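(* Suppose $h_i:=-\sum_{g\in\Gamma_i}\mu_i(g)\log\mu_i(g)<\infty$ for all $i\in\mathcal I$ (with $0\log 0:=0$). Then the asymptotic entropy $h=\lim_{n\to\infty}\frac1n\mathbb{E}[-\log\pi_n(X_n)]$ of the random walk $(X_n)_{n\ge0}$ on the free product of groups $\Gamma=\Gamma_1\ast\dots\ast\Gamma_r$ is given by $$h=-\sum_{i\in\mathcal I}\sum_{g\in\Gamma_i}\alpha_i\mu_i(g)\Bigl[\bigl(1-\varrho(i)\bigr)\log F_i(o_i,g|\xi_i)+(1-\xi_i)\,G_i(o_i,o_i|\xi_i)\,\mathcal F(g)\Bigr],$$ where $\varrho(i)=1-(1-\xi_i)G_i(o_i,o_i|\xi_i)$ and, for $g\in\Gamma_i$, $$\mathcal F(g)=\sum_{g'\in\Gamma_i^\times}F_i(o_i,g'|\xi_i)\log\frac{F_i(o_i,gg'|\xi_i)}{F_i(o_i,g'|\xi_i)}.$$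
   Context: Let $r\ge2$, $\mathcal I=\{1,\dots,r\}$. For each $i\in\mathcal I$, $\Gamma_i$ is a finitely generated group with identity $e_i=o_i$ (the $\Gamma_i$ taken pairwise disjoint), $\Gamma_i^\times=\Gamma_i\setminus\{e_i\}$, and $\mu_i$ is a probability measure on $\Gamma_i^\times$ (extended by $\mu_i(e_i)=0$) whose support generates $\Gamma_i$ as a semigroup. The case $r=2=|\Gamma_1|=|\Gamma_2|$ is excluded. The random walk on $\Gamma_i$ governed by $\mu_i$ has transition probabilities $p_i(x,y)=\mu_i(x^{-1}y)$ and $n$-step probabilities $p_i^{(n)}(x,y)$. Let $\alpha_1,\dots,\alpha_r>0$ with $\sum_i\alpha_i=1$. $\Gamma=\Gamma_1\ast\dots\ast\Gamma_r$ is the free product of groups with identity $e$, and $\mu$ is the probability measure on $\Gamma$ with $\mu(w)=\alpha_i\mu_i(w)$ if $w\in\Gamma_i^\times$, $\mu(w)=0$ otherwise. $(X_n)_{n\ge0}$ is the random walk on $\Gamma$ with $X_0=e$ and transition probabilities $p(x,y)=\mu(x^{-1}y)$; $\pi_n$ is the distribution of $X_n$. Generating functions: $G_i(x,y|z)=\sum_{n\ge0}p_i^{(n)}(x,y)z^n$; $F_i(x,y|z)=\sum_{n\ge0}\mathbb P[Y^{(i)}_n=y,\ Y^{(i)}_m\ne y\ \forall m\le n-1\mid Y^{(i)}_0=x]z^n$, where $Y^{(i)}$ is the random walk on $\Gamma_i$ governed by $\mu_i$ (so $F_i(x,x|z)=1$). With $T_e=\inf\{m\ge1:X_m=e\}$,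 $\overline H_i(z)=\sum_{n\ge1}\mathbb P[T_e=n,\ X_1\notin\Gamma_i^\times]z^n$ and $\xi_i=\xi_i(1)$, where $\xi_i(z)=\alpha_iz/(1-\overline H_i(z))$; it is known that $0<\xi_i<1$. *)

(* Defs.v *)
From HB Require Import structures.
From mathcomp Require Import all_boot all_order all_algebra.
From mathcomp Require Import all_classical all_reals all_analysis.

Set Implicit Arguments.
Unset Strict Implicit.
Unset Printing Implicit Defensive.
Import Order.TTheory GRing.Theory Num.Theory.
Import numFieldNormedType.Exports.

Local Open Scope classical_set_scope.
Local Open Scope ring_scope.

Section FreeProductWords.
Context {I : choiceType} (G : I -> groupType).
Local Open Scope group_scope.

Local Notation letter := {i : I & G i}.
Local Notation word := (seq letter).
Local Notation Tg := (Tagged G).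
Implicit Types (a b : letter) (s t u : word).

Definition reduced s : bool :=
  all (fun a => tagged a != 1) s && sorted (fun a b => tag a != tag b) s.

Definition cons_letter (i : I) (x : G i) s : word :=
  if x == 1 then s else Tg x :: s.

(* Reduced form of the concatenation of one letter (possibly trivial) with a
   reduced word. *)
Definition lact a s : word :=
  if s is b :: s' then
    if tag b == tag a then cons_letter (tagged a * tagged_as a b) s'
    else cons_letter (tagged a) s
  else cons_letter (tagged a) s.

Definition wmul s t : word := foldr lact t s.

Definition winv s : word := rev [seq Tg (tagged a)^-1 | a <- s].

Lemma reduced_cons a s : reduced (a :: s) =
  [&& tagged a != 1, (if s is b :: _ then tag a != tag b else true)
    & reduced s].
Proof.
rewrite /reduced /=; case: s => [|b s] /=; first by rewrite !andbT.
by rewrite -!andbA; do !bool_congr.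
Qed.

Lemma reduced_behead a s : reduced (a :: s) -> reduced s.
Proof. by rewrite reduced_cons => /and3P[]. Qed.

Lemma lact_eq i (x y : G i) s :
  lact (Tg x) (Tg y :: s) = cons_letter (x * y) s.
Proof. by rewrite /lact /= eqxx (@tagged_asE I (fun i => G i) (Tg x) y). Qed.

Lemma lact_neq a b s : tag b != tag a ->
  lact a (b :: s) = cons_letter (tagged a) (b :: s).
Proof. by move=> /negbTE ab; rewrite /lact ab. Qed.

Lemma lact_far i (x : G i) s :
  (if s is b :: _ then i != tag b else true) ->
  lact (Tg x) s = cons_letter x s.
Proof. by case: s => //= b s; rewrite eq_sym => /negbTE ->. Qed.

Lemma reduced_cons_letter i (x : G i) s :
  (if s is b :: _ then i != tag b else true) ->
  reduced s -> reduced (cons_letter x s).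
Proof.
rewrite /cons_letter => far rs; case: eqVneq => // xN1.
by rewrite reduced_cons xN1 far.
Qed.

Lemma reduced_lact a s : reduced s -> reduced (lact a s).
Proof.
case: a => i x; case: s => [|[j y] s] rs.
  exact: reduced_cons_letter.
have [ij|ij] := eqVneq j i.
  move: y rs; rewrite {}ij => y; rewrite reduced_cons => /and3P[_ far rs].
  by rewrite (lact_eq x y); exact: reduced_cons_letter.
rewrite lact_neq //=; apply: reduced_cons_letter => //=.
by rewrite eq_sym.
Qed.

Lemma lact1 i s : reduced s -> lact (Tg (1 : G i)) s = s.
Proof.
case: s => [|[j y] s] rs; first by rewrite /lact /cons_letter eqxx.
have [ij|ij] := eqVneq j i; last by rewrite lact_neq //= /cons_letter eqxx.
move: y rs; rewrite {}ij => y; rewrite reduced_cons => /and3P[y1 _ _].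
by rewrite (lact_eq 1 y) mul1g /cons_letter (negbTE y1).
Qed.

Lemma lact_cons_letter i (x y : G i) s :
  (if s is b :: _ then i != tag b else true) ->
  lact (Tg x) (cons_letter y s) = cons_letter (x * y) s.
Proof.
move=> far; rewrite {1}/cons_letter; case: eqVneq => [->|_].
  by rewrite mulg1 lact_far.
exact: lact_eq.
Qed.

Lemma lactM i (x y : G i) s : reduced s ->
  lact (Tg x) (lact (Tg y) s) = lact (Tg (x * y)) s.
Proof.
case: s => [|[j z] s] rs; first exact: lact_cons_letter.
have [ij|ij] := eqVneq j i.
  move: z rs; rewrite {}ij => z; rewrite reduced_cons => /and3P[_ far _].
  by rewrite (lact_eq y z) (lact_eq (x * y) z) lact_cons_letter // mulgA.
rewrite !(@lact_neq _ (Tg z)) //= lact_cons_letter //=.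
by rewrite eq_sym.
Qed.

Lemma reduced_wmul s t : reduced t -> reduced (wmul s t).
Proof. by move=> rt; elim: s => //= a s; exact: reduced_lact. Qed.

Lemma wmul_cons_letter i (x : G i) s t : reduced t ->
  wmul (cons_letter x s) t = lact (Tg x) (wmul s t).
Proof.
rewrite /cons_letter => rt; case: eqVneq => [->|//].
by rewrite lact1 //; exact: reduced_wmul.
Qed.

Lemma wmul_lact a s t : reduced s -> reduced t ->
  wmul (lact a s) t = lact a (wmul s t).
Proof.
case: a => i x; case: s => [|[j y] s] rs rt; first exact: wmul_cons_letter.
have [ij|ij] := eqVneq j i.
  move: y rs; rewrite {}ij => y _.
  rewrite (lact_eq x y) wmul_cons_letter //= lactM //.
  exact: reduced_wmul.
by rewrite lact_neq // (@wmul_cons_letter i x).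
Qed.

Lemma wmulA s t u : reduced t -> reduced u ->
  wmul s (wmul t u) = wmul (wmul s t) u.
Proof.
move=> rt ru; elim: s => //= a s ->; rewrite wmul_lact //.
exact: reduced_wmul.
Qed.

Lemma wmuls0 s : reduced s -> wmul s [::] = s.
Proof.
elim: s => //= -[i x] s IH rs; rewrite IH ?(reduced_behead rs) //.
move: rs; rewrite reduced_cons => /and3P[x1 far _].
by rewrite lact_far // /cons_letter (negbTE x1).
Qed.

Lemma reduced_winv s : reduced s -> reduced (winv s).
Proof.
rewrite /reduced /winv all_rev rev_sorted all_map sorted_map.
move=> /andP[H1 H2]; apply/andP; split.
  by apply: sub_all H1 => a /=; rewrite invg_eq1.
by apply: sub_sorted H2 => a b /=; rewrite eq_sym.
Qed.

Lemma wmulVs s : reduced s -> wmul (winv s) s = [::].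
Proof.
elim: s => //= -[i x] s IH rs.
have lactV : lact (Tg x^-1) (Tg x :: s) = s.
  by rewrite lact_eq mulVg /cons_letter eqxx.
rewrite /winv map_cons rev_cons -cats1 /wmul foldr_cat.
by rewrite [foldr _ _ [:: _]]lactV; exact: IH (reduced_behead rs).
Qed.

Lemma winvK s : winv (winv s) = s.
Proof.
rewrite /winv map_rev revK -map_comp -[RHS]map_id; apply: eq_map => -[i x] /=.
by rewrite invgK.
Qed.

Lemma wmulsV s : reduced s -> wmul s (winv s) = [::].
Proof.
by move=> rs; rewrite -{1}(winvK s) wmulVs //; exact: reduced_winv.
Qed.

Record free_product : Type :=
  FreeProduct { fp_word :> word; fp_reduced : reduced fp_word }.

HB.instance Definition _ := [isSub for fp_word].
HB.instance Definition _ := [Choice of free_product by <:].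

Implicit Types v w : free_product.

Definition fp_one : free_product := @FreeProduct [::] isT.
Definition fp_mul v w := FreeProduct (reduced_wmul v (fp_reduced w)).
Definition fp_inv v := FreeProduct (reduced_winv (fp_reduced v)).

Lemma fp_mulA : associative fp_mul.
Proof. by move=> ? ? ?; apply/val_inj/wmulA; exact: fp_reduced. Qed.
Lemma fp_mul1g : left_id fp_one fp_mul.
Proof. by move=> ?; exact/val_inj. Qed.
Lemma fp_mulg1 : right_id fp_one fp_mul.
Proof. by move=> ?; apply/val_inj/wmuls0; exact: fp_reduced. Qed.
Lemma fp_mulVg : left_inverse fp_one fp_inv fp_mul.
Proof. by move=> ?; apply/val_inj/wmulVs; exact: fp_reduced. Qed.
Lemma fp_mulgV : right_inverse fp_one fp_inv fp_mul.
Proof. by move=> ?; apply/val_inj/wmulsV; exact: fp_reduced. Qed.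

HB.instance Definition _ :=
  isGroup.Build free_product fp_mulA fp_mul1g fp_mulg1 fp_mulVg fp_mulgV.

Lemma reduced_fp_inj i (x : G i) : reduced (cons_letter x [::]).
Proof. exact: reduced_cons_letter. Qed.

Definition fp_inj i (x : G i) : free_product := FreeProduct (reduced_fp_inj x).

Lemma fp_injM i : {morph @fp_inj i : x y / x * y}.
Proof.
move=> x y; apply/val_inj => /=.
by rewrite wmul_cons_letter ?lact_cons_letter // ; exact: reduced_fp_inj.
Qed.

Definition factor_nontriv i : set free_product :=
  [set fp_inj x | x in [set x : G i | x <> 1]].

End FreeProductWords.

Section Generation.
Variable G : groupType.
Local Open Scope group_scope.

Definition finitely_generated : Prop :=
  exists S : seq G, forall g : G, exists s : seq G,
    {in s, forall x, x \in S \/ x^-1 \in S} /\ g = \prod_(x <- s) x.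

Definition semigroup_generates (A : set G) : Prop :=
  forall g : G, exists s : seq G,
    [/\ s <> [::], {in s, forall x, A x} & g = \prod_(x <- s) x].

End Generation.

Section Sums.
Variable R : realType.

(* Unordered sum of a signed family, valued in the extended reals: it is finite
   only if the family is absolutely summable. *)
Definition usum (T : choiceType) (D : set T) (f : T -> \bar R) : \bar R :=
  (\esum_(x in D) f^\+ x - \esum_(x in D) f^\- x)%E.

Definition prob_mass (T : choiceType) (m : T -> R) : Prop :=
  (forall x, 0 <= m x) /\ (\esum_(x in [set: T]) (m x)%:E = 1)%E.

(* [ln 0 = 0] in the library, so that [0 log 0 = 0]. *)
Definition shannon (T : choiceType) (m : T -> R) : \bar R :=
  (\esum_(x in [set: T]) (- (m x * ln (m x)))%:E)%E.

Definition gen_fun (c : nat -> R) (z : R) : R :=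
  limn (series (fun n => c n * z ^+ n)).

End Sums.

Section RandomWalk.
Context {R : realType} {d : measure_display} {T : measurableType d}.
Variables (P : probability T R) (G : groupType).
Implicit Types (mu : G -> R) (X : nat -> T -> G).

Definition transition mu (x y : G) : R := mu (x^-1 * y)%g.

Definition random_walk mu (x0 : G) X : Prop :=
  [/\ forall n y, measurable (X n @^-1` [set y]),
      P (X 0%N @^-1` [set x0]) = 1%E
    & forall n (x : nat -> G) (y : G),
        P [set w | (forall k, (k <= n)%N -> X k w = x k) /\ X n.+1 w = y] =
        (P [set w | forall k, (k <= n)%N -> X k w = x k]
         * (transition mu (x n) y)%:E)%E].

Definition distribution_at X (n : nat) (y : G) : R :=
  fine (P (X n @^-1` [set y])).

(* For a walk [X] started at [x], the following are [G(x,y|z)] and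
   [F(x,y|z)]. *)
Definition green X (y : G) (z : R) : R :=
  gen_fun (fun n => distribution_at X n y) z.

Definition first_visit X (y : G) (n : nat) : set T :=
  [set w | X n w = y /\ forall m, (m < n)%N -> X m w <> y].

Definition first_passage X (y : G) (z : R) : R :=
  gen_fun (fun n => fine (P (first_visit X y n))) z.

Definition return_time X (y : G) (n : nat) : set T :=
  [set w | [/\ (0 < n)%N, X n w = y
            & forall m, (0 < m < n)%N -> X m w <> y]].

Definition mean_neg_log X (n : nat) : \bar R :=
  ('E_P[fun w => (- ln (distribution_at X n (X n w)))%R])%E.

End RandomWalk.

Section FreeProductWalk.
Context {R : realType} {I : choiceType} (G : I -> groupType).
Variables (alpha : I -> R) (mu : forall i, G i -> R).

Definition fp_measure (w : free_product G) : R :=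
  if fp_word w is [:: a] then alpha (tag a) * mu (tagged a) else 0.

Context {d : measure_display} {T : measurableType d} (P : probability T R).
Variable X : nat -> T -> free_product G.

Definition Hbar (i : I) (z : R) : R :=
  gen_fun (fun n => fine (P (return_time X 1%g n `&`
                             [set w | ~ factor_nontriv i (X 1%N w)]))) z.

Definition xi (i : I) (z : R) : R := alpha i * z / (1 - Hbar i z).

End FreeProductWalk.

(* Main.v *)
Require Import Defs.
From HB Require Import structures.
From mathcomp Require Import all_boot all_order all_algebra.
From mathcomp Require Import all_classical all_reals all_analysis.
From mathcomp Require Import ring lra.

Set Implicit Arguments.
Unset Strict Implicit.
Unset Printing Implicit Defensive.
Import Order.TTheory GRing.Theory Num.Theory.
Import numFieldNormedType.Exports.

Local Open Scope classical_set_scope.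
Local Open Scope ring_scope.

(** By transience the Green function [G] of the walk is finite, and the entropy
    is the rate of escape for the Green distance [L_z(x) = ln G_z(1) - ln G_z(x)]
    with [G_z(x) = \sum_n z^n law_n(x)]. Indeed [law_n <= G_1] bounds the entropy
    of [X_n] below by [E L_1(X_n)] up to a constant, while Gibbs' inequality
    against the probability [(1 - z) G_z] bounds it above by [E L_z(X_n)] up to a
    constant, and [z] may tend to [1] after division by [n].

    By the tree structure of a free product, [L_z(g x) - L_z(x)] with [g] in the
    factor [i] depends only on [g] and on the head of [x], the first letter of
    [x] if it lies in the factor [i] and [1] otherwise. As [X_(n+1)] has the law
    of [g X_n] with [g] an independent step, [E L_z(X_(n+1)) - E L_z(X_n)] is
    computed from the law of the head of [X_n], which converges to
    [(1 - xi_i) G_i(o, . | xi_i)]; this gives the formula.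

    Transience holds because a product of letter weights slightly below [1] is
    superharmonic with a defect at [1]. *)

(** * Unordered sums *)

(** Only the entropies of the [mu i] are assumed finite, so the logarithms to be averaged are signed
    and unbounded. The remedy is the one-step bound [G_z(g x) >= z nu(g) G_z(x)], with [nu] the step
    law: the increment of [L_z] is at most [- ln (z nu(g))], and the nonnegative gap, the slack, is
    what gets averaged. Sums are extended-real and identities are kept free of subtraction, so that
    every exchange of sums rests on positivity alone. At [z = 1] the slack has a summable majorant,
    because [xi_i < 1] makes the Green function summable over a factor. For [z < 1] Fatou's lemma is
    enough: an upper bound on the entropy only asks for lower bounds on the slack. The limit exists
    by squeezing, without subadditivity. The law of the head comes from splitting a path at its last
    visit to the factor [i], outside of which the head is frozen. The same splitting shows that
    [G_1] on the factor solves, up to a constant, the Green equation of [mu i] at [xi_i]. For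
    transience, weights depending only on the factor of a letter fail when [r = 2] and the [mu i]
    are point masses; hence an extra weight on one chosen letter. *)

Section UnorderedSums.
Local Open Scope ereal_scope.
Variable R : realType.
Implicit Types (T : choiceType) (c : \bar R).

(** Scaling by a finite nonzero [c] is undone by [c^-1], so the inequality [le_esumZl], valid for
    all [c], gives its own converse; [c = 0] and [c = +oo] are treated apart. *)
Lemma esumZl T (D : set T) c (f : T -> \bar R) : 0 <= c ->
  (forall x, D x -> 0 <= f x) ->
  \esum_(x in D) (c * f x) = c * \esum_(x in D) f x.
Proof.
have le_esumZl (c' : \bar R) (g : T -> \bar R) : 0 <= c' ->
    (forall x, D x -> 0 <= g x) ->
    \esum_(x in D) (c' * g x) <= c' * \esum_(x in D) g x.
  move=> c0 g0; apply: ge_ereal_sup => /= _ [A [finA AD] <-].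
  rewrite fsbig_finite//= big_seq -ge0_sume_distrr; last first.
    by move=> x; rewrite in_fset_set// inE => /AD/g0.
  rewrite lee_wpmul2l// -big_seq -fsbig_finite//; apply: ereal_sup_ubound.
  by exists A.
move=> c0 f0; apply/eqP; rewrite eq_le le_esumZl//=.
case: c c0 => [c||//] c0; last first.
  have [->|] := eqVneq (\esum_(x in D) f x) 0.
    by rewrite mule0; apply: esum_ge0 => x Dx; rewrite mule_ge0 ?f0.
  rewrite neq_lt ltNge esum_ge0//= => /ereal_sup_gt[_ [A [finA AD] <-]].
  rewrite fsbig_finite//= big_seq lt_neqAle => /andP[+ _].
  have [A0|] := pselect (forall x, A x -> f x = 0).
    by rewrite big1 ?eqxx// => x; rewrite in_fset_set// inE => /A0.
  move=> /existsNP[x /not_implyP[Ax /eqP fx0]] _.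
  rewrite (le_trans (leey _))// esum_ge//; exists [set x].
    by split=> // _ ->; exact: AD.
  by rewrite fsbig_set1 gt0_mulye// lt_neqAle eq_sym fx0 f0//; exact: AD.
have [<-|cN0] := eqVneq 0%R c.
  by rewrite mul0e esum_ge0// => x Dx; rewrite mul0e.
have {c0 cN0}c0 : (0 < c)%R by rewrite lt_neqAle cN0 -lee_fin.
rewrite -(@lee_pmul2l _ c^-1%:E)// ?lte_fin ?invr_gt0//.
rewrite muleA -EFinM mulVf ?gt_eqF// mul1e.
rewrite (le_trans _ (le_esumZl _ _ _ _))//.
- by apply: le_esum => x Dx; rewrite muleA -EFinM mulVf ?gt_eqF// mul1e.
- by rewrite lee_fin invr_ge0 ltW.
- by move=> x Dx; rewrite mule_ge0 ?f0// lee_fin ltW.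
Qed.

Lemma esumZr T (D : set T) c (f : T -> \bar R) : 0 <= c ->
  (forall x, D x -> 0 <= f x) ->
  \esum_(x in D) (f x * c) = (\esum_(x in D) f x) * c.
Proof.
by move=> c0 f0; rewrite muleC -esumZl//; apply: eq_esum => x _; rewrite muleC.
Qed.

Lemma esum_pairE T1 T2 (a : T1 -> T2 -> \bar R) :
  (forall x y, 0 <= a x y) ->
  \esum_(x in [set: T1]) \esum_(y in [set: T2]) a x y =
  \esum_(p in [set: (T1 * T2)%type]) a p.1 p.2.
Proof.
move=> a0; rewrite esum_esum//; congr esum.
by apply/seteqP; split => -[x y].
Qed.

Lemma reindexT_esum T1 T2 (e : T1 -> T2) (a : T2 -> \bar R) : bijective e ->
  \esum_(y in [set: T2]) a y = \esum_(x in [set: T1]) a (e x).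
Proof. by move=> be; apply: reindex_esum; rewrite setTT_bijective. Qed.

Lemma exchange_esum T1 T2 (a : T1 -> T2 -> \bar R) :
  (forall x y, 0 <= a x y) ->
  \esum_(x in [set: T1]) \esum_(y in [set: T2]) a x y =
  \esum_(y in [set: T2]) \esum_(x in [set: T1]) a x y.
Proof.
move=> a0; rewrite !esum_pairE//.
rewrite (@reindexT_esum (T2 * T1)%type _ (fun p => (p.2, p.1)))//.
by exists (fun p => (p.2, p.1)) => -[].
Qed.

Lemma esum_pick T (t : T) (f : T -> \bar R) : 0 <= f t ->
  \esum_(x in [set: T]) (if x == t then f x else 0) = f t.
Proof.
move=> f0; rewrite -[RHS](@esum_set1 _ _ t f)// [RHS]esum_mkcond.
apply: eq_esum => x _; rewrite [x \in _](_ : _ = (x == t))//.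
by apply/idP/eqP; rewrite inE.
Qed.

Lemma le_esum_term T (D : set T) (f : T -> \bar R) (t : T) : D t ->
  (forall x, D x -> 0 <= f x) -> f t <= \esum_(x in D) f x.
Proof.
move=> Dt f0; rewrite -[leLHS](@esum_set1 _ _ t f) ?f0// [leRHS]esum_mkcond.
rewrite [leLHS]esum_mkcond; apply: le_esum => x _.
case: ifPn => [|_]; first by rewrite inE/= => ->; rewrite mem_set.
by case: ifPn => //; rewrite inE => /f0.
Qed.

Lemma esum_eq0P T (D : set T) (f : T -> \bar R) :
  (forall x, D x -> 0 <= f x) -> \esum_(x in D) f x = 0 ->
  forall x, D x -> f x = 0.
Proof.
move=> f0 fD x Dx; apply/eqP; rewrite eq_le f0// andbT.
by rewrite -[leRHS]fD; exact: le_esum_term.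
Qed.

Lemma esum_nat_recl (f : nat -> \bar R) : (forall n, 0 <= f n) ->
  \esum_(n in [set: nat]) f n = f 0%N + \esum_(n in [set: nat]) f n.+1.
Proof.
move=> f0; rewrite -!nneseries_esumT// nneseries_recl//; congr (_ + _).
by rewrite -(@nneseries_addn _ _ 1)//; apply: eq_eseriesr => n _; rewrite addn1.
Qed.

Lemma esum_nat_le (f : nat -> \bar R) c : (forall n, 0 <= f n) ->
  (forall N, \sum_(n < N) f n <= c) -> \esum_(n in [set: nat]) f n <= c.
Proof.
move=> f0 fc; rewrite -nneseries_esumT//; apply: lime_le.
  exact: is_cvg_nneseries.
by apply: nearW => N; rewrite big_mkord.
Qed.

Lemma esum_nat_ge (f : nat -> \bar R) N : (forall n, 0 <= f n) ->
  \sum_(n < N) f n <= \esum_(n in [set: nat]) f n.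
Proof.
move=> f0; rewrite -nneseries_esumT// -(big_mkord xpredT).
exact: nneseries_lim_ge.
Qed.

(** The truncation [k <= n] makes the inner sum range over all [k]; after the exchange, the sum over
    [n] for fixed [k] is a shift by [k], which the last induction removes. *)
Lemma esum_cauchy_product (a b : nat -> \bar R) :
  (forall n, 0 <= a n) -> (forall n, 0 <= b n) ->
  \esum_(n in [set: nat]) \sum_(k < n.+1) (a k * b (n - k)%N) =
  (\esum_(n in [set: nat]) a n) * (\esum_(n in [set: nat]) b n).
Proof.
move=> a0 b0.
have b0' := esum_ge0 (fun n (_ : [set: nat] n) => b0 n).
rewrite -esumZr//.
transitivity (\esum_(n in [set: nat]) \esum_(k in [set: nat])
    (if (k <= n)%N then a k * b (n - k)%N else 0)).
  apply: eq_esum => n _.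
  rewrite (_ : (fun k => _) = fun k => if k \in `I_n.+1 then a k * b (n - k)%N else 0); last first.
    apply/funext => k; rewrite [k \in _](_ : _ = (k <= n)%N)//.
    by apply/idP/idP; rewrite inE.
  rewrite -(@esum_mkcond R nat `I_n.+1 (fun k => a k * b (n - k)%N)).
  rewrite esum_fset//=; last by move=> k _; rewrite mule_ge0.
  by rewrite -fsbig_ord.
rewrite exchange_esum; last by move=> n k; case: ifP => // _; rewrite mule_ge0.
apply: eq_esum => k _; rewrite -esumZl//.
elim: k (a k) (a0 k) => [|k IH] ak ak0.
  by apply: eq_esum => n _; rewrite subn0.
rewrite [LHS]esum_nat_recl; last by move=> n /=; case: ifP => // _; rewrite mule_ge0.
by rewrite ltn0 add0e; under eq_esum do rewrite ltnS subSS; exact: IH.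
Qed.

(** Some finite partial sum of [l] already exceeds [c], and finite sums pass to the limit. *)
Lemma esum_fatou U (F : set_system U) {FF : ProperFilter F} T
    (f : U -> T -> \bar R) (l : T -> \bar R) c :
  (forall u x, 0 <= f u x) -> (forall x, f^~ x @ F --> l x) ->
  c < \esum_(x in [set: T]) l x ->
  \forall u \near F, c < \esum_(x in [set: T]) f u x.
Proof.
move=> f0 fl /ereal_sup_gt[_ [A [finA _] <-]]; rewrite fsbig_finite//= => cA.
have : (\sum_(x <- finmap.enum_fset (fset_set A)) f u x)%R @[u --> F] -->
    (\sum_(x <- finmap.enum_fset (fset_set A)) l x)%R.
  by apply: (@cvg_nnesum _ _ _ _ _ _ (fun x u => f u x)) => // x _; exact: nearW.
move=> /(_ _ (open_ereal_gt' cA)) near_c; near=> u.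
have cu : c < (\sum_(x <- finmap.enum_fset (fset_set A)) f u x)%R.
  by near: u; exact: near_c.
rewrite (lt_le_trans cu)//; apply: ereal_sup_ubound; exists A => //.
by rewrite fsbig_finite.
Unshelve. all: by end_near. Qed.

(** Fatou's lemma is used twice: on [f u] for the lower bound and on [g - f u] for the upper one. *)
Lemma esum_dominated U (F : set_system U) {FF : ProperFilter F} T
    (f : U -> T -> R) (l g : T -> R) :
  (forall u x, (0 <= f u x <= g x)%R) -> (forall x, f^~ x @ F --> l x) ->
  \esum_(x in [set: T]) (g x)%:E < +oo ->
  (fun u => \esum_(x in [set: T]) (f u x)%:E) @ F -->
    \esum_(x in [set: T]) (l x)%:E.
Proof.
move=> fg fl g_fin.
have f0 u x : (0 <= f u x)%R by have /andP[] := fg u x.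
have fle u x : (f u x <= g x)%R by have /andP[] := fg u x.
have lg x : (0 <= l x <= g x)%R.
  apply/andP; split.
    by apply: (cvgr_to_ge (fl x)); apply: nearW.
  by apply: (cvgr_to_le (fl x)); apply: nearW.
have l0 x : (0 <= l x)%R by have /andP[] := lg x.
have lle x : (l x <= g x)%R by have /andP[] := lg x.
set S := fun h : T -> R => \esum_(x in [set: T]) (h x)%:E.
have SB (h : T -> R) : (forall x, 0 <= h x)%R -> (forall x, h x <= g x)%R ->
    S g = S h + S (g \- h)%R.
  move=> h0 hg; rewrite /S -esumD//=.
  - by apply: eq_esum => x _; rewrite -EFinD addrC subrK.
  - by move=> x _; rewrite lee_fin.
  - by move=> x _; rewrite lee_fin subr_ge0.
have Sfin (h : T -> R) : (forall x, 0 <= h x)%R -> (forall x, h x <= g x)%R ->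
    S h \is a fin_num.
  move=> h0 hg; rewrite ge0_fin_numE; last first.
    by apply: esum_ge0 => x _; rewrite lee_fin.
  by apply: le_lt_trans g_fin; apply: le_esum => x _; rewrite lee_fin.
have SBfin (h : T -> R) : (forall x, 0 <= h x)%R -> (forall x, h x <= g x)%R ->
    S (g \- h)%R \is a fin_num.
  by move=> h0 hg; apply: Sfin => x /=; rewrite ?subr_ge0// gerBl.
rewrite -/(S l) -[S l]fineK; last exact: Sfin.
apply/fine_cvgP; split; first by apply: nearW => u; exact: Sfin.
apply/cvgrPdist_lt => e e0; near=> u; rewrite /= -/(S (f u)).
rewrite ltr_norml ltrBrDl ltrBlDl; apply/andP; split.
  have : (fine (S (g \- l)%R) - e)%:E < S (g \- f u)%R.
    near: u; apply: (@esum_fatou _ _ _ _ (fun u x => (g x - f u x)%:E) (fun x => (g x - l x)%:E)).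
    - by move=> u x; rewrite lee_fin subr_ge0.
    - move=> x; apply: cvg_EFin; first exact: nearW.
      by apply: cvgB; [exact: cvg_cst|exact: fl].
    - rewrite -/(S (g \- l)%R) EFinB fineK ?SBfin// lteBlDr//.
      by rewrite lteDl ?SBfin// lte_fin.
  rewrite -(fineK (SBfin _ (f0 u) (fle u))) lte_fin.
  have := SB _ (f0 u) (fle u); rewrite (SB _ l0 lle).
  rewrite -(fineK (Sfin _ (f0 u) (fle u))) -(fineK (SBfin _ (f0 u) (fle u))).
  rewrite -(fineK (Sfin _ l0 lle)) -(fineK (SBfin _ l0 lle)) -!EFinD.
  by move=> [] ? ?; lra.
have : (fine (S l) - e)%:E < S (f u).
  near: u; apply: (@esum_fatou _ _ _ _ (fun u x => (f u x)%:E) (fun x => (l x)%:E)).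
  - by move=> u x; rewrite lee_fin.
  - by move=> x; apply: cvg_EFin; [exact: nearW|exact: fl].
  - by rewrite -/(S l) EFinB fineK ?Sfin// lteBlDr// lteDl ?Sfin// lte_fin.
rewrite -(fineK (Sfin _ (f0 u) (fle u))) lte_fin/=; lra.
Unshelve. all: by end_near. Qed.

End UnorderedSums.

(** * Random walks on a group and their Green functions *)

Lemma mulVg_eq1 (G : groupType) (x y : G) : (x^-1 * y == 1)%g = (x == y).
Proof. by rewrite mulg_eq1 (inj_eq invg_inj). Qed.

Section Convolution.
Local Open Scope ereal_scope.
Variables (R : realType) (G : groupType) (m : G -> R).
Hypothesis m_prob : prob_mass m.
Implicit Types (u v : G -> \bar R) (x y g s : G) (A : nat -> pred G).

Let m0 x : 0 <= (m x)%:E. Proof. by rewrite lee_fin; case: m_prob. Qed.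
Let m1 : \esum_(x in [set: G]) (m x)%:E = 1. Proof. by case: m_prob. Qed.

Definition dirac_mass (x : G) : \bar R := if x == 1%g then 1 else 0.

Definition walk_step u y : \bar R :=
  \esum_(x in [set: G]) (u x * (m (x^-1 * y)%g)%:E).

(* Law at time [n] of the walk killed as soon as it violates [A]. *)
Fixpoint restricted_law A (n : nat) : G -> \bar R :=
  if n is n'.+1 then
    fun y => if A n'.+1 y then walk_step (restricted_law A n') y else 0
  else fun y => if A 0%N y then dirac_mass y else 0.

Definition law : nat -> G -> \bar R := restricted_law (fun _ _ => true).

Lemma dirac_mass_ge0 x : 0 <= dirac_mass x.
Proof. by rewrite /dirac_mass; case: ifP. Qed.

Lemma walk_step_ge0 u : (forall x, 0 <= u x) -> forall y, 0 <= walk_step u y.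
Proof. by move=> u0 y; apply: esum_ge0 => x _; rewrite mule_ge0. Qed.

Lemma restricted_law_ge0 A n x : 0 <= restricted_law A n x.
Proof.
elim: n x => [|n IH] x /=; case: ifP => // _; first exact: dirac_mass_ge0.
exact: walk_step_ge0.
Qed.

Lemma law_ge0 n x : 0 <= law n x. Proof. exact: restricted_law_ge0. Qed.

Lemma lawS n x : law n.+1 x = walk_step (law n) x. Proof. by []. Qed.

Lemma eq_walk_step u v : u =1 v -> walk_step u =1 walk_step v.
Proof. by move=> uv y; apply: eq_esum => x _; rewrite uv. Qed.

Lemma le_walk_step u v : (forall x, u x <= v x) ->
  forall y, walk_step u y <= walk_step v y.
Proof. by move=> uv y; apply: le_esum => x _; rewrite lee_wpmul2r. Qed.

Lemma walk_stepD u v y : (forall x, 0 <= u x) -> (forall x, 0 <= v x) ->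
  walk_step (fun x => u x + v x) y = walk_step u y + walk_step v y.
Proof.
move=> u0 v0; rewrite /walk_step -esumD; try by move=> x _; rewrite mule_ge0.
by apply: eq_esum => x _; rewrite ge0_muleDl.
Qed.

Lemma walk_stepZ c u y : 0 <= c -> (forall x, 0 <= u x) ->
  walk_step (fun x => c * u x) y = c * walk_step u y.
Proof.
move=> c0 u0; rewrite /walk_step -esumZl//; last by move=> x _; rewrite mule_ge0.
by apply: eq_esum => x _; rewrite muleA.
Qed.

Lemma walk_step_esum (T : choiceType) (f : T -> G -> \bar R) y :
  (forall t x, 0 <= f t x) ->
  walk_step (fun x => \esum_(t in [set: T]) f t x) y =
  \esum_(t in [set: T]) walk_step (f t) y.
Proof.
move=> f0; rewrite /walk_step exchange_esum; last by move=> *; rewrite mule_ge0.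
by apply: eq_esum => x _; rewrite esumZr.
Qed.

Lemma walk_step_sum (n : nat) (f : 'I_n -> G -> \bar R) y :
  (forall k x, 0 <= f k x) ->
  walk_step (fun x => \sum_(k < n) f k x) y = \sum_(k < n) walk_step (f k) y.
Proof.
move=> f0; rewrite /walk_step -esum_sum; last by move=> *; rewrite mule_ge0.
by apply: eq_esum => x _; rewrite ge0_sume_distrl.
Qed.

(** Steps multiply on the right, hence commute with left translations. *)
Lemma walk_step_translate g u y :
  walk_step (fun x => u (g^-1 * x)%g) y = walk_step u (g^-1 * y)%g.
Proof.
rewrite /walk_step (@reindexT_esum _ _ _ (fun x => g * x)%g); last first.
  by exists (fun x => g^-1 * x)%g => x; rewrite (mulKg, mulVKg).
by apply: eq_esum => x _; rewrite mulKg invgM !mulgA.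
Qed.

Lemma walk_step_dirac y : walk_step dirac_mass y = (m y)%:E.
Proof.
rewrite /walk_step; transitivity (\esum_(x in [set: G])
    (if x == 1%g then (m (x^-1 * y)%g)%:E else 0)).
  by apply: eq_esum => x _; rewrite /dirac_mass; case: ifP; rewrite (mul1e, mul0e).
by rewrite (esum_pick (f := fun x => (m (x^-1 * y)%g)%:E))// invg1 mul1g.
Qed.

Lemma esum_dirac_mass : \esum_(x in [set: G]) dirac_mass x = 1.
Proof. exact: (@esum_pick R G 1%g (fun=> 1)). Qed.

(** Adjointness: a step of the measure [u] is traded for an average of [f] over one step, the form
    in which superharmonicity enters. *)
Lemma esum_walk_step_mul u (f : G -> \bar R) :
  (forall x, 0 <= u x) -> (forall x, 0 <= f x) ->
  \esum_(y in [set: G]) (walk_step u y * f y) =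
  \esum_(x in [set: G]) (u x * \esum_(s in [set: G]) ((m s)%:E * f (x * s)%g)).
Proof.
move=> u0 f0; rewrite /walk_step.
transitivity (\esum_(y in [set: G]) \esum_(x in [set: G])
   (u x * ((m (x^-1 * y)%g)%:E * f y))).
  apply: eq_esum => y _; rewrite -esumZr//; last first.
    by move=> x _; rewrite mule_ge0.
  by apply: eq_esum => x _; rewrite muleA.
rewrite exchange_esum; last by move=> *; rewrite !mule_ge0.
apply: eq_esum => x _; rewrite -esumZl//; last by move=> s _; rewrite mule_ge0.
rewrite (@reindexT_esum _ _ _ (fun s => x * s)%g); last first.
  by exists (fun s => x^-1 * s)%g => s; rewrite (mulKg, mulVKg).
by apply: eq_esum => s _; rewrite mulKg.
Qed.

Lemma esum_walk_step u : (forall x, 0 <= u x) ->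
  \esum_(y in [set: G]) walk_step u y = \esum_(x in [set: G]) u x.
Proof.
move=> u0; have := @esum_walk_step_mul u (fun=> 1) u0 (fun=> @lee01 R).
under eq_esum do rewrite mule1.
move=> ->; apply: eq_esum => x _; under eq_esum do rewrite mule1.
by rewrite m1 mule1.
Qed.

Lemma esum_law n : \esum_(x in [set: G]) law n x = 1.
Proof.
elim: n => [|n IH]; first exact: esum_dirac_mass.
by rewrite -IH -(esum_walk_step (law_ge0 n)).
Qed.

Lemma law_le1 n x : law n x <= 1.
Proof. by rewrite -(esum_law n); apply: le_esum_term => // y _; exact: law_ge0. Qed.

Lemma law_fin n x : law n x \is a fin_num.
Proof. by rewrite ge0_fin_numE ?law_ge0// (le_lt_trans (law_le1 _ _)) ?ltry. Qed.

(** [law] peels off the last step; this peels off the first, since left translations commute with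
    steps. The recursion for the Green distance needs this side, where a letter is put in front of
    the word. *)
Lemma lawSl n y :
  law n.+1 y = \esum_(s in [set: G]) ((m s)%:E * law n (s^-1 * y)%g).
Proof.
elim: n y => [|n IH] y.
  rewrite lawS walk_step_dirac -[LHS](@esum_pick R G y (fun x => (m x)%:E))//.
  apply: eq_esum => s _; rewrite /law /= /dirac_mass mulVg_eq1.
  by case: eqVneq; rewrite (mule1, mule0).
rewrite lawS (eq_walk_step IH) walk_step_esum; last first.
  by move=> s x; rewrite mule_ge0 ?law_ge0.
apply: eq_esum => s _; rewrite walk_stepZ//; last by move=> x; exact: law_ge0.
by rewrite walk_step_translate.
Qed.

(** * First visits and Green functions *)

Definition avoiding g : nat -> G -> \bar R := restricted_law (fun _ x => x != g).

Definition hitting g (n : nat) : \bar R :=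
  if n is n'.+1 then walk_step (avoiding g n') g else dirac_mass g.

Lemma avoiding_ge0 g n x : 0 <= avoiding g n x.
Proof. exact: restricted_law_ge0. Qed.

Lemma hitting_ge0 g n : 0 <= hitting g n.
Proof.
case: n => [|n]; first exact: dirac_mass_ge0.
exact/walk_step_ge0/avoiding_ge0.
Qed.

Lemma avoiding_self g n : avoiding g n g = 0.
Proof. by rewrite /avoiding; case: n => [|n] /=; rewrite eqxx. Qed.

Lemma walk_step_avoiding g n y :
  walk_step (avoiding g n) y =
  avoiding g n.+1 y + (if y == g then hitting g n.+1 else 0).
Proof.
rewrite {2}/avoiding /=; case: eqVneq => [->|_] /=; first by rewrite add0e.
by rewrite adde0.
Qed.

(** The mass that a step of the avoiding walk puts on [g] is the new first-visit term; all earlier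
    terms just advance by one step. *)
Lemma law_first_visit g n x :
  law n x = avoiding g n x + \sum_(k < n.+1) (hitting g k * law (n - k) (g^-1 * x)%g).
Proof.
elim: n x => [|n IH] x.
  rewrite big_ord1 subnn /avoiding /law /= /dirac_mass mulVg_eq1.
  have [->|xN1] := eqVneq x 1%g; last first.
    rewrite if_same add0e; case: (eqVneq g 1%g) => [->|]; rewrite ?mul0e//.
    by rewrite mul1e eq_sym (negbTE xN1).
  by rewrite [1%g == g]eq_sym; case: eqVneq; rewrite /= ?mule1 ?mul0e ?add0e ?adde0.
have h0 k j y : 0 <= hitting g k * law j (g^-1 * y)%g.
  by rewrite mule_ge0 ?hitting_ge0 ?law_ge0.
rewrite lawS (eq_walk_step IH) walk_stepD; last 2 first.
- by move=> y; exact: avoiding_ge0.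
- by move=> y; exact: sume_ge0.
rewrite walk_step_avoiding -addeA; congr (_ + _).
rewrite walk_step_sum//= [RHS]big_ord_recr /= subnn addeC; congr (_ + _).
  apply: eq_bigr => k _; rewrite walk_stepZ ?hitting_ge0//; last first.
    by move=> y; exact: law_ge0.
  by rewrite (walk_step_translate g (law (n - k))) -lawS subSn// -ltnS.
rewrite /law /= /dirac_mass mulVg_eq1 eq_sym.
by case: ifP; rewrite (mule1, mule0).
Qed.

(** Mass is conserved: what leaves the avoiding walk at a step is what arrives at [g]. *)
Lemma esum_avoiding_hitting g n :
  \esum_(x in [set: G]) avoiding g n x + \sum_(k < n.+1) hitting g k = 1.
Proof.
elim: n => [|n IH].
  rewrite big_ord1 -[RHS]esum_dirac_mass /=.
  rewrite -[dirac_mass g](@esum_pick R G g dirac_mass) ?dirac_mass_ge0//.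
  rewrite -esumD; last 2 first.
  - by move=> x _; exact: avoiding_ge0.
  - by move=> x _; case: ifP => // _; exact: dirac_mass_ge0.
  apply: eq_esum => x _; rewrite /avoiding /=.
  by case: eqVneq; rewrite /= (add0e, adde0).
rewrite -[RHS]IH -(esum_walk_step (avoiding_ge0 g n)) big_ord_recr /= addeA addeAC.
congr (_ + _).
rewrite -[walk_step (avoiding g n) g](@esum_pick R G g (walk_step (avoiding g n))); last first.
  exact/walk_step_ge0/avoiding_ge0.
rewrite -esumD; last 2 first.
- by move=> x _; exact: avoiding_ge0.
- by move=> x _; case: ifP => // _; exact/walk_step_ge0/avoiding_ge0.
apply: eq_esum => x _; rewrite [RHS]walk_step_avoiding; congr (_ + _).
by case: eqP => // ->.
Qed.

Lemma hitting_fin g n : hitting g n \is a fin_num.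
Proof.
rewrite ge0_fin_numE ?hitting_ge0// (@le_lt_trans _ _ 1) ?ltry//.
rewrite -(esum_avoiding_hitting g n) big_ord_recr /= addeA leeDr// adde_ge0//.
  by apply: esum_ge0 => x _; exact: avoiding_ge0.
by apply: sume_ge0 => k _; exact: hitting_ge0.
Qed.

Definition green_fun (z : R) x : \bar R :=
  \esum_(n in [set: nat]) ((z ^+ n)%:E * law n x).

Definition hitting_fun (z : R) g : \bar R :=
  \esum_(n in [set: nat]) ((z ^+ n)%:E * hitting g n).

Section FixedParameter.
Variables (z : R).
Hypothesis z0 : (0 <= z)%R.

Let zn0 n : 0 <= (z ^+ n)%:E. Proof. by rewrite lee_fin exprn_ge0. Qed.

Lemma green_fun_ge0 x : 0 <= green_fun z x.
Proof. by apply: esum_ge0 => n _; rewrite mule_ge0 ?law_ge0. Qed.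

Lemma hitting_fun_ge0 g : 0 <= hitting_fun z g.
Proof. by apply: esum_ge0 => n _; rewrite mule_ge0 ?hitting_ge0. Qed.

Lemma green_fun_recl y : green_fun z y =
  dirac_mass y + z%:E * \esum_(s in [set: G]) ((m s)%:E * green_fun z (s^-1 * y)%g).
Proof.
rewrite {1}/green_fun esum_nat_recl; last by move=> n; rewrite mule_ge0 ?law_ge0.
rewrite expr0 mul1e; congr (_ + _).
transitivity (z%:E * \esum_(s in [set: G]) \esum_(n in [set: nat])
    ((m s)%:E * ((z ^+ n)%:E * law n (s^-1 * y)%g))); last first.
  congr (_ * _); apply: eq_esum => s _; rewrite esumZl// => n _.
  by rewrite mule_ge0 ?law_ge0.
rewrite exchange_esum; last by move=> *; rewrite !mule_ge0 ?law_ge0.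
rewrite -esumZl//; last first.
  by move=> n _; apply: esum_ge0 => s _; rewrite !mule_ge0 ?law_ge0.
apply: eq_esum => n _; rewrite lawSl exprS EFinM -muleA; congr (_ * _).
rewrite -esumZl//; last by move=> s _; rewrite mule_ge0 ?law_ge0.
by apply: eq_esum => s _; rewrite muleCA.
Qed.

(** One term of the first-step recursion is kept. This Harnack-type bound is what later makes
    [slack] nonnegative. *)
Lemma green_fun_step_ge s x :
  z%:E * ((m s)%:E * green_fun z x) <= green_fun z (s * x)%g.
Proof.
rewrite [leRHS]green_fun_recl; apply: lee_paddl; first exact: dirac_mass_ge0.
rewrite lee_wpmul2l//.
rewrite (le_trans _ (@le_esum_term R G setT _ s _ _))// ?mulKg// => t _.
by rewrite mule_ge0 ?green_fun_ge0.
Qed.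

(** Without the avoiding term, the first-visit decomposition is a pure convolution, so its
    generating function factors. It is used at [x = g] and, thanks to the tree structure, at every
    word that starts by [g]. *)
Lemma green_fun_first_visit g x : (forall n, avoiding g n x = 0) ->
  green_fun z x = hitting_fun z g * green_fun z (g^-1 * x)%g.
Proof.
move=> gx; rewrite -esum_cauchy_product; last 2 first.
- by move=> n; rewrite mule_ge0 ?hitting_ge0.
- by move=> n; rewrite mule_ge0 ?law_ge0.
apply: eq_esum => n _; rewrite (law_first_visit g) gx add0e ge0_sume_distrr.
  apply: eq_bigr => k _; rewrite muleACA -EFinM -exprD subnKC//.
  by rewrite -ltnS.
by move=> k _; rewrite mule_ge0 ?hitting_ge0 ?law_ge0.
Qed.

Lemma green_funE g : green_fun z g = hitting_fun z g * green_fun z 1%g.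
Proof.
by rewrite (green_fun_first_visit (avoiding_self g)) mulVg.
Qed.

Lemma hitting_fun_le1 g : (z <= 1)%R -> hitting_fun z g <= 1.
Proof.
move=> z1; apply: esum_nat_le => [n|N]; first by rewrite mule_ge0 ?hitting_ge0.
rewrite (@le_trans _ _ (\sum_(k < N.+1) hitting g k))//; last first.
  rewrite -(esum_avoiding_hitting g N) leeDr// esum_ge0// => x _.
  exact: avoiding_ge0.
rewrite big_ord_recr/= lee_paddr ?hitting_ge0//; apply: lee_sum => k _.
by rewrite gee_pMl ?hitting_ge0// ?lee_fin ?exprn_ile1//.
Qed.

Lemma green_fun_le g : (z <= 1)%R -> green_fun z g <= green_fun z 1%g.
Proof.
move=> z1; rewrite green_funE gee_pMl ?green_fun_ge0 ?hitting_fun_le1//.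
rewrite ge0_fin_numE ?hitting_fun_ge0//.
by rewrite (le_lt_trans (hitting_fun_le1 g z1)) ?ltry.
Qed.

Lemma esum_green_fun : (z < 1)%R ->
  \esum_(x in [set: G]) green_fun z x = ((1 - z)^-1)%:E.
Proof.
move=> z1; have z1' : (0 < 1 - z)%R by rewrite subr_gt0.
rewrite /green_fun exchange_esum; last by move=> *; rewrite mule_ge0 ?law_ge0.
transitivity (\esum_(n in [set: nat]) (z ^+ n)%:E).
  apply: eq_esum => n _; rewrite esumZl// => [|x _]; last exact: law_ge0.
  by rewrite esum_law mule1.
set S := esum _ _.
have S0 : 0 <= S by exact: esum_ge0.
have SE : S = 1 + z%:E * S.
  rewrite {1}/S esum_nat_recl// expr0 -esumZl//; congr (_ + _).
  by apply: eq_esum => n _; rewrite -EFinM -exprS.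
have Sfin : S \is a fin_num.
  rewrite ge0_fin_numE// (@le_lt_trans _ _ ((1 - z)^-1)%:E) ?ltry//.
  apply: esum_nat_le => // N; rewrite sumEFin lee_fin -div1r ler_pdivlMr//.
  have -> : ((\sum_(n < N) z ^+ n) * (1 - z) = 1 - z ^+ N)%R.
    by rewrite mulrC -[LHS]opprK -mulNr opprB -subrX1 opprB.
  by rewrite gerBl exprn_ge0.
move: SE; rewrite -(fineK Sfin) -EFinM -EFinD => -[SE].
congr (_%:E); apply: (@mulfI _ (1 - z)%R); first by rewrite gt_eqF.
by rewrite divff ?gt_eqF// mulrBl mul1r {1}SE addrK.
Qed.

(** Iterating the equation [N] times produces the partial sum of the Green series plus a remainder
    of at most [z ^+ N * C]. *)
Lemma green_fun_unique (Phi : G -> \bar R) (C : R) : (z < 1)%R ->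
  (forall x, 0 <= Phi x <= C%:E) ->
  (forall y, Phi y = dirac_mass y + z%:E * walk_step Phi y) ->
  Phi =1 green_fun z.
Proof.
move=> z1 PhiC PhiE.
have Phi0 x : 0 <= Phi x by have /andP[] := PhiC x.
have zl0 n x : 0 <= (z ^+ n)%:E * law n x by rewrite mule_ge0 ?law_ge0.
have S0 N x : 0 <= \sum_(n < N) ((z ^+ n)%:E * law n x) by exact: sume_ge0.
have C0 : (0 <= C)%R.
  by rewrite -lee_fin; have /andP[/le_trans] := PhiC 1%g; apply.
have stepS N y : walk_step (fun x => \sum_(n < N) ((z ^+ n)%:E * law n x)) y =
    \sum_(n < N) ((z ^+ n)%:E * law n.+1 y).
  rewrite (walk_step_sum (f := fun n x => (z ^+ n)%:E * law n x))//.
  by apply: eq_bigr => n _; rewrite walk_stepZ// => x; exact: law_ge0.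
have sumS N y : \sum_(n < N.+1) ((z ^+ n)%:E * law n y) =
    dirac_mass y + z%:E * \sum_(n < N) ((z ^+ n)%:E * law n.+1 y).
  rewrite big_ord_recl expr0 mul1e ge0_sume_distrr//; last first.
    by move=> n _; rewrite mule_ge0 ?law_ge0.
  by congr (_ + _); apply: eq_bigr => n _; rewrite muleA -EFinM -exprS.
have lower N y : \sum_(n < N) ((z ^+ n)%:E * law n y) <= Phi y.
  elim: N y => [|N IH] y; first by rewrite big_ord0.
  rewrite PhiE sumS leeD2l// lee_wpmul2l//.
  by rewrite -stepS; exact: le_walk_step.
have upper N y : Phi y <= \sum_(n < N) ((z ^+ n)%:E * law n y) + (z ^+ N * C)%:E.
  elim: N y => [|N IH] y.
    by rewrite big_ord0 expr0 mul1r add0e; have /andP[] := PhiC y.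
  rewrite PhiE sumS -addeA leeD2l// (le_trans (lee_wpmul2l _ (le_walk_step IH _)))//.
  rewrite walk_stepD//; last by move=> x; rewrite lee_fin mulr_ge0 ?exprn_ge0.
  rewrite ge0_muleDr; last 2 first.
  - exact: walk_step_ge0.
  - by apply: walk_step_ge0 => x; rewrite lee_fin mulr_ge0 ?exprn_ge0.
  rewrite stepS leeD2l// exprS -mulrA [leRHS]EFinM lee_wpmul2l//.
  rewrite /walk_step esumZl//; last by rewrite lee_fin mulr_ge0 ?exprn_ge0.
  (* The one-step weights into [y], summed over the starting points, also have total mass [1]:
     substitute [x = y s^-1]. *)
  rewrite (@reindexT_esum _ _ _ (fun s => y * s^-1)%g); last first.
    by exists (fun x => x^-1 * y)%g => x; rewrite ?invgM ?invgK ?mulgVK ?mulVKg.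
  under eq_esum do rewrite invgM invgK mulgVK.
  by rewrite m1 mule1.
move=> y; apply/eqP; rewrite eq_le; apply/andP; split; last exact: esum_nat_le.
apply/lee_addgt0Pr => e e0.
have [N zN] : exists N, (z ^+ N * C <= e)%R.
  have : (z ^+ n * C)%R @[n --> \oo] --> (0 * C)%R.
    by apply: cvgM; [apply: cvg_expr; rewrite ger0_norm|exact: cvg_cst].
  rewrite mul0r => /cvgrPdist_le /(_ e e0)[N _ HN]; exists N.
  have := HN N (leqnn N); rewrite /= sub0r normrN; exact: le_trans (ler_norm _).
rewrite (le_trans (upper N y))// leeD//.
exact: (esum_nat_ge N (fun n => zl0 n y)).
Qed.

End FixedParameter.

Lemma law_gt0 (m_gen : semigroup_generates [set g | m g != 0%R]) x :
  exists n, 0 < law n x.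
Proof.
have [s [_ sA ->]] := m_gen x.
elim: s sA => [|a s IH] sA.
  by exists 0%N; rewrite big_nil /law /= /dirac_mass eqxx.
have [t ts|n n0] := IH; first by apply: sA; rewrite inE ts orbT.
exists n.+1; rewrite big_cons lawSl.
apply: (@lt_le_trans _ _ ((m a)%:E * law n (\prod_(x <- s) x)%g)).
  rewrite mule_gt0// lt_neqAle m0 andbT eq_sym eqe.
  by apply: sA; rewrite mem_head.
rewrite (le_trans _ (@le_esum_term R G setT _ a _ _))// ?mulKg// => t _.
by rewrite mule_ge0 ?law_ge0.
Qed.

Lemma green_fun_gt0 (m_gen : semigroup_generates [set g | m g != 0%R]) z x :
  (0 < z)%R -> 0 < green_fun z x.
Proof.
move=> z0; have [n n0] := law_gt0 m_gen x.
rewrite (@lt_le_trans _ _ ((z ^+ n)%:E * law n x))//.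
  by rewrite mule_gt0// lte_fin exprn_gt0.
apply: (@le_esum_term R nat setT (fun n => (z ^+ n)%:E * law n x) n) => // k _.
by rewrite mule_ge0 ?law_ge0// lee_fin exprn_ge0// ltW.
Qed.

End Convolution.

(** * Countability of the groups *)

Section Countability.

Lemma countable_of_code (T : Type) (C : countType) (f : C -> T) :
  (forall x, exists c, f c = x) -> countable [set: T].
Proof.
move=> /choice[g fg]; apply/countable_injP; exists (fun x => pickle (g x)).
by move=> x y _ _ /(pcan_inj pickleK)/(congr1 f); rewrite !fg.
Qed.

Lemma finitely_generated_countable (G : groupType) :
  finitely_generated G -> countable [set: G].
Proof.
move=> [S Sgen].
pose letter (c : bool * nat) : G :=
  (if c.1 then nth 1 S c.2 else (nth 1 S c.2)^-1)%g.
apply: (@countable_of_code _ (seq (bool * nat)) (fun s => \prod_(c <- s) letter c)%g).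
move=> g; have [s [sS ->]] := Sgen g; elim: s sS => [|x s IH] sS.
  by exists [::]; rewrite !big_nil.
have [y ys|l lE] := IH; first by apply: sS; rewrite inE ys orbT.
have [xS|xS] := sS x (mem_head _ _).
  exists ((true, index x S) :: l); rewrite !big_cons lE; congr (_ * _)%g.
  by rewrite /letter /= nth_index.
exists ((false, index x^-1%g S) :: l); rewrite !big_cons lE; congr (_ * _)%g.
by rewrite /letter /= nth_index// invgK.
Qed.

Lemma free_product_countable (r : nat) (Gam : 'I_r -> groupType) :
  (forall i, countable [set: Gam i]) -> countable [set: free_product Gam].
Proof.
move=> Gc.
have code_exists i : {e : Gam i -> nat | injective e}.
  apply: cid; have /countable_injP[e einj] := Gc i.
  by exists e => x y; apply: einj; rewrite inE.
pose e i := sval (code_exists i); have e_inj i := svalP (code_exists i).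
pose code (a : {i & Gam i}) := (tag a, e (tag a) (tagged a)).
have code_inj : injective code.
  by move=> [i x] [j y] [ij]; case: _ / ij y => y /= /e_inj ->.
apply/countable_injP; exists (fun x => pickle (map code (fp_word x))).
move=> x y _ _ /(pcan_inj pickleK)/(inj_map code_inj) xy.
exact: val_inj.
Qed.

End Countability.

(** * From events of the walk to [restricted_law] *)

Section WalkLaw.
Local Open Scope ereal_scope.
Context {R : realType} {d : measure_display} {T : measurableType d}.
Variables (P : probability T R) (G : groupType).
Hypothesis G_countable : countable [set: G].

Section Fibers.
Variable Z : T -> G.
Hypothesis Z_meas : forall y, measurable (Z @^-1` [set y]).

(** The group carries no sigma-algebra; by countability, measurability of the fibers of points is
    enough. *)
Lemma measurable_fibers (A : set G) : measurable (Z @^-1` A).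
Proof.
have -> : Z @^-1` A = \bigcup_x (if x \in A then Z @^-1` [set x] else set0).
  apply/seteqP; split => [w Aw|w [x _]].
    by exists (Z w) => //; rewrite mem_set.
  by case: ifPn => //; rewrite inE /= => Ax ->.
apply: countable_bigcupT_measurable => // x.
by case: ifP.
Qed.

(** Countable additivity is available along [nat], so the fibers are numbered by an injection [e];
    numbers outside its image give empty events, killed by [a set0 = 0]. *)
Let enum_fibers : exists e : G -> nat,
  [/\ injective e, trivIset setT (fun n => [set w | e (Z w) = n]),
      forall n, measurable [set w | e (Z w) = n] &
      forall a : set T -> \bar R, (forall E, 0 <= a E) -> a set0 = 0 ->
      \esum_(n in [set: nat]) a [set w | e (Z w) = n] =
      \esum_(x in [set: G]) a (Z @^-1` [set x])].
Proof.
have /countable_injP[e einj] := G_countable.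
have {}einj : injective e by move=> x y; apply: einj; rewrite inE.
exists e; split => //.
- by move=> i j _ _ [w [/= <- <-]].
- by move=> n; exact: (measurable_fibers [set x | e x = n]).
move=> a a0 a00; transitivity (\esum_(n in e @` [set: G]) a [set w | e (Z w) = n]).
  rewrite [RHS]esum_mkcond; apply: eq_esum => n _; case: ifPn => //.
  rewrite notin_setE => /= nN; rewrite -[RHS]a00; congr a.
  by rewrite -subset0 => w /= wn; apply: nN; exists (Z w).
rewrite esum_image; last by move=> x y _ _ /einj.
apply: eq_esum => x _; congr a; apply/seteqP; split => w /=; first by move/einj.
by move=> ->.
Qed.

Lemma prob_fibers (E : set T) : measurable E ->
  P E = \esum_(x in [set: G]) P (E `&` Z @^-1` [set x]).
Proof.
move=> mE; have [e [einj etriv emeas eE]] := enum_fibers.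
rewrite -(eE (fun F => P (E `&` F)))//; last by rewrite setI0 measure0.
rewrite -nneseries_esumT//.
rewrite -[in LHS](setIT E) (_ : setT = \bigcup_n [set w | e (Z w) = n]); last first.
  by apply/seteqP; split => // w _; exists (e (Z w)).
rewrite setI_bigcupr measure_bigcup//.
- by apply: eq_eseriesl => n; rewrite in_setT.
- by move=> n _; exact: measurableI.
- exact: trivIset_setIl.
Qed.

Lemma integral_fibers (f : G -> R) : (forall x, 0 <= f x)%R ->
  \int[P]_w (f (Z w))%:E =
  \esum_(x in [set: G]) ((f x)%:E * P (Z @^-1` [set x])).
Proof.
move=> f0; have [e [einj etriv emeas eE]] := enum_fibers.
have -> : setT = \bigcup_n [set w | e (Z w) = n] :> set T.
  by apply/seteqP; split => // w _; exists (e (Z w)).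
rewrite ge0_integral_bigcup//; last 2 first.
- move=> _ Y mY; apply: measurableI; first exact: bigcup_measurable.
  exact: (measurable_fibers [set x | Y (f x)%:E]).
- by move=> w _; rewrite lee_fin.
rewrite nneseries_esumT; last by move=> n; apply: integral_ge0 => w _; rewrite lee_fin.
rewrite (eE (fun F => \int[P]_(w in F) (f (Z w))%:E)); last 2 first.
- by move=> E; apply: integral_ge0 => w _; rewrite lee_fin.
- by rewrite integral_set0.
apply: eq_esum => x _; rewrite -integral_cst//.
by apply: eq_integral => w; rewrite inE/= => ->.
Qed.

End Fibers.

Variables (m : G -> R) (X : nat -> T -> G).
Hypothesis X_walk : random_walk P m 1%g X.

Let X_meas n y : measurable (X n @^-1` [set y]).
Proof. by case: X_walk. Qed.

Lemma measurable_history (A : nat -> set G) n :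
  measurable [set w | forall k, (k < n)%N -> A k (X k w)].
Proof.
have -> : [set w | forall k, (k < n)%N -> A k (X k w)] =
    \bigcap_(k in `I_n) (X k @^-1` A k) by [].
by apply: bigcap_measurableType => k _; exact: measurable_fibers.
Qed.

Hypothesis m_prob : prob_mass m.

Let m0 x : 0 <= (m x)%:E. Proof. by rewrite lee_fin; case: m_prob. Qed.

(* Past events that prescribe membership in [A k] before time [j] and the exact
   position from time [j] to time [n]. *)
Let mixed_past (A : nat -> set G) n j (x : nat -> G) : set T :=
  [set w | (forall k, (k < j)%N -> A k (X k w)) /\
     forall k, (j <= k <= n)%N -> X k w = x k].

Let measurable_mixed_past A n j x : measurable (mixed_past A n j x).
Proof.
have -> : mixed_past A n j x = [set w | forall k, (k < j)%N -> A k (X k w)] `&`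
    [set w | forall k, (k < n.+1)%N -> [set z | (j <= k)%N -> z = x k] (X k w)].
  apply/seteqP; split => w /= [wA wx]; split => // k.
    by move=> kn jk; apply: wx; rewrite jk.
  by move=> /andP[jk kn]; exact: wx.
apply: measurableI; first exact: (@measurable_history A).
exact: (@measurable_history (fun k => [set z | (j <= k)%N -> z = x k])).
Qed.

(** [random_walk] states the Markov property only for fully prescribed pasts, the case [j = 0]. The
    induction frees one coordinate at a time by summing over the position at time [j]. *)
Let markov_mixed_past A n j x y : (j <= n)%N ->
  P (mixed_past A n j x `&` X n.+1 @^-1` [set y]) =
  P (mixed_past A n j x) * (m ((x n)^-1 * y)%g)%:E.
Proof.
elim: j x => [|j IH] x jn.
  have [_ _ /(_ n x y) markov] := X_walk.
  rewrite [X in P X = _](_ : _ =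
    [set w | (forall k, (k <= n)%N -> X k w = x k) /\ X n.+1 w = y]); last first.
    by apply/seteqP; split => w /= [wx ?]; [case: wx|split].
  rewrite markov; congr (P _ * _).
  by apply/seteqP; split => w /=; [split|case].
pose x' a k := if k == j then a else x k.
have x'n a : x' a n = x n by rewrite /x' gtn_eqF.
have pastS a : A j a -> mixed_past A n j.+1 x `&` X j @^-1` [set a] =
    mixed_past A n j (x' a).
  move=> Aja; apply/seteqP; split => w /=.
    move=> [[wA wx] wa]; split => [k kj|k /andP[jk kn]].
      by apply: wA; rewrite ltnS ltnW.
    rewrite /x'; case: eqVneq => [->//|kj]; apply: wx.
    by rewrite kn andbT ltn_neqAle eq_sym kj.
  move=> [wA wx]; have wj : X j w = a.
    by have := wx j; rewrite leqnn (ltnW jn) /x' eqxx => ->.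
  split=> //; split => [k|k /andP[jk kn]].
    rewrite ltnS leq_eqVlt => /predU1P[->|]; first by rewrite wj.
    exact: wA.
  by have := wx k; rewrite kn (ltnW jk) /x' gtn_eqF// => ->.
have step (E : set T) : measurable E -> E `<=` mixed_past A n j.+1 x ->
    P E = \esum_(a in [set: G]) (if a \in A j then P (E `&` X j @^-1` [set a]) else 0).
  move=> mE EA; rewrite (prob_fibers (X_meas j) mE); apply: eq_esum => a _.
  case: ifPn => //; rewrite notin_setE => Aja.
  rewrite [X in P X](_ : _ = set0) ?measure0// -subset0 => w /= [/EA[wA _] wa].
  by apply: Aja; rewrite -wa; exact: wA.
rewrite step; [|by apply: measurableI|by move=> w []].
rewrite [in RHS]step// -esumZr//; last by move=> a _; case: ifP.
apply: eq_esum => a _; case: ifPn => [|_]; last by rewrite mul0e.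
rewrite inE => Aja; rewrite setIAC pastS// IH 1?ltnW//.
by rewrite x'n.
Qed.

Lemma prob_history_step (A : nat -> pred G) n y :
  P [set w | (forall k, (k <= n)%N -> A k (X k w)) /\ X n.+1 w = y] =
  \esum_(x in [set: G])
    (P [set w | (forall k, (k <= n)%N -> A k (X k w)) /\ X n w = x] *
     (m (x^-1 * y)%g)%:E).
Proof.
rewrite (prob_fibers (X_meas n)); last first.
  apply: (@measurableI _ _ [set w | forall k, (k < n.+1)%N ->
    [set x | A k x] (X k w)] (X n.+1 @^-1` [set y])) => //.
  exact: (@measurable_history (fun k => [set x | A k x])).
apply: eq_esum => x _.
have [Anx|AnxF] := boolP (A n x); last first.
  have -> : [set w | (forall k, (k <= n)%N -> A k (X k w)) /\ X n w = x] = set0.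
    rewrite -subset0 => w /= [wA wx].
    by move/negP: AnxF; apply; rewrite -wx; exact: wA.
  rewrite measure0 mul0e -[RHS](measure0 P); congr (P _).
  rewrite -subset0 => w /= [[wA _] wx].
  by move/negP: AnxF; apply; rewrite -wx; exact: wA.
have -> : [set w | (forall k, (k <= n)%N -> A k (X k w)) /\ X n w = x] =
    mixed_past (fun k => [set x | A k x]) n n (fun=> x).
  apply/seteqP; split => w /= [wA wx]; split=> //.
  - by move=> k kn; apply: wA; exact: ltnW.
  - by move=> k; rewrite -eqn_leq => /eqP <-.
  - move=> k; rewrite leq_eqVlt => /predU1P[->|]; last exact: wA.
    by rewrite (wx n) ?leqnn.
  - by rewrite (wx n) ?leqnn.
rewrite -(@markov_mixed_past (fun k => [set x | A k x]) n n (fun=> x))//.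
congr (P _); apply/seteqP; split => w /=.
  move=> [[wA wy] wx]; split=> //; split=> //.
  - by move=> k kn; apply: wA; exact: ltnW.
  - by move=> k; rewrite -eqn_leq => /eqP <-.
move=> [[wA wx] wy]; split; last by rewrite (wx n) ?leqnn.
split=> // k; rewrite leq_eqVlt => /predU1P[->|]; last exact: wA.
by rewrite (wx n) ?leqnn.
Qed.

Lemma prob_restricted_law (A : nat -> pred G) n x :
  P [set w | (forall k, (k <= n)%N -> A k (X k w)) /\ X n w = x] =
  restricted_law m A n x.
Proof.
elim: n x => [|n IH] x /=.
  have [A0x|A0xF] := ifP; last first.
    rewrite -[RHS](measure0 P); congr (P _); rewrite -subset0 => w /= [wA wx].
    by move: A0xF; rewrite -wx wA.
  rewrite (_ : [set w | _] = X 0%N @^-1` [set x]); last first.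
    apply/seteqP; split => w /=; first by case.
    by move=> wx; split=> // k; rewrite leqn0 => /eqP ->; rewrite wx.
  have [_ X0 _] := X_walk; rewrite /dirac_mass; case: eqVneq => [->//|xN1].
  apply/eqP; rewrite eq_le measure_ge0 andbT.
  (* The walk starts at [1] only almost surely, so any other starting point is bounded by the
     complementary null event. *)
  rewrite (@le_trans _ _ (P (~` (X 0%N @^-1` [set 1%g]))))//.
    apply: le_measure; rewrite ?inE//; first exact: measurableC.
    by move=> w /= wx w1; move/eqP: xN1; apply; rewrite -wx.
  by rewrite probability_setC// X0 subee.
have [Ax|AxF] := ifP; last first.
  rewrite -[RHS](measure0 P); congr (P _); rewrite -subset0 => w /= [wA wx].
  by move: AxF; rewrite -wx wA.
rewrite /walk_step -(eq_esum (fun y _ => congr1 (fun t => t * _) (IH y))).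
rewrite -prob_history_step; congr (P _).
apply/seteqP; split => w /= [wA wx]; split => // k kn.
  by apply: wA; exact: leqW.
move: kn; rewrite leq_eqVlt => /predU1P[->|kn]; first by rewrite wx.
exact: wA.
Qed.

Lemma prob_restricted_step (A : nat -> pred G) n y :
  P [set w | (forall k, (k <= n)%N -> A k (X k w)) /\ X n.+1 w = y] =
  walk_step m (restricted_law m A n) y.
Proof.
by rewrite prob_history_step; apply: eq_esum => x _; rewrite prob_restricted_law.
Qed.

Lemma prob_law n x : P (X n @^-1` [set x]) = law m n x.
Proof.
rewrite /law -prob_restricted_law; congr (P _).
by apply/seteqP; split => w //= [].
Qed.

Lemma distribution_atE n x : distribution_at P X n x = fine (law m n x).
Proof. by rewrite /distribution_at prob_law. Qed.

Lemma prob_first_visit y n : P (first_visit X y n) = hitting m y n.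
Proof.
case: n => [|n] /=.
  rewrite -[RHS](_ : law m 0 y = _)// -prob_law; congr (P _).
  by apply/seteqP; split => w /=; [case|move=> ?; split].
rewrite -(prob_restricted_step (fun _ x => x != y)); congr (P _).
apply/seteqP; split => w /=.
  by move=> [wy wN]; split=> // k kn; apply/eqP; exact: wN.
by move=> [wN wy]; split=> // k kn; apply/eqP; exact: wN.
Qed.

Lemma mean_neg_logE n : mean_neg_log P X n =
  \esum_(x in [set: G]) (- (fine (law m n x) * ln (fine (law m n x))))%:E.
Proof.
rewrite /mean_neg_log unlock.
rewrite (integral_fibers (X_meas n)
  (f := fun x => (- ln (distribution_at P X n x))%R)); last first.
  move=> x; rewrite oppr_ge0 ln_le0// distribution_atE.
  by rewrite -lee_fin fineK ?law_fin ?law_le1.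
apply: eq_esum => x _; rewrite prob_law distribution_atE -[X in _ * X]fineK ?law_fin//.
by rewrite -EFinM mulNr mulrC.
Qed.

End WalkLaw.

(** * Generating functions as unordered sums *)

Section GeneratingFunctions.
Local Open Scope ereal_scope.
Variable R : realType.

(** [gen_fun] is a [limn], meaningful only for a convergent series; finiteness of the unordered sum
    supplies the convergence. *)
Lemma gen_funE (a : nat -> \bar R) (z : R) : (0 <= z)%R ->
  (forall n, 0 <= a n) -> (forall n, a n \is a fin_num) ->
  \esum_(n in [set: nat]) ((z ^+ n)%:E * a n) < +oo ->
  (gen_fun (fun n => fine (a n)) z)%:E = \esum_(n in [set: nat]) ((z ^+ n)%:E * a n).
Proof.
move=> z0 a0 afin a_sum.
have termE n : (z ^+ n)%:E * a n = (fine (a n) * z ^+ n)%:E.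
  by rewrite mulrC EFinM fineK.
have t0 n : (0 <= fine (a n) * z ^+ n)%R by rewrite mulr_ge0 ?exprn_ge0 ?fine_ge0.
rewrite (eq_esum (fun n _ => termE n)) in a_sum *.
rewrite -nneseries_esumT// in a_sum *.
rewrite /gen_fun -EFin_lim; last exact: nnseries_is_cvg.
by apply: congr_lim; apply/funext => n /=; rewrite /series /= sumEFin.
Qed.

Context {d : measure_display} {T : measurableType d}.
Variables (P : probability T R) (G : groupType) (m : G -> R) (X : nat -> T -> G).
Hypotheses (G_countable : countable [set: G]) (m_prob : prob_mass m).
Hypothesis X_walk : random_walk P m 1%g X.

Lemma greenE y z : (0 <= z)%R -> green_fun m z y < +oo ->
  (green P X y z)%:E = green_fun m z y.
Proof.
move=> z0 Gfin; rewrite /green /green_fun -(gen_funE z0 _ _ Gfin).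
- congr (gen_fun _ z)%:E; apply/funext => n.
  by rewrite (distribution_atE G_countable X_walk).
- by move=> n; exact: law_ge0.
- by move=> n; exact: law_fin.
Qed.

Lemma first_passageE y z : (0 <= z <= 1)%R ->
  (first_passage P X y z)%:E = hitting_fun m z y.
Proof.
move=> /andP[z0 z1]; rewrite /first_passage.
have Ffin : hitting_fun m z y < +oo.
  by rewrite (le_lt_trans (hitting_fun_le1 m_prob z0 y z1)) ?ltry.
rewrite /hitting_fun -(gen_funE z0 _ _ Ffin).
- congr (gen_fun _ z)%:E; apply/funext => n.
  by rewrite (prob_first_visit G_countable X_walk).
- by move=> n; exact: hitting_ge0.
- by move=> n; exact: hitting_fin.
Qed.

End GeneratingFunctions.

(** * The factors of a free product *)

Section Projection.
Context {I : choiceType} (G : I -> groupType).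
Local Open Scope group_scope.
Local Notation letter := {i : I & G i}.
Local Notation Tg := (Tagged G).
Implicit Types (x y : free_product G) (s t : seq letter).

(* The first letter of [x] if it belongs to the factor [i], else [1]; the
   default of [tagged_as] is its first argument. *)
Definition fp_head (i : I) x : G i :=
  if fp_word x is b :: _ then tagged_as (Tg (1 : G i)) b else 1.

Definition fp_tail (i : I) x : free_product G := (fp_inj (fp_head i x))^-1 * x.

Definition in_factor (i : I) x : bool := x == fp_inj (fp_head i x).

Lemma tagged_as1_neq i (b : letter) : tag b != i -> tagged_as (Tg (1 : G i)) b = 1.
Proof.
case: b => j y /= ji; rewrite /tagged_as /=; case: eqP => // ij.
by exfalso; move/eqP: ji; apply; exact: esym.
Qed.

Lemma tagged_as_self i (g h : G i) : tagged_as (Tg g) (Tg h) = h.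
Proof. exact: (@tagged_asE I (fun i => G i) (Tg g) h). Qed.

Lemma fp_word_inj i (g : G i) : fp_word (fp_inj g) = cons_letter g [::].
Proof. by []. Qed.

Lemma fp_inj1 i : fp_inj (1 : G i) = 1.
Proof. by apply: val_inj; rewrite /= /cons_letter eqxx. Qed.

Lemma fp_injV i (g : G i) : fp_inj g^-1 = (fp_inj g)^-1.
Proof. by apply: (@mulgI _ (fp_inj g)); rewrite -fp_injM !mulgV fp_inj1. Qed.

Lemma fp_word_injM i (g : G i) x :
  fp_word (fp_inj g * x) = lact (Tg g) (fp_word x).
Proof.
rewrite [LHS]/= wmul_cons_letter//; exact: fp_reduced.
Qed.

(** Equivariance is what makes the head useful: with [fp_tail] it splits the free product as the
    factor times the words of trivial head, the factor acting on the first coordinate only. *)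
Lemma fp_head_injM i (g : G i) x : fp_head i (fp_inj g * x) = g * fp_head i x.
Proof.
rewrite /fp_head fp_word_injM; case: x => -[|[j y] s] rs /=.
  rewrite /cons_letter mulg1; case: eqVneq => [->//|_].
  by rewrite tagged_as_self.
have [ij|ij] := eqVneq j i; last first.
  rewrite tagged_as1_neq// mulg1 /cons_letter; case: eqVneq => [->|_].
    by rewrite tagged_as1_neq.
  by rewrite tagged_as_self.
move: y rs; rewrite {j}ij => y; rewrite reduced_cons => /and3P[/= _ far _].
rewrite !tagged_as_self /cons_letter; case: eqVneq => [->|_].
  (* If the letters cancel, the word now starts in another factor, so its head is [1]. *)
  by case: s far => //= b s; rewrite eq_sym => /tagged_as1_neq.
by rewrite tagged_as_self.
Qed.

Lemma fp_head1 i : fp_head i 1 = 1. Proof. by []. Qed.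

Lemma fp_head_inj i (g : G i) : fp_head i (fp_inj g) = g.
Proof. by rewrite -[fp_inj g]mulg1 fp_head_injM fp_head1 mulg1. Qed.

Lemma fp_inj_inj i : injective (@fp_inj I G i).
Proof. exact: can_inj (fp_head_inj (i := i)). Qed.

Lemma fp_head_inj_neq i j (h : G j) : j != i -> fp_head i (fp_inj h) = 1.
Proof.
move=> ji; rewrite /fp_head fp_word_inj /cons_letter; case: eqVneq => // _.
by rewrite tagged_as1_neq.
Qed.

Lemma fp_head_tail i x : fp_head i (fp_tail i x) = 1.
Proof. by rewrite /fp_tail -fp_injV fp_head_injM mulVg. Qed.

Lemma fp_inj_head_tail i x : fp_inj (fp_head i x) * fp_tail i x = x.
Proof. by rewrite mulVKg. Qed.

Lemma fp_tail_injM i (g : G i) x : fp_tail i (fp_inj g * x) = fp_tail i x.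
Proof. by rewrite /fp_tail fp_head_injM fp_injM invgM mulgA mulgVK. Qed.

Lemma in_factorE i x : in_factor i x = (fp_tail i x == 1).
Proof. by rewrite mulVg_eq1 eq_sym. Qed.

Lemma in_factor_injM i (g : G i) x : in_factor i (fp_inj g * x) = in_factor i x.
Proof. by rewrite !in_factorE fp_tail_injM. Qed.

Lemma in_factor_inj i (g : G i) : in_factor i (fp_inj g).
Proof. by rewrite /in_factor fp_head_inj. Qed.

Lemma in_factorP i x : reflect (exists g : G i, x = fp_inj g) (in_factor i x).
Proof.
apply: (iffP eqP) => [xE|[g ->]]; first by exists (fp_head i x).
by rewrite fp_head_inj.
Qed.

Lemma in_factor1 i : in_factor i 1.
Proof. by rewrite -(fp_inj1 i) in_factor_inj. Qed.

(** Only the last letter can merge with the new one or cancel against it, so a nontrivial product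
    still starts in the same factor. *)
Let wmul_letter_head b s j (h : G j) c t : reduced (b :: s) ->
  wmul (b :: s) (cons_letter h [::]) = c :: t -> tag c = tag b.
Proof.
elim: s b c t => [|b' s IH] [i y] c t.
  rewrite reduced_cons => /and3P[/= y1 _ _]; rewrite /cons_letter /lact.
  case: eqVneq => [_ /=|_ /=]; first by rewrite /cons_letter (negbTE y1) => -[<-].
  case: ifP => _; rewrite /cons_letter; first by case: eqP => // _ [<-].
  by rewrite (negbTE y1) => -[<-].
rewrite reduced_cons => /and3P[/= y1 ib' rs].
move: (IH b'); rewrite /=; case: (lact b' _) => [|c' t'] IHb'.
  by rewrite /lact /cons_letter (negbTE y1) => -[<-].
have c'b' := IHb' _ _ rs erefl.
by rewrite lact_neq /= ?c'b' 1?eq_sym// /cons_letter (negbTE y1) => -[<-].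
Qed.

(* A right multiplication by one letter changes the first letter only when the
   word lies inside a factor. *)
Lemma fp_head_mul_letter i x j (h : G j) : ~~ in_factor i x ->
  fp_head i (x * fp_inj h) = fp_head i x.
Proof.
case: x => -[|a s] rs xN.
  by case/negP: xN; rewrite (_ : FreeProduct rs = 1) ?in_factor1//; exact: val_inj.
rewrite /fp_head.
have -> : fp_word (FreeProduct rs * fp_inj h) = wmul (a :: s) (cons_letter h [::]) by [].
rewrite [fp_word _]/=.
have [ai|ai] := eqVneq (tag a) i; last first.
  rewrite [RHS]tagged_as1_neq//.
  have := @wmul_letter_head a s j h; case: (wmul _ _) => // c t /(_ c t rs erefl) ca.
  by rewrite tagged_as1_neq// ca.
case: a ai rs xN => [i' y] /= ii'; move: y; rewrite {i'}ii' => y rs.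
case: s rs => [|b s] rs xN.
  case/negP: xN; apply/in_factorP; exists y; apply: val_inj => /=.
  by move: rs; rewrite reduced_cons /cons_letter => /and3P[/negbTE ->].
move: rs {xN}; rewrite reduced_cons => /and3P[/= y1 ib rs].
have := @wmul_letter_head b s j h; rewrite /=.
case: (lact b _) => [_|c t /(_ c t rs erefl) cb].
  by rewrite /lact /cons_letter (negbTE y1).
by rewrite lact_neq /= ?cb 1?eq_sym// /cons_letter (negbTE y1).
Qed.

End Projection.

(** * The step distribution of the free product *)

Section FactorMeasure.
Local Open Scope ereal_scope.
Variables (R : realType) (r : nat) (Gam : 'I_r -> groupType).
Variables (alpha : 'I_r -> R) (mu : forall i, Gam i -> R).
Arguments mu : clear implicits.
Hypotheses (mu_prob : forall i, prob_mass (mu i)) (mu1 : forall i, mu i 1%g = 0%R).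
Hypotheses (alpha_gt0 : forall i, (0 < alpha i)%R) (alpha_sum : (\sum_i alpha i = 1)%R).

Local Notation Gamma := (free_product Gam).
Let nu := fp_measure alpha mu.

Let mu0 i g : (0 <= mu i g)%R. Proof. by case: (mu_prob i). Qed.

Lemma fp_measure_inj i (g : Gam i) : nu (fp_inj g) = (alpha i * mu i g)%R.
Proof.
rewrite /nu /fp_measure fp_word_inj /cons_letter; case: eqVneq => [->|//].
by rewrite mu1 mulr0.
Qed.

Lemma fp_measure_supp (x : Gamma) : nu x != 0%R ->
  exists i (g : Gam i), x = fp_inj g /\ g != 1%g.
Proof.
rewrite /nu /fp_measure; case: x => -[|[i g] []]//= rs; rewrite ?eqxx// => _.
have g1 : g != 1%g by move: rs; rewrite reduced_cons => /andP[].
by exists i, g; split => //; apply: val_inj; rewrite /= /cons_letter (negbTE g1).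
Qed.

Lemma fp_measure_ge0 x : (0 <= nu x)%R.
Proof.
rewrite /nu /fp_measure; case: (fp_word x) => [|a []]//.
by rewrite mulr_ge0// ltW.
Qed.

(** The support is the disjoint union of the nontrivial parts of the factors, and [mu i 1 = 0] lets
    each sum run over the whole factor. *)
Lemma esum_fp_measure (f : Gamma -> \bar R) : (forall x, 0 <= f x) ->
  \esum_(x in [set: Gamma]) ((nu x)%:E * f x) =
  \sum_(i < r) \esum_(g in [set: Gam i]) ((alpha i * mu i g)%:E * f (fp_inj g)).
Proof.
move=> f0; pose D i : set Gamma := factor_nontriv i.
have nf0 x : 0 <= (nu x)%:E * f x by rewrite mule_ge0// lee_fin fp_measure_ge0.
transitivity (\esum_(x in [set: Gamma]) \sum_(i < r)
    (if x \in D i then (nu x)%:E * f x else 0)).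
  apply: eq_esum => x _; have [->|/fp_measure_supp[i [g [-> g1]]]] := eqVneq (nu x) 0%R.
    by rewrite mul0e big1// => i _; rewrite if_same.
  rewrite (bigD1 i)//= ifT; last by rewrite inE; exists g => //; apply/eqP.
  rewrite big1 ?adde0// => j ji; rewrite ifF//; apply/negbTE; rewrite notin_setE.
  move=> [h /eqP h1] /(congr1 (fp_head j)); rewrite fp_head_inj fp_head_inj_neq 1?eq_sym//.
  by move=> hE; rewrite hE eqxx in h1.
rewrite esum_sum; last by move=> x i _ _; case: ifP.
apply: eq_bigr => i _; rewrite -esum_mkcond /D /factor_nontriv esum_image; last first.
  by move=> x y _ _ /fp_inj_inj.
rewrite esum_mkcond; apply: eq_esum => g _; rewrite fp_measure_inj; case: ifPn => //.
rewrite notin_setE /= => /contrapT ->; rewrite mu1 mulr0 mul0e//.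
Qed.

Lemma fp_measure_prob : prob_mass nu.
Proof.
split; first exact: fp_measure_ge0.
transitivity (\esum_(x in [set: Gamma]) ((nu x)%:E * 1)).
  by apply: eq_esum => x _; rewrite mule1.
rewrite esum_fp_measure//; transitivity (\sum_(i < r) (alpha i)%:E).
  apply: eq_bigr => i _; have [_ mui1] := mu_prob i.
  rewrite -[RHS]mule1 -mui1 -esumZl ?lee_fin ?ltW//; last first.
    by move=> g _; rewrite lee_fin.
  by apply: eq_esum => g _; rewrite mui1 mule1 EFinM.
by rewrite sumEFin alpha_sum.
Qed.

Lemma fp_measure_gen (mu_gen : forall i, semigroup_generates [set g | mu i g != 0%R]) :
  (0 < r)%N -> semigroup_generates [set x | nu x != 0%R].
Proof.
move=> r0.
pose ok (x : Gamma) := exists s : seq Gamma,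
  [/\ s <> [::], {in s, forall x, [set x | nu x != 0%R] x} & x = (\prod_(y <- s) y)%g].
have okM x y : ok x -> ok y -> ok (x * y)%g.
  move=> [s [s0 sA ->]] [t [t0 tA ->]]; exists (s ++ t); split.
  - by case: s s0 {sA}.
  - by move=> u; rewrite mem_cat => /orP[]; [exact: sA|exact: tA].
  - by rewrite big_cat.
have ok_inj i (g : Gam i) : ok (fp_inj g).
  have [s [s0 sA ->]] := mu_gen i g; exists [seq fp_inj x | x <- s]; split.
  - by case: s s0 {sA}.
  - move=> _ /mapP[x /sA /= mux ->]; rewrite /= fp_measure_inj.
    by rewrite mulf_neq0// gt_eqF.
  - rewrite big_map; elim: s {s0 sA} => [|a s IH]; first by rewrite !big_nil fp_inj1.
    by rewrite !big_cons fp_injM IH.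
move=> x; change (ok x); case: x => s; elim: s => [|[i g] s IH] rs.
  rewrite (_ : FreeProduct rs = fp_inj (1%g : Gam (Ordinal r0)))//.
  by apply: val_inj; rewrite /= /cons_letter eqxx.
have rs' := reduced_behead rs.
rewrite (_ : FreeProduct rs = (fp_inj g * FreeProduct rs')%g); first exact: okM.
apply: val_inj; rewrite [RHS]fp_word_injM /=.
move: rs; rewrite reduced_cons => /and3P[/= g1 far _].
by rewrite lact_far// /cons_letter (negbTE g1).
Qed.

End FactorMeasure.

(** * Excursions away from a factor, and the last-visit decomposition *)

Section Excursions.
Local Open Scope ereal_scope.
Variables (R : realType) (r : nat) (Gam : 'I_r -> groupType).
Variables (alpha : 'I_r -> R) (mu : forall i, Gam i -> R).
Arguments mu : clear implicits.
Hypotheses (mu_prob : forall i, prob_mass (mu i)) (mu1 : forall i, mu i 1%g = 0%R).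
Hypotheses (alpha_gt0 : forall i, (0 < alpha i)%R) (alpha_sum : (\sum_i alpha i = 1)%R).

Local Notation Gamma := (free_product Gam).
Local Notation nu := (fp_measure alpha mu).

Let nu_prob : prob_mass nu := fp_measure_prob mu_prob mu1 alpha_gt0 alpha_sum.
Let nu0 x : 0 <= (nu x)%:E. Proof. by rewrite lee_fin; case: nu_prob. Qed.
Let nu1 : nu 1%g = 0%R. Proof. by []. Qed.
Let mu0 i g : (0 <= mu i g)%R. Proof. by case: (mu_prob i). Qed.

Variable i : 'I_r.

(* Walks from [1] that stay outside the factor [i] at all positive times. *)
Definition excursion : nat -> Gamma -> \bar R :=
  restricted_law nu (fun k x => (k == 0)%N || ~~ in_factor i x).

Definition excursion_return (n : nat) : \bar R :=
  if n is m.+1 then walk_step nu (excursion m) 1%g else 0.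

Definition excursion_mass (n : nat) : \bar R :=
  \esum_(x in [set: Gamma]) excursion n x.

(** This is the number [Hbar] at [z = 1], written through walks that avoid the whole factor rather
    than [1] alone. *)
Definition return_mass : \bar R := \esum_(n in [set: nat]) excursion_return n.

Lemma excursion_ge0 n x : 0 <= excursion n x.
Proof. exact: restricted_law_ge0. Qed.

Lemma excursion_return_ge0 n : 0 <= excursion_return n.
Proof. by case: n => //= n; apply: walk_step_ge0 => // x; exact: excursion_ge0. Qed.

Lemma excursion_mass_ge0 n : 0 <= excursion_mass n.
Proof. by apply: esum_ge0 => x _; exact: excursion_ge0. Qed.

Lemma excursion0 x : excursion 0 x = dirac_mass R x. Proof. by []. Qed.

Lemma excursionS n x : excursion n.+1 x =
  if in_factor i x then 0 else walk_step nu (excursion n) x.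
Proof. by rewrite /excursion /=; case: in_factor. Qed.

(** A right multiplication acts at the end of the word, out of reach of the head as long as the word
    is not inside the factor. *)
Lemma fp_head_step x y : ~~ in_factor i x -> nu (x^-1 * y)%g != 0%R ->
  fp_head i y = fp_head i x.
Proof.
move=> xN /fp_measure_supp[j [h [xyE _]]].
by rewrite -(fp_head_mul_letter h xN) -xyE mulVKg.
Qed.

Lemma fp_head_stepV x y : ~~ in_factor i y -> nu (x^-1 * y)%g != 0%R ->
  fp_head i y = fp_head i x.
Proof.
move=> yN /fp_measure_supp[j [h [xyE _]]].
rewrite -(fp_head_mul_letter h^-1%g yN) fp_injV -xyE invgM invgK mulgA.
by rewrite mulgV mul1g.
Qed.

Lemma excursion_supp n x : fp_head i x != 1%g -> excursion n x = 0.
Proof.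
elim: n x => [|n IH] x x1.
  by rewrite excursion0 /dirac_mass; case: eqVneq => // xE; rewrite xE eqxx in x1.
rewrite excursionS; case: ifPn => // xN; apply: esum1 => y _.
have [->|yx] := eqVneq (nu (y^-1 * x)%g) 0%R; first by rewrite mule0.
by rewrite IH ?mul0e// -(fp_head_stepV xN yx).
Qed.

Lemma excursion_in_factor n x : in_factor i x -> excursion n.+1 x = 0.
Proof. by rewrite excursionS => ->. Qed.

(** The head stays [1] during an excursion from [1], so the factor can be re-entered only at [1]. *)
Lemma walk_step_excursion_in_factor n x : in_factor i x -> x != 1%g ->
  walk_step nu (excursion n.+1) x = 0.
Proof.
move=> xi x1; apply: esum1 => y _.
have [yi|yN] := boolP (in_factor i y); first by rewrite excursion_in_factor ?mul0e.
have [->|yx] := eqVneq (nu (y^-1 * x)%g) 0%R; first by rewrite mule0.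
rewrite excursion_supp ?mul0e// -(fp_head_step yN yx).
by apply: contra_neq x1 => x1; rewrite (eqP xi) x1 fp_inj1.
Qed.

(** The path is split at the last time [k] spent in the factor. As the head is frozen afterwards,
    the position at that time must be the head of [x], and the rest is a translated excursion to the
    tail. *)
Lemma law_excursion n x : law nu n x =
  \sum_(k < n.+1) (law nu k (fp_inj (fp_head i x)) * excursion (n - k) (fp_tail i x)).
Proof.
have l0 := law_ge0 nu_prob.
elim: n x => [|n IH] x.
  rewrite big_ord1 excursion0 /law /= /dirac_mass.
  have [->|x1] := eqVneq x 1%g; first by rewrite /fp_tail fp_head1 fp_inj1 mulg1 invg1 !eqxx mule1.
  case: eqVneq => [h1|]; last by rewrite mul0e.
  case: eqVneq => [t1|_]; last by rewrite mule0.
  by move: x1; rewrite -(fp_inj_head_tail i x) h1 t1 mulg1 eqxx.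
rewrite big_ord_recr /= subnn excursion0 /dirac_mass -in_factorE.
have [xi|xN] := boolP (in_factor i x).
  rewrite big1 ?add0e ?mule1 -?(eqP xi)// => k _.
  by rewrite subSn -1?ltnS// excursion_in_factor ?mule0// /fp_tail -fp_injV in_factor_injM.
rewrite mule0 adde0 lawS /walk_step.
set g := fp_head i x.
transitivity (walk_step nu (fun y => \sum_(k < n.+1)
    (law nu k (fp_inj g) * excursion (n - k) ((fp_inj g)^-1 * y)%g)) x).
  apply: eq_esum => y _.
  have [->|yx] := eqVneq (nu (y^-1 * x)%g) 0%R; first by rewrite !mule0.
  by rewrite IH /fp_tail /g (fp_head_stepV xN yx).
rewrite walk_step_sum//; last by move=> k y; rewrite mule_ge0 ?excursion_ge0.
apply: eq_bigr => k _; rewrite walk_stepZ//; last by move=> y; exact: excursion_ge0.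
rewrite (walk_step_translate nu (fp_inj g) (excursion (n - k))) subSn -1?ltnS//.
by rewrite excursionS ifF//; apply/negbTE; rewrite /fp_tail -fp_injV in_factor_injM.
Qed.

Lemma esum_in_factor (f : Gamma -> \bar R) :
  \esum_(x in [set: Gamma]) (if in_factor i x then f x else 0) =
  \esum_(g in [set: Gam i]) f (fp_inj g).
Proof.
rewrite -(@esum_image _ _ _ setT (@fp_inj _ Gam i)); last by move=> x y _ _ /fp_inj_inj.
rewrite [RHS]esum_mkcond; apply: eq_esum => x _; congr (if _ then _ else _).
apply/in_factorP/idP; rewrite inE; first by move=> [g ->]; exists g.
by move=> [g _ <-]; exists g.
Qed.

(** The last step into [g] comes either from inside the factor, through [mu i], or from outside; in
    the second case the path has been on an excursion since its last visit to the factor, and that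
    visit was at [g] itself. *)
Lemma law_factor_rec n (g : Gam i) : law nu n.+1 (fp_inj g) =
  (alpha i)%:E * walk_step (mu i) (fun h => law nu n (fp_inj h)) g +
  \sum_(k < n.+1) (law nu k (fp_inj g) * excursion_return (n - k).+1).
Proof.
have l0 := law_ge0 nu_prob.
rewrite lawS /walk_step.
transitivity (\esum_(y in [set: Gamma])
   (if in_factor i y then law nu n y * (nu (y^-1 * fp_inj g)%g)%:E else 0) +
   \esum_(y in [set: Gamma])
   (if in_factor i y then 0 else law nu n y * (nu (y^-1 * fp_inj g)%g)%:E)).
  rewrite -esumD; last 2 first.
  - by move=> y _; case: ifP => // _; rewrite mule_ge0.
  - by move=> y _; case: ifP => // _; rewrite mule_ge0.
  by apply: eq_esum => y _; case: ifP; rewrite (adde0, add0e).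
congr (_ + _).
  rewrite esum_in_factor -esumZl ?lee_fin ?ltW//; last first.
    by move=> h _; rewrite mule_ge0 ?lee_fin.
  apply: eq_esum => h _; rewrite -fp_injV -fp_injM fp_measure_inj//.
  by rewrite EFinM muleCA.
transitivity (\esum_(v in [set: Gamma]) \sum_(k < n.+1)
    (law nu k (fp_inj g) * (excursion (n - k) v * (nu (v^-1 * 1)%g)%:E))); last first.
  rewrite esum_sum; last by move=> v k _ _; rewrite !mule_ge0 ?excursion_ge0.
  apply: eq_bigr => k _; rewrite esumZl// => v _; rewrite mule_ge0 ?excursion_ge0//.
rewrite (@reindexT_esum _ _ _ (fun v => fp_inj g * v)%g); last first.
  by exists (fun x => (fp_inj g)^-1 * x)%g => x; rewrite (mulKg, mulVKg).
apply: eq_esum => v _; rewrite in_factor_injM invgM mulgVK mulg1.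
have [->|v0] := eqVneq (nu v^-1%g) 0%R.
  by rewrite mule0 if_same big1// => k _; rewrite !mule0.
case: ifPn => vi.
  (* An excursion of positive length cannot end in the factor; one of length [0] ends at [1], where
     the closing step would have mass [nu 1 = 0]. *)
  rewrite big1// => k _; case: (n - k)%N => [|j]; last by rewrite excursion_in_factor// mul0e mule0.
  rewrite excursion0 /dirac_mass; case: (eqVneq v 1%g) => [v1|_]; last by rewrite mul0e mule0.
  by rewrite v1 invg1 nu1 eqxx in v0.
have hv : fp_head i v = 1%g.
  by rewrite -(fp_head_step (y := 1%g) vi) ?mulg1// fp_head1.
rewrite law_excursion fp_head_injM fp_tail_injM hv mulg1 /fp_tail hv fp_inj1 invg1 mul1g.
rewrite ge0_sume_distrl; last by move=> k _; rewrite mule_ge0 ?excursion_ge0.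
by apply: eq_bigr => k _; rewrite muleA.
Qed.

(** Summing the previous recursion over time turns its convolution into a product. Moving that
    product to the left gives the Green equation of [mu i] with parameter
    [alpha i / (1 - return_mass)], that is, [xi_i]. *)
Lemma green_factor_rec (g : Gam i) : green_fun nu 1 (fp_inj g) =
  dirac_mass R g +
  (alpha i)%:E * walk_step (mu i) (fun h => green_fun nu 1 (fp_inj h)) g +
  green_fun nu 1 (fp_inj g) * return_mass.
Proof.
have l0 := law_ge0 nu_prob.
have greenE x : green_fun nu 1 x = \esum_(n in [set: nat]) law nu n x.
  by apply: eq_esum => n _; rewrite expr1n mul1e.
have returnE : return_mass = \esum_(n in [set: nat]) excursion_return n.+1.
  rewrite /return_mass esum_nat_recl ?add0e// => n; exact: excursion_return_ge0.
rewrite {1}greenE esum_nat_recl// -addeA; congr (_ + _).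
  rewrite /law /= /dirac_mass; congr (if _ then _ else _).
  by rewrite -(fp_inj1 Gam i) (inj_eq (@fp_inj_inj _ _ i)).
rewrite (eq_esum (fun n _ => law_factor_rec n g)) esumD; last 2 first.
- by move=> n _; apply: mule_ge0; [rewrite lee_fin ltW|exact: walk_step_ge0].
- by move=> n _; apply: sume_ge0 => k _; rewrite mule_ge0// excursion_return_ge0.
congr (_ + _); last first.
  rewrite (esum_cauchy_product (a := fun k => law nu k (fp_inj g))
    (b := fun k => excursion_return k.+1)) ?greenE ?returnE// => n.
  exact: excursion_return_ge0.
rewrite esumZl ?lee_fin ?ltW//; last by move=> n _; exact: walk_step_ge0.
rewrite -walk_step_esum//; congr (_ * _); apply: eq_walk_step => h.
by rewrite greenE.
Qed.

Definition head_law (n : nat) (g : Gam i) : \bar R :=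
  \esum_(x in [set: Gamma]) (if fp_head i x == g then law nu n x else 0).

Lemma head_law_ge0 n g : 0 <= head_law n g.
Proof. by apply: esum_ge0 => x _; case: ifP => // _; exact: law_ge0. Qed.

(** The last-visit decomposition is summed over all tails. *)
Lemma head_lawE n g : head_law n g =
  \sum_(k < n.+1) (law nu k (fp_inj g) * excursion_mass (n - k)).
Proof.
have l0 := law_ge0 nu_prob.
rewrite /head_law (@reindexT_esum _ _ _ (fun v => fp_inj g * v)%g); last first.
  by exists (fun x => (fp_inj g)^-1 * x)%g => x; rewrite (mulKg, mulVKg).
transitivity (\esum_(v in [set: Gamma]) \sum_(k < n.+1)
    (law nu k (fp_inj g) * excursion (n - k) v)); last first.
  rewrite esum_sum; last by move=> v k _ _; rewrite !mule_ge0 ?excursion_ge0.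
  by apply: eq_bigr => k _; rewrite esumZl// => v _; exact: excursion_ge0.
apply: eq_esum => v _; rewrite fp_head_injM.
have [hv|hv] := eqVneq (fp_head i v) 1%g; last first.
  rewrite ifF; last first.
    by apply/negbTE; apply: contra_neq hv => /(canRL (mulKg g)); rewrite mulVg.
  by rewrite big1// => k _; rewrite excursion_supp ?mule0.
rewrite hv mulg1 eqxx law_excursion fp_head_injM fp_tail_injM hv mulg1.
by rewrite /fp_tail hv fp_inj1 invg1 mul1g.
Qed.

Lemma excursion_mass0 : excursion_mass 0 = 1.
Proof. exact: esum_dirac_mass. Qed.

Lemma esum_fp_measure_factor :
  \esum_(x in [set: Gamma]) (if in_factor i x then (nu x)%:E else 0) = (alpha i)%:E.
Proof.
rewrite esum_in_factor; have [_ mui] := mu_prob i.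
rewrite -[RHS]mule1 -mui -esumZl ?lee_fin ?ltW//; last by move=> g _; rewrite lee_fin.
by apply: eq_esum => g _; rewrite fp_measure_inj// EFinM.
Qed.

(** Mass balance: the walk entered the factor by its first step, with probability [alpha i], or has
    returned to [1], or is still on its excursion. *)
Lemma excursion_massE n :
  excursion_mass n.+1 + (alpha i)%:E + \sum_(k < n.+2) excursion_return k = 1.
Proof.
have e0 := excursion_ge0.
elim: n => [|n IH].
  rewrite !big_ord_recr big_ord0 /= add0e walk_step_dirac// nu1 !adde0.
  rewrite -esum_fp_measure_factor -esumD//; last by move=> x _; case: ifP.
  have [_ <-] := nu_prob; apply: eq_esum => x _; rewrite excursionS.
  by case: ifP => _; rewrite ?add0e// adde0 walk_step_dirac.
rewrite -[RHS]IH [in LHS]big_ord_recr /= addeA [LHS]addeAC; congr (_ + _).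
rewrite addeAC; congr (_ + _).
rewrite [in RHS]/excursion_mass -[RHS](esum_walk_step nu_prob)//.
rewrite -[X in _ + X](@esum_pick R Gamma 1%g (walk_step nu (excursion n.+1))); last first.
  exact: walk_step_ge0.
rewrite -esumD; last 2 first.
- by [].
- by move=> x _; case: ifP => // _; exact: walk_step_ge0.
apply: eq_esum => x _; rewrite excursionS; case: (eqVneq x 1%g) => [->|x1].
  by rewrite in_factor1 add0e.
by rewrite adde0; case: ifP => // xi; rewrite walk_step_excursion_in_factor.
Qed.

(** * Consequences of a superharmonic function *)

Section Superharmonic.
Variable f : Gamma -> R.
Hypotheses (f0 : forall x, (0 <= f x)%R) (f1 : f 1%g = 1%R).
Hypothesis f_super : forall x,
  \esum_(s in [set: Gamma]) ((nu s)%:E * (f (x * s)%g)%:E) <= (f x)%:E.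

Let f0' x : 0 <= (f x)%:E. Proof. by rewrite lee_fin. Qed.

(** Optional stopping: from time [1] on, the [f]-mass still on the excursion plus the mass already
    returned, which counts [f 1 = 1], does not increase. *)
Lemma return_mass_le : return_mass <=
  \esum_(s in [set: Gamma]) (if in_factor i s then 0 else (nu s * f s)%:E).
Proof.
have e0 := excursion_ge0.
have ef0 n x : 0 <= excursion n x * (f x)%:E by rewrite mule_ge0.
have step u : (forall x, 0 <= u x) ->
    \esum_(y in [set: Gamma]) (walk_step nu u y * (f y)%:E) <=
    \esum_(x in [set: Gamma]) (u x * (f x)%:E).
  move=> u0; rewrite esum_walk_step_mul//; apply: le_esum => x _.
  by rewrite lee_wpmul2l.
have start : \esum_(x in [set: Gamma]) (excursion 1 x * (f x)%:E) =
    \esum_(s in [set: Gamma]) (if in_factor i s then 0 else (nu s * f s)%:E).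
  apply: eq_esum => x _; rewrite excursionS; case: ifP => _; first by rewrite mul0e.
  by rewrite walk_step_dirac// EFinM.
have bound n : \esum_(x in [set: Gamma]) (excursion n.+1 x * (f x)%:E) +
    \sum_(k < n.+2) excursion_return k <=
    \esum_(x in [set: Gamma]) (excursion 1 x * (f x)%:E).
  elim: n => [|n IH].
    by rewrite !big_ord_recr big_ord0 /= walk_step_dirac// nu1 !adde0.
  rewrite (le_trans _ IH)// big_ord_recr /= addeA addeAC leeD2r//.
  rewrite (le_trans _ (step _ (e0 n.+1)))//.
  rewrite -[X in _ + X](@esum_pick R Gamma 1%g (walk_step nu (excursion n.+1))); last first.
    exact: walk_step_ge0.
  rewrite -esumD//; last by move=> x _; case: ifP => // _; exact: walk_step_ge0.
  apply: le_esum => x _; rewrite excursionS; case: (eqVneq x 1%g) => [->|x1].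
    by rewrite in_factor1 mul0e add0e f1 mule1.
  rewrite adde0; case: ifP => // _.
  by rewrite mul0e mule_ge0//; exact: walk_step_ge0.
rewrite -start; apply: esum_nat_le => [n|N]; first exact: excursion_return_ge0.
case: N => [|N]; first by rewrite big_ord0 esum_ge0.
apply: le_trans (bound N); rewrite [X in _ <= _ + X]big_ord_recr /= addeCA leeDl// adde_ge0//.
  exact: esum_ge0.
exact: (excursion_return_ge0 N.+1).
Qed.

(** Each visit to [1] destroys at least [eta] of the [f]-mass, which is [1] at time [0]; so the
    expected number of visits is at most [eta^-1]. *)
Lemma green_fun_super (eta : R) : (0 < eta)%R ->
  \esum_(s in [set: Gamma]) ((nu s)%:E * (f s)%:E) + eta%:E <= 1 ->
  green_fun nu 1 1%g <= (eta^-1)%:E.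
Proof.
move=> eta0 strict; have l0 := law_ge0 nu_prob.
have lf0 n x : 0 <= law nu n x * (f x)%:E by rewrite mule_ge0.
have bound N : \esum_(x in [set: Gamma]) (law nu N x * (f x)%:E) +
    eta%:E * \sum_(n < N) law nu n 1%g <= 1.
  elim: N => [|N IH].
    rewrite big_ord0 mule0 adde0 -[leRHS](@esum_pick R Gamma 1%g (fun=> 1))//.
    apply: le_esum => x _; rewrite /law /= /dirac_mass; case: eqVneq => [->|_].
      by rewrite mul1e f1.
    by rewrite mul0e.
  rewrite big_ord_recr /= ge0_muleDr ?sume_ge0// addeCA addeC (le_trans _ IH)//.
  rewrite leeD2r// (eq_esum (fun x _ => congr1 (fun t => t * _) (lawS nu N x))).
  rewrite esum_walk_step_mul//.
  rewrite -[eta%:E * _](@esum_pick R Gamma 1%g (fun x => eta%:E * law nu N x)); last first.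
    by rewrite mule_ge0// lee_fin ltW.
  have Pf0 x : 0 <= \esum_(s in [set: Gamma]) ((nu s)%:E * (f (x * s)%g)%:E).
    by apply: esum_ge0 => s _; rewrite mule_ge0.
  rewrite -esumD; last 2 first.
  - by move=> x _; rewrite mule_ge0.
  - by move=> x _; case: ifP => // _; rewrite mule_ge0// lee_fin ltW.
  apply: le_esum => x _; case: (eqVneq x 1%g) => [->|_]; last first.
    by rewrite adde0 lee_wpmul2l.
  rewrite [eta%:E * _]muleC -ge0_muleDr//; last by rewrite lee_fin ltW.
  rewrite lee_wpmul2l// f1.
  by under eq_esum do rewrite mul1g.
apply: esum_nat_le => [n|N]; first by rewrite expr1n mul1e.
under eq_bigr do rewrite expr1n mul1e.
rewrite -[leRHS]mule1 lee_pdivlMl// (le_trans _ (bound N))// leeDr//.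
exact: esum_ge0.
Qed.

End Superharmonic.

End Excursions.

(** * Transience *)

Section ProductSuperharmonic.
Local Open Scope ereal_scope.
Variables (R : realType) (r : nat) (Gam : 'I_r -> groupType).
Variables (alpha : 'I_r -> R) (mu : forall i, Gam i -> R).
Arguments mu : clear implicits.
Hypotheses (mu_prob : forall i, prob_mass (mu i)) (mu1 : forall i, mu i 1%g = 0%R).
Hypotheses (alpha_gt0 : forall i, (0 < alpha i)%R) (alpha_sum : (\sum_i alpha i = 1)%R).

Local Notation Gamma := (free_product Gam).
Local Notation nu := (fp_measure alpha mu).

Let mu0 i g : (0 <= mu i g)%R. Proof. by case: (mu_prob i). Qed.

Variables (ka t : 'I_r -> R) (s : forall i, Gam i) (e : R).
Hypotheses (ka_ge0 : forall i, (0 <= ka i)%R) (t_ge0 : forall i, (0 <= t i)%R).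
Hypotheses (s_neq1 : forall i, s i != 1%g) (e_gt0 : (0 < e)%R).
Hypothesis e_small : forall i, (e * (ka i + t i) < 1)%R.

(** Every nontrivial letter costs [ka i] at first order in [e], and the letter [(s i)^-1] costs
    [t i] more. The inverse appears because the superharmonic function is the weight of the inverse
    word, for which a step [s i] puts [(s i)^-1] in front. *)
Definition letter_weight i (g : Gam i) : R :=
  (1 - e * (ka i * (g != 1%g)%:R + t i * (g == (s i)^-1%g)%:R))%R.

Definition word_weight (y : Gamma) : R :=
  (\prod_(a <- fp_word y) letter_weight (tagged a))%R.

(** The loss of weight, divided by [e], caused by steps in the factor [i] from a word whose head in
    that factor is trivial. *)
Definition drift i : R := (alpha i * (ka i + t i * mu i (s i)))%R.

(* The first-order condition in [e] for superharmonicity at a word whose first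
   letter lies in the factor [i]. *)
Hypothesis drift_ge : forall i (g : Gam i), g != 1%g ->
  (alpha i * (t i * (g == (s i)^-1%g)%:R + ka i * mu i g) <=
   (\sum_(j | j != i) drift j) * (1 - e * (ka i + t i)))%R.

Lemma letter_weight1 i : letter_weight (1%g : Gam i) = 1%R.
Proof.
by rewrite /letter_weight eqxx eq_sym invg_eq1 (negbTE (s_neq1 i)) !mulr0 addr0 mulr0 subr0.
Qed.

Lemma letter_weight_ge i (g : Gam i) : (1 - e * (ka i + t i) <= letter_weight g)%R.
Proof.
rewrite lerD2l lerN2 ler_pM2l// lerD//; first by rewrite ler_piMr// lern1 leq_b1.
by rewrite ler_piMr// lern1 leq_b1.
Qed.

Lemma letter_weight_gt0 i (g : Gam i) : (0 < letter_weight g)%R.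
Proof. by rewrite (lt_le_trans _ (letter_weight_ge g))// subr_gt0. Qed.

Lemma word_weight_gt0 y : (0 < word_weight y)%R.
Proof. by apply: prodr_gt0 => a _; exact: letter_weight_gt0. Qed.

Lemma word_weight1 : word_weight 1%g = 1%R.
Proof. by rewrite /word_weight big_nil. Qed.

Lemma word_weight_injM i (g : Gam i) y : word_weight (fp_inj g * y)%g =
  (letter_weight (g * fp_head i y)%g * word_weight (fp_tail i y))%R.
Proof.
rewrite -{1}(fp_inj_head_tail i y) mulgA -fp_injM.
move: (g * _)%g (fp_tail i y) (fp_head_tail i y) => {}g {}y hy.
rewrite /word_weight fp_word_injM lact_far; last first.
  move: hy; rewrite /fp_head; case: y => -[|[j h] w] //= rs.
  apply: contra_eq_neq => ij; move: h rs; rewrite -ij => h rs.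
  by rewrite tagged_as_self; move: rs; rewrite reduced_cons => /andP[].
rewrite /cons_letter; case: eqVneq => [->|_]; last by rewrite big_cons.
by rewrite letter_weight1 mul1r.
Qed.

(** The cost [ka i] is avoided only by the step [h = g], which cancels the letter; the extra cost
    [t i] is paid only by [h = g * s i]. *)
Lemma esum_letter_weight i (g : Gam i) :
  \esum_(h in [set: Gam i]) (mu i h * letter_weight (h^-1 * g)%g)%:E =
  (1 - e * ka i * (1 - mu i g) - e * t i * mu i (g * s i)%g)%:E.
Proof.
have ka1 : (0 <= 1 - e * ka i)%R.
  have := e_small i; rewrite mulrDr => es.
  have := mulr_ge0 (ltW e_gt0) (t_ge0 i); lra.
have ekm : (0 <= e * ka i)%R by rewrite mulr_ge0// ltW.
have etm : (0 <= e * t i)%R by rewrite mulr_ge0// ltW.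
set S := esum _ _.
(* The subtracted terms are moved across, so that only nonnegative families are added before
   finiteness of [S] is known. *)
have SE : S + (e * t i * mu i (g * s i)%g)%:E =
    (1 - e * ka i)%:E + (e * ka i * mu i g)%:E.
  rewrite -[X in _ + X](@esum_pick R _ (g * s i)%g (fun h => (e * t i * mu i h)%:E)); last first.
    by rewrite lee_fin mulr_ge0.
  rewrite -[X in _ = _ + X](@esum_pick R _ g (fun h => (e * ka i * mu i h)%:E)); last first.
    by rewrite lee_fin mulr_ge0.
  have [_ mui] := mu_prob i.
  rewrite -[X in _ = X + _]mule1 -mui -esumZl ?lee_fin//; last first.
    by move=> h _; rewrite lee_fin.
  rewrite /S -!esumD//; last 4 first.
  - by move=> h _; rewrite lee_fin mulr_ge0// ltW// letter_weight_gt0.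
  - by move=> h _; case: ifP => // _; rewrite lee_fin mulr_ge0.
  - by move=> h _; rewrite mule_ge0 ?lee_fin.
  - by move=> h _; case: ifP => // _; rewrite lee_fin mulr_ge0.
  apply: eq_esum => h _; rewrite /letter_weight mulVg_eq1.
  have -> : (h^-1 * g == (s i)^-1)%g = (h == g * s i)%g.
    by rewrite -(inj_eq invg_inj) invgM !invgK -(inj_eq (mulgI g)) mulVKg.
  by do 2 case: eqP => _ /=; rewrite -EFinM -!EFinD; congr (_%:E); ring.
have Sfin : S \is a fin_num.
  rewrite ge0_fin_numE; last first.
    by apply: esum_ge0 => h _; rewrite lee_fin mulr_ge0// ltW// letter_weight_gt0.
  apply: (@le_lt_trans _ _ (S + (e * t i * mu i (g * s i)%g)%:E)).
    by rewrite leeDl// lee_fin mulr_ge0.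
  by rewrite SE -EFinD ltry.
move: SE; rewrite -(fineK Sfin) -!EFinD => -[SE]; congr (_%:E).
by move: SE => /(canRL (addrK _)) ->; ring.
Qed.

Let weight_step i y : \esum_(g in [set: Gam i])
    ((alpha i * mu i g)%:E * (word_weight ((fp_inj g)^-1 * y)%g)%:E) =
  (alpha i * (1 - e * ka i * (1 - mu i (fp_head i y))
     - e * t i * mu i (fp_head i y * s i)%g) * word_weight (fp_tail i y))%:E.
Proof.
rewrite EFinM [in RHS]EFinM -esum_letter_weight.
rewrite -esumZl ?lee_fin ?ltW//; last first.
  by move=> h _; rewrite lee_fin mulr_ge0// ltW// letter_weight_gt0.
rewrite -esumZr ?lee_fin ?ltW ?word_weight_gt0//; last first.
  move=> h _; rewrite -EFinM lee_fin !mulr_ge0//; first exact: ltW.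
  by rewrite ltW// letter_weight_gt0.
apply: eq_esum => g _; rewrite -fp_injV word_weight_injM -!EFinM.
by congr (_%:E); rewrite !mulrA.
Qed.

(** From a word whose first letter is in the factor [i], steps in [i] only alter that letter and may
    raise the weight, while steps in the other factors add a letter and lower it; [drift_ge]
    balances the two. *)
Lemma word_weight_super y : \esum_(x in [set: Gamma])
    ((nu x)%:E * (word_weight (x^-1 * y)%g)%:E) <= (word_weight y)%:E.
Proof.
rewrite esum_fp_measure//; last by move=> x; rewrite lee_fin ltW// word_weight_gt0.
under eq_bigr do rewrite weight_step.
rewrite sumEFin lee_fin.
have drift_ge0 j : (0 <= drift j)%R.
  by rewrite /drift mulr_ge0 ?addr_ge0 ?mulr_ge0// ltW.
case: y => -[|[i g] w] rs.
  have -> : FreeProduct rs = 1%g by exact: val_inj.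
  rewrite word_weight1 -[leRHS]alpha_sum; apply: ler_sum => i _.
  rewrite /fp_tail fp_head1 fp_inj1 invg1 mulg1 word_weight1 mulr1 mu1 mul1g.
  have := drift_ge0 i; rewrite /drift; have := ltW e_gt0; nra.
have g1 : g != 1%g by move: rs; rewrite reduced_cons => /andP[].
set y := FreeProduct rs.
have hi : fp_head i y = g by rewrite /fp_head /= tagged_as_self.
have hj j : j != i -> fp_head j y = 1%g.
  by move=> ji; rewrite /fp_head /= tagged_as1_neq// eq_sym.
have yE : word_weight y = (letter_weight g * word_weight (fp_tail i y))%R.
  by rewrite -{1}[y]mul1g -(fp_inj1 _ i) word_weight_injM mul1g hi.
rewrite (bigD1 i)//= hi.
rewrite (eq_bigr (fun j => (alpha j - e * drift j) * word_weight y)%R); last first.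
  move=> j ji; rewrite hj// /fp_tail hj// fp_inj1 invg1 mul1g mu1 mul1g.
  by rewrite /drift; ring.
rewrite -mulr_suml sumrB -mulr_sumr.
have -> : (\sum_(j < r | j != i) alpha j = 1 - alpha i)%R.
  by rewrite -alpha_sum [in RHS](bigD1 i)//= addrAC subrr add0r.
rewrite yE; set T := word_weight (fp_tail i y).
set W := (\sum_(j < r | j != i) drift j)%R.
have T0 : (0 <= T)%R by rewrite ltW// word_weight_gt0.
have W0 : (0 <= W)%R by apply: sumr_ge0.
rewrite mulrA -mulrDl ler_wpM2r//.
have := drift_ge g1; rewrite -/W => dg.
have := ler_wpM2l W0 (letter_weight_ge g) => WL.
have := mulr_ge0 (mulr_ge0 (ltW (alpha_gt0 i)) (t_ge0 i)) (mu0 (g * s i)%g) => at0.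
(* The required inequality is exactly a multiple of [e]; what remains after division is [drift_ge],
   using the lower bound on the weight of [g]. *)
suff : (e * (alpha i * (t i * (g == (s i)^-1%g)%:R + ka i * mu i g) -
    alpha i * t i * mu i (g * s i)%g - W * letter_weight g) <= 0)%R.
  rewrite {2 3}/letter_weight g1 mulr1; set L := letter_weight g; set d := (_%:R)%R.
  have -> : L = (1 - e * (ka i + t i * d))%R by rewrite /L /letter_weight g1 mulr1.
  nra.
rewrite pmulr_rle0// subr_le0 (le_trans _ WL)//; lra.
Qed.

(** The first step into a factor [j] other than [i] has [f]-mass [alpha j - e * drift j], and
    returning cannot exceed the mass present after that step. *)
Lemma return_mass_weight i :
  return_mass alpha mu i <= (1 - alpha i - e * \sum_(j | j != i) drift j)%:E.
Proof.
pose f (x : Gamma) := word_weight x^-1%g.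
have nf0 x : (0 <= nu x * f x)%R.
  by rewrite mulr_ge0 ?fp_measure_ge0// ltW// word_weight_gt0.
have ww1 j g : ((alpha j * mu j g)%:E * (f (fp_inj g))%:E) =
    (alpha j * mu j g)%:E * (word_weight ((fp_inj g)^-1 * 1)%g)%:E.
  by rewrite mulg1.
have stepE j : \esum_(g in [set: Gam j]) ((alpha j * mu j g)%:E * (f (fp_inj g))%:E) =
    (alpha j - e * drift j)%:E.
  rewrite (eq_esum (fun g _ => ww1 j g)) weight_step.
  rewrite /fp_tail fp_head1 fp_inj1 invg1 !mul1g word_weight1 mu1 /drift.
  by congr (_%:E); ring.
apply: (@le_trans _ _ (\esum_(x in [set: Gamma])
    (if in_factor i x then 0 else (nu x * f x)%:E))).
  apply: return_mass_le => //.
  - by move=> x; rewrite /f ltW// word_weight_gt0.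
  - by rewrite /f invg1 word_weight1.
  - move=> x; rewrite /f; under eq_esum do rewrite invgM.
    exact: word_weight_super.
set X := esum _ _.
have : X + (alpha i - e * drift i)%:E = (1 - e * \sum_j drift j)%:E.
  rewrite -stepE.
  transitivity (\esum_(x in [set: Gamma]) ((nu x)%:E * (f x)%:E)); last first.
    rewrite esum_fp_measure//; last by move=> x; rewrite lee_fin /f ltW// word_weight_gt0.
    under eq_bigr do rewrite stepE.
    by rewrite sumEFin sumrB alpha_sum mulr_sumr.
  rewrite (eq_esum (b := fun g => (nu (fp_inj g) * f (fp_inj g))%:E)); last first.
    by move=> g _; rewrite fp_measure_inj// EFinM.
  rewrite -(esum_in_factor i (fun x => (nu x * f x)%:E)) -esumD; last 2 first.
  - by move=> x _; case: ifP; rewrite ?lee_fin.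
  - by move=> x _; case: ifP; rewrite ?lee_fin.
  by apply: eq_esum => x _; rewrite -EFinM; case: ifP; rewrite (add0e, adde0).
rewrite [in X in _ = X -> _](bigD1 i)//=.
have X0 : 0 <= X by apply: esum_ge0 => x _; case: ifP; rewrite ?lee_fin.
case: X X0 => [X||]// X0; rewrite -EFinD => -[XE]; rewrite lee_fin.
lra.
Qed.

Lemma green_fun_weight : (0 < \sum_j drift j)%R -> green_fun nu 1 1%g < +oo.
Proof.
move=> d0; pose f (x : Gamma) := word_weight x^-1%g.
have eta0 : (0 < e * \sum_j drift j)%R by rewrite mulr_gt0.
apply: le_lt_trans (ltry _).
apply: (@green_fun_super _ _ _ _ _ _ _ _ _ f _ _ _ _ eta0) => //.
- by move=> x; rewrite /f ltW// word_weight_gt0.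
- by rewrite /f invg1 word_weight1.
- move=> x; rewrite /f; under eq_esum do rewrite invgM.
  exact: word_weight_super.
- rewrite esum_fp_measure//; last by move=> x; rewrite lee_fin /f ltW// word_weight_gt0.
  rewrite (eq_bigr (fun j => (alpha j - e * drift j)%:E)); last first.
    move=> j _.
    rewrite (eq_esum (b := fun g => (alpha j * mu j g)%:E *
      (word_weight ((fp_inj g)^-1 * 1)%g)%:E)); last by move=> g _; rewrite mulg1.
    rewrite weight_step.
    rewrite /fp_tail fp_head1 fp_inj1 invg1 !mul1g word_weight1 mu1 /drift.
    by congr (_%:E); ring.
  by rewrite sumEFin sumrB alpha_sum -mulr_sumr -EFinD subrK.
Qed.

End ProductSuperharmonic.

(** * Choice of the weights outside the infinite dihedral case *)

Section Transience.
Variables (R : realType) (r : nat) (Gam : 'I_r -> groupType).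
Variables (alpha : 'I_r -> R) (mu : forall i, Gam i -> R).
Arguments mu : clear implicits.
Hypotheses (mu_prob : forall i, prob_mass (mu i)) (mu1 : forall i, mu i 1%g = 0%R).
Hypotheses (alpha_gt0 : forall i, 0 < alpha i) (alpha_sum : \sum_i alpha i = 1).
Hypothesis mu_gen : forall i, semigroup_generates [set g | mu i g != 0].
Hypothesis r_ge2 : (2 <= r)%N.
Hypothesis not_dihedral : ~ (r = 2%N /\ forall i, ([set: Gam i] #= `I_2)%card).

Local Notation nu := (fp_measure alpha mu).

(** The second clause says that, with positive probability, the walk leaves [1] through another
    factor and never returns; it amounts to [xi_i < 1]. *)
Definition transient_walk : Prop :=
  (green_fun nu 1 1%g < +oo)%E /\
  forall i, (return_mass alpha mu i < (1 - alpha i)%:E)%E.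

Let mu0 i g : 0 <= mu i g. Proof. by case: (mu_prob i). Qed.

Let mu_le1 i g : mu i g <= 1.
Proof.
rewrite -lee_fin; have [_ <-] := mu_prob i.
by apply: le_esum_term => // h _; rewrite lee_fin.
Qed.

(** The two strict inequalities are the conditions at [e = 0], for a letter other than [(s i)^-1]
    and for [(s i)^-1]; finitely many strict inequalities survive for small [e]. *)
Let transient_of_drift (ka t : 'I_r -> R) (s : forall i, Gam i) :
  (forall i, 0 < ka i) -> (forall i, 0 <= t i) -> (forall i, s i != 1%g) ->
  (forall i, alpha i * ka i < \sum_(j | j != i) drift alpha mu ka t s j) ->
  (forall i, alpha i * (t i + ka i * mu i (s i)^-1%g) <
     \sum_(j | j != i) drift alpha mu ka t s j) ->
  transient_walk.
Proof.
move=> ka0 t0 s1 drift1 drift2.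
set d := drift alpha mu ka t s in drift1 drift2.
have d0 i : 0 < d i.
  by rewrite mulr_gt0// ltr_pwDl// mulr_ge0.
pose W i := \sum_(j | j != i) d j.
pose D i := Num.min (W i - alpha i * ka i)
  (W i - alpha i * (t i + ka i * mu i (s i)^-1%g)).
have D0 i : 0 < D i by rewrite lt_min !subr_gt0 drift1 drift2.
have W0 i : 0 < W i by rewrite (le_lt_trans _ (drift1 i))// mulr_ge0// ltW.
have kt0 i : 0 < ka i + t i by rewrite ltr_pwDl.
(* With [e = S^-1], the first summand makes the correction to [drift_ge] smaller than the margin
   [D i], and the second keeps the letter weights positive. *)
pose S := 1 + \sum_i (W i * (ka i + t i) / D i + (ka i + t i)).
have term0 i : 0 < W i * (ka i + t i) / D i by rewrite !mulr_gt0// invr_gt0.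
have S_ge i : 1 + (W i * (ka i + t i) / D i + (ka i + t i)) <= S.
  rewrite lerD2l (bigD1 i)//= lerDl sumr_ge0// => j _.
  by rewrite addr_ge0// ltW.
have S0 : 0 < S.
  have [i _] : exists i : 'I_r, True by exists (Ordinal (ltnW r_ge2)).
  apply: lt_le_trans (S_ge i); rewrite addr_gt0// addr_gt0//.
have e0 : 0 < S^-1 by rewrite invr_gt0.
have e_small i : S^-1 * (ka i + t i) < 1.
  rewrite mulrC ltr_pdivrMr// mul1r; apply: lt_le_trans (S_ge i).
  by have := term0 i; lra.
have drift_ge i (g : Gam i) : g != 1%g ->
    alpha i * (t i * (g == (s i)^-1%g)%:R + ka i * mu i g) <=
    (\sum_(j | j != i) d j) * (1 - S^-1 * (ka i + t i)).
  move=> g1; rewrite -/(W i).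
  have WD : W i * (S^-1 * (ka i + t i)) <= D i.
    rewrite mulrCA mulrC ler_pdivrMr// -ler_pdivrMl// mulrC.
    by apply: le_trans (S_ge i); have := kt0 i; lra.
  have [DW1 DW2] : D i <= W i - alpha i * ka i /\
      D i <= W i - alpha i * (t i + ka i * mu i (s i)^-1%g).
    by rewrite /D; split; rewrite ge_min lexx ?orbT.
  rewrite mulrBr mulr1; case: eqVneq => [->|_] /=; first by rewrite mulr1; lra.
  rewrite mulr0 add0r.
  have : alpha i * (ka i * mu i g) <= alpha i * ka i.
    rewrite ler_wpM2l//; first exact: ltW.
    by rewrite ler_piMr//; exact: ltW.
  lra.
split.
  apply: (green_fun_weight mu_prob mu1 alpha_gt0 alpha_sum (fun i => ltW (ka0 i)) t0 s1
    e0 e_small drift_ge).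
  rewrite (bigD1 (Ordinal (ltnW r_ge2)))//= ltr_pwDl// sumr_ge0// => j _.
  exact: ltW.
move=> i; apply: le_lt_trans (return_mass_weight mu_prob mu1 alpha_gt0 alpha_sum
  (fun i => ltW (ka0 i)) t0 s1 e0 e_small drift_ge i) _.
by rewrite lte_fin ltrBlDr ltrDl mulr_gt0//; exact: W0.
Qed.

Let support_neq1 i : exists g, g != 1%g /\ 0 < mu i g.
Proof.
have [l [l0 lA _]] := mu_gen (1%g : Gam i); case: l l0 lA => // g l _ lA.
have /= g0 := lA g (mem_head _ _); exists g; split.
  by apply: contra_neq g0 => ->.
by rewrite lt_neqAle eq_sym g0 mu0.
Qed.

Let mass_one i g : 1 <= mu i g -> forall h, h != g -> mu i h = 0.
Proof.
move=> g1 h hg; have [_] := mu_prob i.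
rewrite (esumID [set g])//=; last by move=> x _; rewrite lee_fin.
rewrite setTI esum_set1 ?lee_fin//.
have -> : mu i g = 1 by apply/eqP; rewrite eq_le mu_le1 g1.
set X := (\esum_(_ in _) _)%E => X1.
have {X1} X0 : X = 0%E.
  have X_ge0 : (0 <= X)%E by apply: esum_ge0 => x _; rewrite lee_fin.
  case: X X1 X_ge0 => [x||]//=; rewrite -EFinD => -[x1] _; congr (_%:E).
  by apply: (@addrI _ 1); rewrite x1 addr0.
suff : (mu i h)%:E = 0%E by case.
apply: (esum_eq0P (D := [set: Gam i] `&` ~` [set g]) (f := fun x => (mu i x)%:E) _ X0).
  by move=> x _; rewrite lee_fin.
by split=> //= hg'; rewrite hg' eqxx in hg.
Qed.

(** Used in contrapositive form: a factor that does not have two elements contains a step [g] with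
    [mu k g^-1 < (1 + mu k g) / 2], just the room needed to choose the weights. *)
Let card2_of_symmetric k :
  (forall g, g != 1%g -> 0 < mu k g -> (1 + mu k g) / 2 <= mu k g^-1%g) ->
  ([set: Gam k] #= `I_2)%card.
Proof.
move=> sym; have [g [g1 g0]] := support_neq1 k.
have gV := sym g g1 g0; have gV1 : g^-1%g != 1%g by rewrite invg_eq1.
have /(sym _ gV1) : 0 < mu k g^-1%g by lra.
(* The assumption at [g] and at [g^-1] combine into [mu k g >= 1]; so [g] carries all the mass,
   equals its inverse and generates the group. *)
rewrite invgK => gVV; have mg : 1 <= mu k g by lra.
have gE : g^-1%g = g.
  by apply/eqP; apply: contraTT g0 => /(mass_one mg) gV0; rewrite -leNgt; lra.
have only x : x = 1%g \/ x = g.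
  have [l [_ lA ->]] := mu_gen x.
  have {}lA : {in l, forall y, y = g}.
    move=> y /lA /=; apply: contra_neq_eq; exact: mass_one.
  elim: l lA => [|y l IH] lA; first by left; rewrite big_nil.
  rewrite big_cons (lA y (mem_head _ _)).
  have [z zl|->|->] := IH; first by apply: lA; rewrite inE zl orbT.
    by right; rewrite mulg1.
  by left; rewrite -{1}gE mulVg.
apply/card_set_bijP; exists (fun x => (x == g) : nat); split.
- by move=> x _ /=; rewrite ltnS leq_b1.
- move=> x y _ _ /=; have [->|->] := only x; have [->|->] := only y => //=;
    by rewrite eqxx eq_sym (negbTE g1).
- move=> [|[|//]] _ /=; first by exists 1%g => //; rewrite eq_sym (negbTE g1).
  by exists g => //; rewrite eqxx.
Qed.

Let sum_drift_ge (d : 'I_r -> R) i j : (forall l, 0 <= d l) -> j != i ->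
  d j <= \sum_(l | l != i) d l.
Proof. by move=> d0 ji; rewrite (bigD1 j)//= lerDl sumr_ge0. Qed.

(** The extra weight on the letter [s0^-1] raises the drift of the factor [k] strictly above [1],
    leaving an interval for the common drift [c] of the other factors; this works even with a single
    other factor. *)
Let transient_big k : ~ ([set: Gam k] #= `I_2)%card -> transient_walk.
Proof.
move=> k3.
have [s0 [s01 s00 s0V]] : exists g, [/\ g != 1%g, 0 < mu k g &
    mu k g^-1%g < (1 + mu k g) / 2].
  apply: contrapT => none; apply: k3; apply: card2_of_symmetric => g g1 g0.
  by rewrite leNgt; apply/negP => gV; apply: none; exists g.
(* A dependent family with prescribed value [s0] at [k]; the transport along [i = k] is what lets
   that value be stated for all [i] at once. *)
have s_exists i : {g : Gam i |
    g != 1%g /\ forall ik : i = k, (eq_rect i (fun i => Gam i) g k ik) = s0}.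
  apply: cid; have [ik|ik] := eqVneq i k.
    move: s0 s01 s00 s0V {k3}; rewrite -ik => s0 s01 s00 s0V.
    by exists s0; split=> // e; rewrite (eq_irrelevance e erefl).
  have [g [g1 _]] := support_neq1 i; exists g; split=> // e.
  by rewrite e eqxx in ik.
pose s i := sval (s_exists i).
have sk : s k = s0 by have [_ /(_ erefl)] := svalP (s_exists k).
have s1 i : s i != 1%g by have [] := svalP (s_exists i).
pose m0 := mu k s0; pose m1 := mu k s0^-1%g.
(* Midpoint of the admissible interval: [1] and [1 / 2 + m1] are the two demands at the factor [k],
   and [1 + m0 / 2], the drift of [k], bounds [c] in the others. *)
pose c := (Num.max 1 (1 / 2 + m1) + (1 + m0 / 2)) / 2.
have [c1 [c2 c3]] : 1 < c /\ 1 / 2 + m1 < c /\ c < 1 + m0 / 2.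
  have : 1 <= Num.max 1 (1 / 2 + m1) by rewrite le_max lexx.
  have : 1 / 2 + m1 <= Num.max 1 (1 / 2 + m1) by rewrite le_max lexx orbT.
  have : Num.max 1 (1 / 2 + m1) < 1 + m0 / 2.
    by rewrite gt_max; apply/andP; split; rewrite /m1 /m0; lra.
  by rewrite /c; lra.
pose ka i := (if i == k then 1 else c) / alpha i.
pose t i := (if i == k then 1 / 2 else 0) / alpha i.
have aN i : alpha i != 0 by rewrite gt_eqF.
have aka i : alpha i * ka i = if i == k then 1 else c by rewrite mulrC divfK.
have at_ i : alpha i * t i = if i == k then 1 / 2 else 0 by rewrite mulrC divfK.
have driftE i : drift alpha mu ka t s i = if i == k then 1 + m0 / 2 else c.
  rewrite /drift mulrDr mulrA aka at_; case: eqVneq => [->|_]; last by rewrite mul0r addr0.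
  by rewrite sk -/m0; lra.
have drift0 i : 0 <= drift alpha mu ka t s i.
  by rewrite driftE; case: ifP => _; lra.
have Wk : c <= \sum_(j | j != k) drift alpha mu ka t s j.
  have [j jk] : exists j : 'I_r, j != k.
    have [k0|k0] := eqVneq (k : nat) 0%N.
      by exists (Ordinal r_ge2); apply/eqP => /(congr1 val) /=; rewrite k0.
    by exists (Ordinal (ltnW r_ge2)); apply/eqP => /(congr1 val) /= k0'; rewrite -k0' in k0.
  by apply: le_trans (sum_drift_ge drift0 jk); rewrite driftE (negbTE jk).
have Wi i : i != k -> 1 + m0 / 2 <= \sum_(j | j != i) drift alpha mu ka t s j.
  move=> ik; have ki : k != i by rewrite eq_sym.
  by apply: le_trans (sum_drift_ge drift0 ki); rewrite driftE eqxx.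
apply: (@transient_of_drift ka t s) => //.
- by move=> i; rewrite divr_gt0//; case: ifP => _; lra.
- by move=> i; rewrite divr_ge0//; [case: ifP => _; lra|exact: ltW].
- move=> i; rewrite aka; have [->|ik] := eqVneq i k; first by lra.
  by have := Wi i ik; lra.
- move=> i; rewrite mulrDr mulrA aka at_; have [->|ik] := eqVneq i k.
    by rewrite sk -/m1; lra.
  have := Wi i ik; have := mu_le1 (s i)^-1%g; have := mu0 (s i)^-1%g; nra.
Qed.

(** With every drift equal to [1], the other factors total [r - 1], which exceeds [1]; no special
    letter has to be favoured. *)
Let transient_small : (2 < r)%N -> transient_walk.
Proof.
move=> r3; pose s i := sval (cid (support_neq1 i)).
have s1 i : s i != 1%g by have [] := svalP (cid (support_neq1 i)).
pose ka i := (alpha i)^-1; pose t (_ : 'I_r) : R := 0.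
have driftE i : drift alpha mu ka t s i = 1.
  by rewrite /drift mul0r addr0 mulfV// gt_eqF.
have W i : 1 < \sum_(j | j != i) drift alpha mu ka t s j.
  rewrite (eq_bigr (fun=> 1)); last by move=> j _; rewrite driftE.
  by rewrite sumr_const cardC1 card_ord ltr1n -ltnS prednK// ltnW// ltnW.
apply: (@transient_of_drift ka t s) => //.
- by move=> i; rewrite invr_gt0.
- by move=> i; rewrite mulfV ?gt_eqF.
- move=> i; rewrite add0r mulrA mulfV ?gt_eqF// mul1r.
  by rewrite (le_lt_trans (mu_le1 _)).
Qed.

Lemma free_product_transient : transient_walk.
Proof.
have [all2|/existsNP[k]] := pselect (forall i, ([set: Gam i] #= `I_2)%card).
  apply: transient_small; rewrite ltn_neqAle r_ge2 andbT; apply/eqP => r2.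
  exact: not_dihedral.
exact: transient_big.
Qed.

End Transience.

(** * Entropy as a rate of escape *)

Section GreenReal.
Local Open Scope ereal_scope.
Variables (R : realType) (r : nat) (Gam : 'I_r -> groupType).
Variables (alpha : 'I_r -> R) (mu : forall i, Gam i -> R).
Arguments mu : clear implicits.
Hypotheses (mu_prob : forall i, prob_mass (mu i)) (mu1 : forall i, mu i 1%g = 0%R).
Hypotheses (alpha_gt0 : forall i, (0 < alpha i)%R) (alpha_sum : (\sum_i alpha i = 1)%R).
Hypothesis mu_gen : forall i, semigroup_generates [set g | mu i g != 0%R].
Hypothesis r_gt0 : (0 < r)%N.

Local Notation Gamma := (free_product Gam).
Local Notation nu := (fp_measure alpha mu).

Hypothesis green_finite : green_fun nu 1 1%g < +oo.
Hypothesis return_lt : forall i, return_mass alpha mu i < (1 - alpha i)%:E.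

Let nu_prob : prob_mass nu := fp_measure_prob mu_prob mu1 alpha_gt0 alpha_sum.
Let nu0 x : 0 <= (nu x)%:E. Proof. by rewrite lee_fin; case: nu_prob. Qed.
Let mu0 i g : (0 <= mu i g)%R. Proof. by case: (mu_prob i). Qed.
Let nu_gen := fp_measure_gen mu1 alpha_gt0 mu_gen r_gt0.
Let law_ge0' := law_ge0 nu_prob.

Definition green_real (z : R) (x : Gamma) : R := fine (green_fun nu z x).

Lemma green_fun_fin z x : (0 <= z <= 1)%R -> green_fun nu z x \is a fin_num.
Proof.
move=> /andP[z0 z1]; rewrite ge0_fin_numE ?green_fun_ge0//.
apply: le_lt_trans green_finite.
apply: le_trans (green_fun_le nu_prob ler01 x (lexx _)).
apply: le_esum => n _; rewrite lee_wpmul2r// lee_fin expr1n exprn_ile1//.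
Qed.

Lemma green_realK z x : (0 <= z <= 1)%R -> (green_real z x)%:E = green_fun nu z x.
Proof. by move=> z01; rewrite fineK ?green_fun_fin. Qed.

Lemma green_real_gt0 z x : (0 < z <= 1)%R -> (0 < green_real z x)%R.
Proof.
move=> /andP[z0 z1]; have z01 : (0 <= z <= 1)%R by rewrite z1 ltW.
by rewrite -lte_fin green_realK//; exact: green_fun_gt0.
Qed.

Lemma green_real_le z x : (0 <= z <= 1)%R -> (green_real z x <= green_real z 1%g)%R.
Proof.
move=> z01; rewrite -lee_fin !green_realK//; case/andP: z01 => z0 z1.
exact: green_fun_le.
Qed.

Lemma law_le_green n x : law nu n x <= (green_real 1 x)%:E.
Proof.
rewrite green_realK ?ler01 ?lexx//.
apply: le_trans (le_esum_term (D := setT) (t := n) _ _) => //.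
  by rewrite expr1n mul1e.
by move=> k _; rewrite expr1n mul1e.
Qed.

Lemma green_real_step_ge z i (g : Gam i) x : (0 <= z <= 1)%R ->
  (z * (alpha i * mu i g) * green_real z x <= green_real z (fp_inj g * x)%g)%R.
Proof.
move=> z01; have z0 : (0 <= z)%R by case/andP: z01.
rewrite -lee_fin 2!EFinM !green_realK// -muleA -fp_measure_inj//.
exact: green_fun_step_ge.
Qed.

(** Outside the factor the head is frozen, so the words of head [g] can be entered only through
    [fp_inj g]; for [g = 1] the walk already starts there. *)
Lemma avoiding_cone i (g : Gam i) n x : fp_head i x = g ->
  avoiding nu (fp_inj g) n x = 0.
Proof.
rewrite /avoiding; elim: n x => [|n IH] x hx /=.
  case: ifPn => // xg; rewrite /dirac_mass; case: eqVneq => // x1.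
  by move: xg; rewrite -hx x1 fp_head1 fp_inj1 eqxx.
case: ifPn => // xg; have xN : ~~ in_factor i x by rewrite /in_factor hx.
apply: esum1 => y _.
have [->|yx] := eqVneq (nu (y^-1 * x)%g) 0%R; first by rewrite mule0.
by rewrite IH ?mul0e// -(fp_head_stepV xN yx).
Qed.

(** A path to [x] passes through its head: the factor before that visit is the ratio of the Green
    functions at the head and at [1], and what follows is the Green function of the tail. *)
Lemma green_real_cone z i x : (0 <= z <= 1)%R ->
  (green_real z x * green_real z 1%g =
   green_real z (fp_inj (fp_head i x)) * green_real z (fp_tail i x))%R.
Proof.
move=> z01; have z0 : (0 <= z)%R by case/andP: z01.
apply: EFin_inj; rewrite 2!EFinM !green_realK//.
rewrite (green_fun_first_visit nu_prob z0 (fun n => avoiding_cone n (erefl (fp_head i x)))).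
rewrite [X in _ = X * _](green_funE nu_prob z0).
by rewrite -!muleA; congr (_ * _); rewrite muleC.
Qed.

(** [g x] and [x] have the same tail, whose contribution cancels. *)
Lemma green_real_ratio z i (g : Gam i) x : (0 < z <= 1)%R ->
  (green_real z (fp_inj g * x)%g * green_real z (fp_inj (fp_head i x)) =
   green_real z (fp_inj (g * fp_head i x)%g) * green_real z x)%R.
Proof.
move=> z01; have z01' : (0 <= z <= 1)%R by case/andP: z01 => /ltW -> ->.
have G1 : green_real z 1%g != 0%R by rewrite gt_eqF// green_real_gt0.
apply: (mulIf G1); rewrite -mulrA [(_ * green_real z 1%g)%R]mulrC mulrA.
rewrite (green_real_cone i)// fp_head_injM fp_tail_injM.
rewrite -[RHS]mulrA (green_real_cone i x)//; ring.
Qed.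

(** * Reduction to the walk on one factor, and the limit law of the head *)

Section Factor.
Variable i : 'I_r.

Definition return_real : R := fine (return_mass alpha mu i).
Definition xi_real : R := (alpha i / (1 - return_real))%R.

Let return_ge0 : 0 <= return_mass alpha mu i.
Proof. by apply: esum_ge0 => n _; exact: excursion_return_ge0. Qed.

Lemma return_realK : return_real%:E = return_mass alpha mu i.
Proof. by rewrite fineK// ge0_fin_numE// (lt_trans (return_lt i)) ?ltry. Qed.

Lemma return_real_lt : (return_real < 1 - alpha i)%R.
Proof. by rewrite -lte_fin return_realK. Qed.

Let denom_gt0 : (0 < 1 - return_real)%R.
Proof. by have := return_real_lt; have := alpha_gt0 i; lra. Qed.

Lemma xi_real_gt0 : (0 < xi_real)%R. Proof. exact: divr_gt0. Qed.

Lemma xi_real_lt1 : (xi_real < 1)%R.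
Proof. by rewrite ltr_pdivrMr// mul1r; have := return_real_lt; lra. Qed.

(** By [green_factor_rec] the left side is a bounded solution of the Green equation of [mu i] at
    [xi_real], and that equation has a single bounded solution. *)
Lemma green_factor (g : Gam i) :
  ((1 - return_real) * green_real 1 (fp_inj g))%:E = green_fun (mu i) xi_real g.
Proof.
have h01 : (0 <= (1 : R) <= 1)%R by rewrite ler01 lexx.
have G0 x : (0 <= green_real 1 x)%R by rewrite ltW// green_real_gt0// ltr01 lexx.
pose Phi (g : Gam i) : \bar R := ((1 - return_real) * green_real 1 (fp_inj g))%:E.
apply: (@green_fun_unique _ _ _ (mu_prob i) _ (ltW xi_real_gt0) Phi
  ((1 - return_real) * green_real 1 1%g)%R xi_real_lt1).
  move=> h; have d0 := ltW denom_gt0.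
  by rewrite !lee_fin mulr_ge0//= ler_wpM2l//; exact: green_real_le.
move=> h; rewrite /Phi.
have := green_factor_rec mu_prob mu1 alpha_gt0 alpha_sum h.
rewrite -return_realK -!green_realK//.
set W := walk_step _ _ _.
have WE : walk_step (mu i) (fun g => ((1 - return_real) * green_real 1 (fp_inj g))%:E) h =
    (1 - return_real)%:E * W.
  rewrite /W -walk_stepZ// ?lee_fin ?ltW//; last first.
    by move=> x; exact: green_fun_ge0.
  by apply: eq_walk_step => x; rewrite EFinM green_realK.
rewrite WE; have W0 : 0 <= W.
  by apply: walk_step_ge0 => // x; exact: green_fun_ge0.
have d0 := dirac_mass_ge0 R h; rewrite /dirac_mass in d0 *.
(* An infinite [W] would make the right side of the recursion infinite, while its left side is
   finite. *)
case: W W0 {WE} => [w||]// w0; last first.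
  rewrite gt0_muley ?lte_fin//.
  by case: ifP.
rewrite -!EFinM; case: ifP => _; rewrite -!EFinD => -[GE]; congr (_%:E);
  rewrite /xi_real mulrA divfK ?gt_eqF//; lra.
Qed.

Lemma esum_green_factor :
  \esum_(g in [set: Gam i]) (green_real 1 (fp_inj g))%:E =
  (((1 - xi_real) * (1 - return_real))^-1)%:E.
Proof.
rewrite (eq_esum (b := fun g => ((1 - return_real)^-1)%:E * green_fun (mu i) xi_real g)).
  rewrite esumZl ?esum_green_fun//.
  - by rewrite -EFinM -invfM mulrC.
  - exact: ltW xi_real_gt0.
  - exact: xi_real_lt1.
  - by rewrite lee_fin invr_ge0 ltW.
  - by move=> g _; apply: green_fun_ge0 => //; exact: ltW xi_real_gt0.
by move=> g _; rewrite -green_factor -EFinM mulrA mulVf ?mul1r// gt_eqF.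
Qed.

(** The Green function counts visits to [g], and the coefficient is the probability that such a
    visit is followed by an excursion that never returns to the factor. *)
Definition head_limit (g : Gam i) : R :=
  ((1 - alpha i - return_real) * green_real 1 (fp_inj g))%R.

Lemma head_limitE g :
  (head_limit g)%:E = ((1 - xi_real)%:E * green_fun (mu i) xi_real g).
Proof.
rewrite -green_factor -EFinM; congr (_%:E); rewrite mulrA; congr (_ * _)%R.
by rewrite /xi_real mulrBl mul1r divfK ?gt_eqF//; lra.
Qed.

Lemma head_limit_ge0 g : (0 <= head_limit g)%R.
Proof.
rewrite mulr_ge0//; first by have := return_real_lt; lra.
by rewrite ltW// green_real_gt0// ltr01 lexx.
Qed.

Lemma esum_head_limit : \esum_(g in [set: Gam i]) (head_limit g)%:E = 1.
Proof.
have xi0 := ltW xi_real_gt0.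
have xi1 : (0 < 1 - xi_real)%R by rewrite subr_gt0 xi_real_lt1.
rewrite (eq_esum (fun g _ => head_limitE g)) esumZl ?lee_fin ?ltW//; last first.
  by move=> g _; exact: green_fun_ge0.
by rewrite esum_green_fun ?xi_real_lt1// -EFinM mulfV// gt_eqF.
Qed.

Definition head_real n (g : Gam i) : R := fine (head_law alpha mu n g).

Lemma esum_head_law n (F : Gam i -> \bar R) : (forall g, 0 <= F g) ->
  \esum_(g in [set: Gam i]) (head_law alpha mu n g * F g) =
  \esum_(x in [set: Gamma]) (law nu n x * F (fp_head i x)).
Proof.
move=> F0; rewrite /head_law.
transitivity (\esum_(g in [set: Gam i]) \esum_(x in [set: Gamma])
    (if g == fp_head i x then law nu n x * F g else 0)).
  apply: eq_esum => g _; rewrite -esumZr//; last by move=> x _; case: ifP.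
  by apply: eq_esum => x _; rewrite eq_sym; case: ifP; rewrite ?mul0e.
rewrite exchange_esum; last by move=> g x; case: ifP => // _; rewrite mule_ge0.
apply: eq_esum => x _.
by rewrite (esum_pick (f := fun g => law nu n x * F g))// mule_ge0.
Qed.

Lemma head_law_le1 n (g : Gam i) : head_law alpha mu n g <= 1.
Proof.
have := @esum_head_law n (fun=> 1) (fun=> lee01).
under eq_esum do rewrite mule1.
under [RHS]eq_esum do rewrite mule1.
rewrite esum_law// => <-; apply: le_esum_term => // h _.
exact: head_law_ge0.
Qed.

Lemma head_realK n g : (head_real n g)%:E = head_law alpha mu n g.
Proof.
rewrite fineK// ge0_fin_numE ?head_law_ge0//.
by rewrite (le_lt_trans (head_law_le1 _ _)) ?ltry.
Qed.

Lemma head_real_ge0 n g : (0 <= head_real n g)%R.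
Proof. by rewrite -lee_fin head_realK head_law_ge0. Qed.

Lemma excursion_mass_le1 n : excursion_mass alpha mu i n <= 1.
Proof.
case: n => [|n]; first by rewrite excursion_mass0.
rewrite -(excursion_massE mu_prob mu1 alpha_gt0 alpha_sum i n) -addeA leeDl//.
rewrite adde_ge0//; first by rewrite lee_fin ltW.
by apply: sume_ge0 => k _; exact: excursion_return_ge0.
Qed.

Let mass_fin n : excursion_mass alpha mu i n \is a fin_num.
Proof.
rewrite ge0_fin_numE ?excursion_mass_ge0//.
by rewrite (le_lt_trans (excursion_mass_le1 _)) ?ltry.
Qed.

(** By the mass balance, the excursion mass is [1 - alpha i] minus the partial sums of
    [return_mass]. *)
Lemma excursion_mass_cvg :
  fine (excursion_mass alpha mu i n) @[n --> \oo] --> (1 - alpha i - return_real)%R.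
Proof.
have e0 n := excursion_return_ge0 mu_prob mu1 alpha_gt0 alpha_sum i n.
have efin n : excursion_return alpha mu i n \is a fin_num.
  rewrite ge0_fin_numE//; apply: le_lt_trans (lt_trans (return_lt i) (ltry _)).
  by apply: le_esum_term => // k _; exact: e0.
rewrite -(cvg_shiftS (fun n => fine (excursion_mass alpha mu i n))).
have -> : (fun n => fine (excursion_mass alpha mu i n.+1)) =
    (fun n => 1 - alpha i - \sum_(k < n.+2) fine (excursion_return alpha mu i k))%R.
  apply/funext => n; have := excursion_massE mu_prob mu1 alpha_gt0 alpha_sum i n.
  rewrite -(fineK (mass_fin n.+1)).
  under eq_bigr do rewrite -(fineK (efin _)).
  by rewrite sumEFin -!EFinD => -[<-]; ring.
apply: cvgB; first exact: cvg_cst.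
rewrite (cvg_shiftS (fun n => \sum_(k < n.+1) fine (excursion_return alpha mu i k))%R).
rewrite (cvg_shiftS (fun n => \sum_(k < n) fine (excursion_return alpha mu i k))%R).
have : (\sum_(k < n) (fine (excursion_return alpha mu i k))%:E) @[n --> \oo] -->
    return_real%:E.
  rewrite return_realK /return_mass -nneseries_esumT//.
  under eq_fun do (under eq_bigr do rewrite fineK//; rewrite -(big_mkord xpredT)).
  exact: is_cvg_nneseries.
move=> /fine_cvgP[_]; apply: cvg_trans; apply: near_eq_cvg.
by apply: nearW => n /=; rewrite sumEFin.
Qed.

Lemma head_real_le n g : (head_real n g <= green_real 1 (fp_inj g))%R.
Proof.
rewrite -lee_fin head_realK head_lawE// green_realK ?ler01 ?lexx//.
apply: (@le_trans _ _ (\sum_(k < n.+1) (1 ^+ k)%:E * law nu k (fp_inj g))); last first.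
  by apply: esum_nat_ge => k; rewrite expr1n mul1e.
apply: lee_sum => k _; rewrite expr1n mul1e -[leRHS]mule1 lee_wpmul2l//.
exact: excursion_mass_le1.
Qed.

(** [head_lawE] convolves the law at [g], summable by transience, with the bounded convergent
    excursion masses; dominated convergence with majorant [a] applies. *)
Lemma head_real_cvg g : head_real n g @[n --> \oo] --> head_limit g.
Proof.
pose a k := fine (law nu k (fp_inj g)); pose c k := fine (excursion_mass alpha mu i k).
have a0 k : (0 <= a k)%R by rewrite fine_ge0.
have c0 k : (0 <= c k)%R by rewrite fine_ge0// excursion_mass_ge0.
have aE k : (a k)%:E = law nu k (fp_inj g) by rewrite fineK// law_fin.
have cE k : (c k)%:E = excursion_mass alpha mu i k by rewrite fineK.
have c1 k : (c k <= 1)%R by rewrite -lee_fin cE excursion_mass_le1.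
have sum_a : \esum_(k in [set: nat]) (a k)%:E = (green_real 1 (fp_inj g))%:E.
  rewrite green_realK ?ler01 ?lexx//; apply: eq_esum => k _.
  by rewrite expr1n mul1e aE.
have limE : \esum_(k in [set: nat]) (a k * (1 - alpha i - return_real))%:E =
    (head_limit g)%:E.
  under eq_esum do rewrite EFinM.
  rewrite esumZr; last 2 first.
  - by rewrite lee_fin; have := return_real_lt; lra.
  - by move=> k _; rewrite lee_fin.
  by rewrite sum_a -EFinM mulrC.
have fE n : \esum_(k in [set: nat]) (if (k <= n)%N then a k * c (n - k)%N else 0)%:E =
    head_law alpha mu n g.
  rewrite head_lawE//.
  transitivity (\esum_(k in `I_n.+1) (a k * c (n - k)%N)%:E).
    rewrite [RHS]esum_mkcond; apply: eq_esum => k _.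
    rewrite [k \in _](_ : _ = (k <= n)%N); first by case: ifP.
    by apply/idP/idP; rewrite inE.
  rewrite esum_fset//=; last by move=> k _; rewrite lee_fin mulr_ge0.
  by rewrite -fsbig_ord; apply: eq_bigr => k _; rewrite EFinM aE cE.
suff : (fun n => \esum_(k in [set: nat])
    (if (k <= n)%N then a k * c (n - k)%N else 0)%:E) @ \oo -->
    \esum_(k in [set: nat]) (a k * (1 - alpha i - return_real))%:E.
  by rewrite limE (funext fE) => /fine_cvgP[].
apply: (esum_dominated (g := a)).
- move=> n k; case: ifP => _; last by rewrite lexx a0.
  by rewrite mulr_ge0//= ler_piMr.
- move=> k; have : (fun n => a k * c (n - k)%N)%R @ \oo --> (a k * (1 - alpha i - return_real))%R.
    apply: cvgM; first exact: cvg_cst.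
    rewrite -(cvg_shiftn k (fun n => c (n - k)%N)).
    under eq_fun do rewrite addnK.
    exact: excursion_mass_cvg.
  apply: cvg_trans; apply: near_eq_cvg; near=> n; rewrite ifT//.
  by near: n; exact: nbhs_infty_ge.
- by rewrite sum_a ltry.
Unshelve. all: by end_near. Qed.

End Factor.

Lemma green_real_cvg x : green_real (1 - n.+2%:R^-1) x @[n --> \oo] --> green_real 1 x.
Proof.
have z01 n : (0 <= (1 - n.+2%:R^-1 : R) <= 1)%R.
  rewrite gerBl invr_ge0 ler0n andbT subr_ge0 invf_le1 ?ltr0n//.
  by rewrite ler1n.
pose a k := fine (law nu k x).
have a0 k : (0 <= a k)%R by rewrite fine_ge0.
have aE k : (a k)%:E = law nu k x by rewrite fineK// law_fin.
have greenE z : (0 <= z <= 1)%R ->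
    \esum_(k in [set: nat]) (z ^+ k * a k)%:E = (green_real z x)%:E.
  by move=> z1; rewrite green_realK//; apply: eq_esum => k _; rewrite EFinM aE.
have h01 : (0 <= (1 : R) <= 1)%R by rewrite ler01 lexx.
suff : (fun n => \esum_(k in [set: nat]) ((1 - n.+2%:R^-1) ^+ k * a k)%:E) @ \oo -->
    \esum_(k in [set: nat]) (1 ^+ k * a k)%:E.
  by rewrite greenE// (funext (fun n => greenE _ (z01 n))) => /fine_cvgP[].
apply: (esum_dominated (g := a)).
- move=> n k; have /andP[z0 z1] := z01 n.
  by rewrite mulr_ge0 ?exprn_ge0//= ler_piMl// exprn_ile1.
- move=> k; apply: cvgM; last exact: cvg_cst.
  have -> : (1 ^+ k = (1 - 0) ^+ k :> R)%R by rewrite subr0.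
  have : (1 - n.+2%:R^-1 : R)%R @[n --> \oo] --> (1 - 0 : R)%R.
    apply: cvgB; first exact: cvg_cst.
    rewrite (cvg_shiftS (fun n => n.+1%:R^-1 : R)%R); exact: cvg_harmonic.
  move=> z_cvg; apply: (continuous_cvg _ (h := fun z : R => (z ^+ k)%R) _ z_cvg).
  exact: exprn_continuous.
- have := greenE _ h01; under eq_esum do rewrite expr1n mul1r.
  by move=> ->; rewrite ltry.
Qed.

(** * Increments of the Green distance *)

Definition green_dist (z : R) (x : Gamma) : R :=
  (ln (green_real z 1%g) - ln (green_real z x))%R.

Definition mean_green_dist (z : R) (n : nat) : \bar R :=
  \esum_(x in [set: Gamma]) (law nu n x * (green_dist z x)%:E).

Definition step_cost (z : R) i (g : Gam i) : R := (- ln (z * (alpha i * mu i g)))%R.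

(* By how much the increment [green_dist z (g x) - green_dist z x], which only
   depends on the head [h] of [x] in the factor of [g], falls short of the
   a priori bound [step_cost z g]. *)
Definition slack (z : R) i (g h : Gam i) : R :=
  (step_cost z g + ln (green_real z (fp_inj (g * h)%g)) - ln (green_real z (fp_inj h)))%R.

Definition slack_term (z : R) i (q : Gam i -> R) (p : Gam i * Gam i) : R :=
  (alpha i * mu i p.1 * q p.2 * slack z p.1 p.2)%R.

Definition mean_slack (z : R) i (q : Gam i -> R) : \bar R :=
  \esum_(p in [set: (Gam i * Gam i)%type]) (slack_term z q p)%:E.

(** At [z = 1] this is the Shannon entropy of the step law on the free product. *)
Definition mean_cost (z : R) : \bar R :=
  \sum_(i < r) \esum_(g in [set: Gam i]) (alpha i * mu i g * step_cost z g)%:E.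

Let amu_ge0 i (g : Gam i) : (0 <= alpha i * mu i g)%R.
Proof. by rewrite mulr_ge0// ltW. Qed.

Let amu_le1 i (g : Gam i) : (alpha i * mu i g <= 1)%R.
Proof.
rewrite -fp_measure_inj// -lee_fin; have [_ <-] := nu_prob.
exact: (@le_esum_term _ _ _ (fun x => (nu x)%:E)).
Qed.

Lemma green_dist_ge0 z x : (0 < z <= 1)%R -> (0 <= green_dist z x)%R.
Proof.
move=> z01; have z01' : (0 <= z <= 1)%R by case/andP: z01 => /ltW -> ->.
by rewrite subr_ge0 ler_ln ?posrE ?green_real_gt0// green_real_le.
Qed.

Lemma step_cost_ge0 z i (g : Gam i) : (0 <= z <= 1)%R -> (0 <= step_cost z g)%R.
Proof.
move=> /andP[z0 z1]; rewrite oppr_ge0 ln_le0//.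
by rewrite (le_trans (ler_pM _ _ z1 (amu_le1 g)))// mulr1.
Qed.

(** This is [green_real_step_ge] in logarithms. For [mu i g = 0] the convention [ln 0 = 0] would
    spoil it, so later sums always carry the factor [mu i g]. *)
Lemma slack_ge0 z i (g h : Gam i) : (0 < z <= 1)%R -> (0 < mu i g)%R ->
  (0 <= slack z g h)%R.
Proof.
move=> z01 g0; have z01' : (0 <= z <= 1)%R by case/andP: z01 => /ltW -> ->.
have z0 : (0 < z)%R by case/andP: z01.
have zg0 : (0 < z * (alpha i * mu i g))%R by rewrite !mulr_gt0.
have := green_real_step_ge g (fp_inj h) z01'; rewrite -fp_injM.
rewrite -ler_ln ?posrE ?mulr_gt0 ?green_real_gt0// lnM ?posrE ?green_real_gt0//.
by rewrite /slack /step_cost; lra.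
Qed.

Lemma slack_term_ge0 z i (q : Gam i -> R) p : (0 < z <= 1)%R ->
  (forall g, 0 <= q g)%R -> (0 <= slack_term z q p)%R.
Proof.
move=> z01 q0; rewrite /slack_term.
have [->|g0] := eqVneq (mu i p.1) 0%R; first by rewrite mulr0 !mul0r.
by rewrite !mulr_ge0// ?slack_ge0// ?ltW// lt_neqAle eq_sym g0 mu0.
Qed.

Lemma green_dist_increment z i (g : Gam i) x : (0 < z <= 1)%R ->
  (green_dist z (fp_inj g * x)%g + slack z g (fp_head i x) =
   green_dist z x + step_cost z g)%R.
Proof.
move=> z01; have := congr1 (@ln R) (green_real_ratio g x z01).
rewrite !lnM ?posrE ?green_real_gt0// /green_dist /slack; lra.
Qed.

Lemma mean_green_dist0 z : mean_green_dist z 0 = 0.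
Proof.
apply: esum1 => x _; rewrite /law /= /dirac_mass; case: eqVneq => [->|_].
  by rewrite /green_dist subrr mule0.
by rewrite mul0e.
Qed.

Lemma mean_green_dist_ge0 z n : (0 < z <= 1)%R -> 0 <= mean_green_dist z n.
Proof.
by move=> z01; apply: esum_ge0 => x _; rewrite mule_ge0// lee_fin green_dist_ge0.
Qed.

Lemma mean_slackE z i n : (0 < z <= 1)%R ->
  mean_slack z (head_real (i := i) n) = \esum_(g in [set: Gam i]) \esum_(x in [set: Gamma])
    (law nu n x * (alpha i * mu i g * slack z g (fp_head i x))%:E).
Proof.
move=> z01; rewrite /mean_slack.
rewrite -(esum_pairE (a := fun g h => (slack_term z (head_real n) (g, h))%:E)); last first.
  by move=> g h; rewrite lee_fin slack_term_ge0// => k; exact: head_real_ge0.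
apply: eq_esum => g _.
rewrite -(esum_head_law n (F := fun h => (alpha i * mu i g * slack z g h)%:E)); last first.
  move=> h; rewrite lee_fin; have [->|g0] := eqVneq (mu i g) 0%R.
    by rewrite mulr0 mul0r.
  by rewrite mulr_ge0// slack_ge0// lt_neqAle eq_sym g0 mu0.
by apply: eq_esum => h _; rewrite -head_realK -EFinM /slack_term /=; congr (_%:E); ring.
Qed.

(** Averages [green_dist_increment] over an independent first step [g] and over [X_n]. Slack and
    cost sit on opposite sides so that all terms are nonnegative and no integrability is
    required. *)
Lemma mean_green_dist_rec z n : (0 < z <= 1)%R ->
  mean_green_dist z n.+1 + \sum_(i < r) mean_slack z (head_real (i := i) n) =
  mean_green_dist z n + mean_cost z.
Proof.
move=> z01; have z01' : (0 <= z <= 1)%R by case/andP: z01 => /ltW -> ->.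
have d0 x : 0 <= (green_dist z x)%:E by rewrite lee_fin green_dist_ge0.
have stepE : mean_green_dist z n.+1 = \sum_(i < r) \esum_(g in [set: Gam i])
    \esum_(x in [set: Gamma]) (law nu n x *
      (alpha i * mu i g * green_dist z (fp_inj g * x)%g)%:E).
  rewrite /mean_green_dist.
  transitivity (\esum_(y in [set: Gamma]) \esum_(s in [set: Gamma])
      ((nu s)%:E * (law nu n (s^-1 * y)%g * (green_dist z y)%:E))).
    apply: eq_esum => y _; rewrite lawSl// -esumZr//; last by move=> s _; rewrite mule_ge0.
    by apply: eq_esum => s _; rewrite muleA.
  rewrite exchange_esum; last by move=> *; rewrite !mule_ge0.
  transitivity (\esum_(s in [set: Gamma]) ((nu s)%:E *
      \esum_(x in [set: Gamma]) (law nu n x * (green_dist z (s * x)%g)%:E))).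
    apply: eq_esum => s _; rewrite esumZl//; last by move=> *; rewrite mule_ge0.
    congr (_ * _); rewrite (@reindexT_esum _ _ _ (fun x => s * x)%g); last first.
      by exists (fun x => s^-1 * x)%g => x; rewrite (mulKg, mulVKg).
    by apply: eq_esum => x _; rewrite mulKg.
  rewrite esum_fp_measure//; last by move=> s; apply: esum_ge0 => x _; rewrite mule_ge0.
  apply: eq_bigr => i _; apply: eq_esum => g _; rewrite -esumZl ?lee_fin//; last first.
    by move=> x _; rewrite mule_ge0.
  by apply: eq_esum => x _; rewrite [in RHS]EFinM muleCA.
have costE : mean_green_dist z n + mean_cost z = \sum_(i < r) \esum_(g in [set: Gam i])
    \esum_(x in [set: Gamma]) (law nu n x *
      (alpha i * mu i g * (green_dist z x + step_cost z g))%:E).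
  transitivity (\sum_(i < r) \esum_(g in [set: Gam i])
    ((alpha i * mu i g)%:E * mean_green_dist z n + (alpha i * mu i g * step_cost z g)%:E)).
    rewrite /mean_cost; under [RHS]eq_bigr => i _.
      rewrite esumD; last 2 first.
      - by move=> g _; rewrite mule_ge0 ?lee_fin ?mean_green_dist_ge0.
      - by move=> g _; rewrite lee_fin mulr_ge0// step_cost_ge0.
      over.
    rewrite big_split /=; congr (_ + _).
    rewrite -(esum_fp_measure mu_prob mu1 alpha_gt0 (f := fun=> mean_green_dist z n)); last first.
      by move=> x; exact: mean_green_dist_ge0.
    rewrite esumZr ?mean_green_dist_ge0//.
    by have [_ ->] := nu_prob; rewrite mul1e.
  apply: eq_bigr => i _; apply: eq_esum => g _.
  transitivity (\esum_(x in [set: Gamma])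
     ((alpha i * mu i g)%:E * (law nu n x * (green_dist z x)%:E)
     + law nu n x * (alpha i * mu i g * step_cost z g)%:E)).
    have c0 : 0 <= (alpha i * mu i g * step_cost z g)%:E.
      by rewrite lee_fin mulr_ge0// step_cost_ge0.
    rewrite esumD; last 2 first.
    - by move=> x _; rewrite !mule_ge0 ?lee_fin// green_dist_ge0.
    - by move=> x _; rewrite mule_ge0.
    rewrite esumZl ?lee_fin//; last by move=> x _; rewrite mule_ge0.
    by rewrite esumZr// esum_law// mul1e.
  apply: eq_esum => x _; rewrite [in RHS]mulrDr [in RHS]EFinD [in RHS]ge0_muleDr.
  - by rewrite muleCA -EFinM.
  - by rewrite lee_fin mulr_ge0// green_dist_ge0.
  - by rewrite lee_fin mulr_ge0// step_cost_ge0.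
rewrite stepE costE -big_split /=; apply: eq_bigr => i _.
have s0 g x : 0 <= law nu n x * (alpha i * mu i g * slack z g (fp_head i x))%:E.
  rewrite mule_ge0// lee_fin; have [->|g0] := eqVneq (mu i g) 0%R.
    by rewrite mulr0 mul0r.
  by rewrite mulr_ge0// slack_ge0// lt_neqAle eq_sym g0 mu0.
have t0 g x : 0 <= law nu n x * (alpha i * mu i g * green_dist z (fp_inj g * x)%g)%:E.
  by rewrite mule_ge0// lee_fin mulr_ge0// green_dist_ge0.
rewrite mean_slackE// -esumD; last 2 first.
- by move=> g _; apply: esum_ge0.
- by move=> g _; apply: esum_ge0.
apply: eq_esum => g _; rewrite -esumD//; apply: eq_esum => x _.
rewrite -green_dist_increment// [in RHS]mulrDr [in RHS]EFinD [in RHS]ge0_muleDr//.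
- by rewrite lee_fin mulr_ge0// green_dist_ge0.
- rewrite lee_fin; have [->|g0] := eqVneq (mu i g) 0%R; first by rewrite mulr0 mul0r.
  by rewrite mulr_ge0// slack_ge0// lt_neqAle eq_sym g0 mu0.
Qed.

(** * Entropy compared with the Green distance *)

Definition entropy n : \bar R :=
  \esum_(x in [set: Gamma]) (- (fine (law nu n x) * ln (fine (law nu n x))))%:E.

Let lawK n x : (fine (law nu n x))%:E = law nu n x.
Proof. by rewrite fineK// law_fin. Qed.

Let fine_law_ge0 n x : (0 <= fine (law nu n x))%R. Proof. by rewrite fine_ge0. Qed.

Let fine_law_le1 n x : (fine (law nu n x) <= 1)%R.
Proof. by rewrite -lee_fin lawK law_le1. Qed.

Let entropy_term_ge0 n x : (0 <= - (fine (law nu n x) * ln (fine (law nu n x))))%R.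
Proof. by rewrite -mulrN mulr_ge0// oppr_ge0 ln_le0. Qed.

Lemma entropy_ge0 n : 0 <= entropy n.
Proof. by apply: esum_ge0 => x _; rewrite lee_fin. Qed.

(* Gibbs' inequality against the probability [(1 - z) green_real z]. *)
Lemma entropy_le z n : (0 < z < 1)%R ->
  entropy n <= mean_green_dist z n + (- ln ((1 - z) * green_real z 1%g))%:E.
Proof.
move=> /andP[z0 z1]; have z01 : (0 < z <= 1)%R by rewrite z0 ltW.
have z01' : (0 <= z <= 1)%R by rewrite !ltW.
have z1' : (0 < 1 - z)%R by rewrite subr_gt0.
pose Q x := ((1 - z) * green_real z x)%R.
have Q0 x : (0 < Q x)%R by rewrite mulr_gt0// green_real_gt0.
have sumQ : \esum_(x in [set: Gamma]) (Q x)%:E = 1.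
  under eq_esum do rewrite EFinM green_realK//.
  rewrite esumZl ?lee_fin ?ltW//; last first.
    by move=> x _; apply: green_fun_ge0 => //; exact: ltW.
  by rewrite esum_green_fun ?ltW// -EFinM mulfV// gt_eqF.
have Q1 : (Q 1%g <= 1)%R.
  rewrite -lee_fin -sumQ; apply: (@le_esum_term _ _ _ (fun x => (Q x)%:E)) => // x _.
  by rewrite lee_fin ltW.
have c0 : (0 <= - ln (Q 1%g))%R by rewrite oppr_ge0 ln_le0.
(* Both total masses [1] are added so that the inequality [p - p ln p <= Q - p ln Q], a form of
   [ln u <= u - 1], can be summed term by term. *)
suff : entropy n + \esum_(x in [set: Gamma]) law nu n x <= mean_green_dist z n +
    (- ln (Q 1%g))%:E * (\esum_(x in [set: Gamma]) law nu n x) +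
    \esum_(x in [set: Gamma]) (Q x)%:E.
  by rewrite esum_law// sumQ mule1 leeD2rE.
have d_ge0 x : 0 <= law nu n x * (green_dist z x)%:E.
  by rewrite mule_ge0// lee_fin green_dist_ge0.
have c_ge0 x : 0 <= (- ln (Q 1%g))%:E * law nu n x by rewrite mule_ge0// lee_fin.
rewrite -esumZl ?lee_fin// /entropy -esumD//; last by move=> x _; rewrite lee_fin.
rewrite -esumD// -esumD//; last 2 first.
- by move=> x _; rewrite adde_ge0.
- by move=> x _; rewrite lee_fin ltW.
apply: le_esum => x _.
move: (law_fin nu_prob n x) (fine_law_ge0 n x); case: (law nu n x) => [p||]//= _ p0.
rewrite -!EFinM -!EFinD lee_fin.
have -> : (p * green_dist z x + - ln (Q 1%g) * p = - (p * ln (Q x)))%R.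
  rewrite /green_dist /Q !lnM ?posrE ?green_real_gt0//; ring.
have [->|pN0] := eqVneq p 0%R; first by rewrite !mul0r oppr0 !add0r ltW.
have p_gt0 : (0 < p)%R by rewrite lt_neqAle eq_sym pN0.
have : (ln (Q x / p) <= Q x / p - 1)%R.
  have := @le_ln1Dx R (Q x / p - 1); rewrite addrCA subrr addr0; apply.
  by rewrite ltrBrDl subrr divr_gt0.
move=> /(ler_wpM2l p0); rewrite ln_div ?posrE// 2!mulrBr mulr1 (mulrCA p) divff// mulr1.
lra.
Qed.

Lemma entropy_ge n : mean_green_dist 1 n <= entropy n + (ln (green_real 1 1%g))%:E.
Proof.
have h01 : (0 < (1 : R) <= 1)%R by rewrite ltr01 lexx.
have G1 : (1 <= green_real 1 1%g)%R.
  by rewrite -lee_fin (le_trans _ (law_le_green 0 1%g)).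
rewrite -[X in _ <= _ + X]mule1 -(esum_law nu_prob n) -esumZl ?lee_fin ?ln_ge0//.
rewrite -esumD; last 2 first.
- by move=> x _; rewrite lee_fin.
- by move=> x _; rewrite mule_ge0// lee_fin ln_ge0.
apply: le_esum => x _.
move: (law_fin nu_prob n x) (fine_law_ge0 n x) (law_le_green n x).
case: (law nu n x) => [p||]//= _ p0; rewrite -!EFinM -!EFinD !lee_fin => pG.
have [->|pN0] := eqVneq p 0%R; first by rewrite !mul0r mulr0 oppr0 addr0.
have p_gt0 : (0 < p)%R by rewrite lt_neqAle eq_sym pN0.
have : (p * ln p <= p * ln (green_real 1 x))%R.
  by rewrite ler_wpM2l// ler_ln ?posrE ?green_real_gt0.
by rewrite /green_dist; lra.
Qed.

(** * Convergence of the mean slack *)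

Hypothesis mu_entropy : forall i, shannon (mu i) < +oo.

Let h01 : (0 < (1 : R) <= 1)%R. Proof. by rewrite ltr01 lexx. Qed.
Let h01' : (0 <= (1 : R) <= 1)%R. Proof. by rewrite ler01 lexx. Qed.

Let alpha_le1 i : (alpha i <= 1)%R.
Proof. by rewrite -alpha_sum (bigD1 i)//= lerDl sumr_ge0// => j _; exact: ltW. Qed.

Definition factor_cost i : \bar R :=
  \esum_(g in [set: Gam i]) (alpha i * mu i g * step_cost 1 g)%:E.

Let cost_term_ge0 z i (g : Gam i) : (0 <= z <= 1)%R ->
  (0 <= alpha i * mu i g * step_cost z g)%R.
Proof. by move=> z01; rewrite mulr_ge0// step_cost_ge0. Qed.

(** The logarithm of [alpha i * mu i g] splits: the sum is [alpha i] times the entropy of [mu i],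
    plus [- alpha i * ln (alpha i)]. *)
Lemma factor_cost_fin i : factor_cost i < +oo.
Proof.
have mln0 g : (0 <= - (mu i g * ln (mu i g)))%R.
  rewrite -mulrN mulr_ge0// oppr_ge0 ln_le0// -lee_fin; have [_ <-] := mu_prob i.
  by apply: (@le_esum_term _ _ _ (fun g => (mu i g)%:E)) => // h _; rewrite lee_fin.
have aln0 : (0 <= - ln (alpha i))%R by rewrite oppr_ge0 ln_le0.
rewrite /factor_cost (eq_esum (b := fun g =>
    (alpha i)%:E * (- (mu i g * ln (mu i g)))%:E +
    (alpha i * - ln (alpha i))%:E * (mu i g)%:E)); last first.
  move=> g _; rewrite -!EFinM -EFinD; congr (_%:E); rewrite /step_cost mul1r.
  have [->|g0] := eqVneq (mu i g) 0%R; first by rewrite !(mulr0, mul0r, oppr0, addr0).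
  rewrite lnM ?posrE//; first by ring.
  by rewrite lt_neqAle eq_sym g0 mu0.
rewrite esumD; last 2 first.
- by move=> g _; rewrite mule_ge0 ?lee_fin// ltW.
- by move=> g _; rewrite mule_ge0 ?lee_fin// mulr_ge0// ltW.
have [_ mui] := mu_prob i.
have a0 := ltW (alpha_gt0 i); have aln := mulr_ge0 a0 aln0.
have mu_ge0 g : [set: Gam i] g -> 0 <= (mu i g)%:E by rewrite lee_fin.
have mln_ge0 g : [set: Gam i] g -> 0 <= (- (mu i g * ln (mu i g)))%:E by rewrite lee_fin.
rewrite !esumZl ?lee_fin//.
rewrite mui mule1; apply: lte_add_pinfty; last exact: ltry.
by apply: lte_mul_pinfty => //; rewrite ?lee_fin ?ltW//; exact: mu_entropy.
Qed.

Lemma mean_cost_fin : mean_cost 1 < +oo.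
Proof. by apply: lte_sum_pinfty => i _; exact: factor_cost_fin. Qed.

Lemma mean_costE z : (0 < z <= 1)%R -> mean_cost z = mean_cost 1 + (- ln z)%:E.
Proof.
move=> /andP[z0 z1]; have z01' : (0 <= z <= 1)%R by rewrite ltW.
have lz : 0 <= (- ln z)%:E by rewrite lee_fin oppr_ge0 ln_le0.
transitivity (\sum_(i < r) \esum_(g in [set: Gam i])
    ((alpha i * mu i g * step_cost 1 g)%:E + (alpha i * mu i g)%:E * (- ln z)%:E)).
  apply: eq_bigr => i _; apply: eq_esum => g _; rewrite -EFinM -EFinD; congr (_%:E).
  have [->|g0] := eqVneq (mu i g) 0%R; first by rewrite !(mulr0, mul0r, addr0).
  have am : (0 < alpha i * mu i g)%R by rewrite mulr_gt0// lt_neqAle eq_sym g0 mu0.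
  by rewrite /step_cost mul1r lnM ?posrE//; ring.
under eq_bigr => i _.
  rewrite esumD; last 2 first.
  - by move=> g _; rewrite lee_fin cost_term_ge0.
  - by move=> g _; rewrite mule_ge0 ?lee_fin.
  over.
rewrite big_split /=; congr (_ + _).
rewrite -(esum_fp_measure mu_prob mu1 alpha_gt0 (f := fun=> (- ln z)%:E))//.
by rewrite esumZr//; have [_ ->] := nu_prob; rewrite mul1e.
Qed.

(** With [a] and [b] the Green functions at [g h] and [h], and [q h <= b]: [ln u <= u] gives
    [q h * (ln a - ln b) <= b * (a / b) = a], and the cost is simply multiplied by [b]. *)
Let slack_bound i (p : Gam i * Gam i) : R :=
  (alpha i * mu i p.1 * green_real 1 (fp_inj (p.1 * p.2)%g) +
   alpha i * mu i p.1 * step_cost 1 p.1 * green_real 1 (fp_inj p.2))%R.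

Let slack_term_le i (q : Gam i -> R) p :
  (forall g, 0 <= q g <= green_real 1 (fp_inj g))%R ->
  (slack_term 1 q p <= slack_bound p)%R.
Proof.
move=> qG; have /andP[q0 qle] := qG p.2.
set a := green_real 1 (fp_inj (p.1 * p.2)%g); set b := green_real 1 (fp_inj p.2).
have a0 : (0 < a)%R by exact: green_real_gt0.
have b0 : (0 < b)%R by exact: green_real_gt0.
have am := amu_ge0 p.1; have c0 := step_cost_ge0 p.1 h01'.
have lnab : (q p.2 * (ln a - ln b) <= a)%R.
  rewrite -ln_div ?posrE//; apply: (@le_trans _ _ (b * (a / b))%R); last first.
    by rewrite mulrCA divff ?mulr1// gt_eqF.
  apply: (@le_trans _ _ (q p.2 * (a / b))%R).
    by rewrite ler_wpM2l// ltW// ln_sublinear// divr_gt0.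
  by rewrite ler_wpM2r// divr_ge0// ltW.
have qc : (q p.2 * step_cost 1 p.1 <= b * step_cost 1 p.1)%R by rewrite ler_wpM2r.
have -> : slack_bound p = (alpha i * mu i p.1 * (a + step_cost 1 p.1 * b))%R.
  by rewrite /slack_bound mulrDr mulrA.
rewrite /slack_term -(mulrA (alpha i * mu i p.1)%R) ler_wpM2l//.
by rewrite /slack -/a -/b; lra.
Qed.

(** For fixed [g], both sums over [h] are sums of the Green function over the factor, finite since
    [xi_i < 1], one of them after a translation; the sum over [g] is then finite by
    [factor_cost_fin]. *)
Let esum_slack_bound i :
  \esum_(p in [set: (Gam i * Gam i)%type]) (slack_bound p)%:E < +oo.
Proof.
have G0 x : (0 <= green_real 1 x)%R by rewrite ltW// green_real_gt0.
rewrite -(esum_pairE (a := fun g h => (slack_bound (g, h))%:E)); last first.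
  move=> g h; rewrite lee_fin; apply: addr_ge0; apply: mulr_ge0 => //=.
  exact: cost_term_ge0.
set S := ((1 - xi_real i) * (1 - return_real i))^-1%:E.
have SE : \esum_(h in [set: Gam i]) (green_real 1 (fp_inj h))%:E = S.
  exact: esum_green_factor.
have S0 : 0 <= S by rewrite -SE; apply: esum_ge0 => h _; rewrite lee_fin.
rewrite (eq_esum (b := fun g => (alpha i * mu i g)%:E * S +
    (alpha i * mu i g * step_cost 1 g)%:E * S)); last first.
  move=> g _; under eq_esum do rewrite /slack_bound /= EFinD EFinM [X in _ + X]EFinM.
  rewrite esumD; last 2 first.
  - by move=> h _; rewrite mule_ge0 ?lee_fin.
  - by move=> h _; rewrite mule_ge0 ?lee_fin ?cost_term_ge0.
  rewrite !esumZl ?lee_fin ?cost_term_ge0// ?SE; last 2 first.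
  - by move=> h _; rewrite lee_fin.
  - by move=> h _; rewrite lee_fin.
  congr (_ * _ + _); rewrite -SE [RHS](@reindexT_esum _ _ _ (fun h => g * h)%g)//.
  by exists (fun x => g^-1 * x)%g => x; rewrite (mulKg, mulVKg).
rewrite esumD; last 2 first.
- by move=> g _; rewrite mule_ge0 ?lee_fin.
- by move=> g _; rewrite mule_ge0 ?lee_fin ?cost_term_ge0.
rewrite !esumZr//; last 2 first.
- by move=> g _; rewrite lee_fin cost_term_ge0.
- by move=> g _; rewrite lee_fin.
have -> : \esum_(g in [set: Gam i]) (alpha i * mu i g)%:E = (alpha i)%:E.
  have [_ mui] := mu_prob i; under eq_esum do rewrite EFinM.
  by rewrite esumZl ?lee_fin ?ltW// ?mui ?mule1// => g _; rewrite lee_fin.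
have cf : factor_cost i \is a fin_num.
  rewrite ge0_fin_numE ?factor_cost_fin//.
  by apply: esum_ge0 => g _; rewrite lee_fin cost_term_ge0.
by rewrite -/(factor_cost i) -(fineK cf) /S -!EFinM -EFinD ltry.
Qed.

Lemma head_limit_le i (g : Gam i) : (head_limit g <= green_real 1 (fp_inj g))%R.
Proof.
rewrite /head_limit ler_piMl//; first by rewrite ltW// green_real_gt0.
have : (0 <= return_real i)%R.
  by rewrite -lee_fin return_realK; apply: esum_ge0 => n _; exact: excursion_return_ge0.
by have := alpha_gt0 i; lra.
Qed.

Lemma mean_slack_limit_fin i : mean_slack 1 (head_limit (i := i)) \is a fin_num.
Proof.
rewrite ge0_fin_numE; last first.
  by apply: esum_ge0 => p _; rewrite lee_fin slack_term_ge0// => g; exact: head_limit_ge0.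
apply: le_lt_trans (esum_slack_bound i); apply: le_esum => p _; rewrite lee_fin.
by apply: slack_term_le => g; rewrite head_limit_ge0 head_limit_le.
Qed.

Lemma mean_slack_cvg i :
  mean_slack 1 (head_real (i := i) n) @[n --> \oo] --> mean_slack 1 (head_limit (i := i)).
Proof.
apply: (esum_dominated (g := @slack_bound i)).
- move=> n p; rewrite slack_term_ge0//=; last by move=> g; exact: head_real_ge0.
  by apply: slack_term_le => g; rewrite head_real_ge0 head_real_le.
- move=> p; apply: cvgM; last exact: cvg_cst.
  by apply: cvgM; [exact: cvg_cst|exact: head_real_cvg].
- exact: esum_slack_bound.
Qed.

Let zm (k : nat) : R := (1 - k.+2%:R^-1)%R.

Let zm01 k : (0 < zm k < 1)%R.
Proof.
rewrite /zm gtrBl invr_gt0 ltr0n andbT subr_gt0 invf_lt1 ?ltr0n//.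
by rewrite ltr1n.
Qed.

Let zm01' k : (0 < zm k <= 1)%R.
Proof. by have /andP[-> /ltW ->] := zm01 k. Qed.

Let zm_cvg : zm k @[k --> \oo] --> (1 : R)%R.
Proof.
rewrite -[X in _ --> X](subr0 (1 : R)%R); apply: cvgB; first exact: cvg_cst.
rewrite (cvg_shiftS (fun n => n.+1%:R^-1 : R)%R); exact: cvg_harmonic.
Qed.

Let slack_term_cvg i (q : Gam i -> R) p :
  slack_term (zm k) q p @[k --> \oo] --> slack_term 1 q p.
Proof.
rewrite /slack_term; have [->|g0] := eqVneq (mu i p.1) 0%R.
  by under eq_fun do rewrite mulr0 !mul0r; rewrite mulr0 !mul0r; exact: cvg_cst.
have am : (0 < alpha i * mu i p.1)%R by rewrite mulr_gt0// lt_neqAle eq_sym g0 mu0.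
have ln_cvg x : ln (green_real (zm k) x) @[k --> \oo] --> ln (green_real 1 x).
  apply: (continuous_cvg _ (h := @ln R)); last exact: green_real_cvg.
  by apply: continuous_ln; exact: green_real_gt0.
apply: cvgM; first exact: cvg_cst.
apply: cvgB; last exact: ln_cvg.
apply: cvgD; last exact: ln_cvg.
apply: cvgN; apply: (continuous_cvg _ (h := @ln R)).
  by apply: continuous_ln; rewrite mul1r.
by apply: cvgM; [exact: zm_cvg|exact: cvg_cst].
Qed.

Let slack_near i (c : R) : (c%:E < mean_slack 1 (head_limit (i := i))) ->
  \forall k \near \oo, c%:E < mean_slack (zm k) (head_limit (i := i)).
Proof.
move=> cs; apply: (esum_fatou (l := fun p => (slack_term 1 (head_limit (i := i)) p)%:E)) => //.
  by move=> k p; rewrite lee_fin slack_term_ge0// => g; exact: head_limit_ge0.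
by move=> p; apply: cvg_EFin; [exact: nearW|exact: slack_term_cvg].
Qed.

(** Fatou's lemma gives only a lower bound; it suffices because the slack is subtracted in the upper
    estimate of the entropy. *)
Let slack_near_n z i (c : R) : (0 < z <= 1)%R ->
  (c%:E < mean_slack z (head_limit (i := i))) ->
  \forall n \near \oo, c%:E < mean_slack z (head_real (i := i) n).
Proof.
move=> z01 cs; apply: (esum_fatou (l := fun p => (slack_term z (head_limit (i := i)) p)%:E)) => //.
  by move=> k p; rewrite lee_fin slack_term_ge0// => g; exact: head_real_ge0.
move=> p; apply: cvg_EFin; first exact: nearW.
apply: cvgM; last exact: cvg_cst.
by apply: cvgM; [exact: cvg_cst|exact: head_real_cvg].
Qed.

(** * The entropy rate by squeezing *)

Definition total_slack z n : \bar R :=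
  \sum_(i < r) mean_slack z (head_real (i := i) n).

Let total_slack_ge0 z n : (0 < z <= 1)%R -> 0 <= total_slack z n.
Proof.
move=> z01; apply: sume_ge0 => i _; apply: esum_ge0 => p _.
by rewrite lee_fin slack_term_ge0// => g; exact: head_real_ge0.
Qed.

Let mean_cost_fin_num z : (0 < z <= 1)%R -> mean_cost z \is a fin_num.
Proof.
move=> z01; rewrite mean_costE// fin_numD andbT ge0_fin_numE ?mean_cost_fin//.
apply: sume_ge0 => i _; apply: esum_ge0 => g _; rewrite lee_fin; exact: cost_term_ge0.
Qed.

Lemma mean_green_dist_sum z n : (0 < z <= 1)%R ->
  mean_green_dist z n + \sum_(k < n) total_slack z k = n%:R%:E * mean_cost z.
Proof.
move=> z01; elim: n => [|n IH].
  by rewrite mean_green_dist0 big_ord0 adde0 mul0e.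
rewrite big_ord_recr /= addeCA addeC mean_green_dist_rec// -addeA addeCA.
by rewrite IH addeC -natr1 EFinD ge0_muleDl ?mul1e.
Qed.

(** Finiteness is read off the telescoped identity, whose right side is a finite multiple of the
    mean cost; no majorant at this [z] is required. *)
Let total_slack_fin z n : (0 < z <= 1)%R -> total_slack z n \is a fin_num.
Proof.
move=> z01; rewrite ge0_fin_numE ?total_slack_ge0//.
have kf : n.+1%:R%:E * mean_cost z < +oo.
  by rewrite -(fineK (mean_cost_fin_num z01)) -EFinM ltry.
apply: le_lt_trans kf; rewrite -mean_green_dist_sum// big_ord_recr /= addeA leeDr//.
rewrite adde_ge0 ?mean_green_dist_ge0// sume_ge0// => k _.
exact: total_slack_ge0.
Qed.

Let mean_green_dist_fin z n : (0 < z <= 1)%R -> mean_green_dist z n \is a fin_num.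
Proof.
move=> z01; rewrite ge0_fin_numE ?mean_green_dist_ge0//.
have kf : n%:R%:E * mean_cost z < +oo.
  by rewrite -(fineK (mean_cost_fin_num z01)) -EFinM ltry.
apply: le_lt_trans kf; rewrite -mean_green_dist_sum// leeDl//.
by apply: sume_ge0 => k _; exact: total_slack_ge0.
Qed.

Let green_dist_real z n : (0 < z <= 1)%R ->
  (fine (mean_green_dist z n) =
   n%:R * fine (mean_cost z) - \sum_(k < n) fine (total_slack z k))%R.
Proof.
move=> z01; have := mean_green_dist_sum n z01.
rewrite -(fineK (mean_green_dist_fin n z01)) -(fineK (mean_cost_fin_num z01)).
under eq_bigr do rewrite -(fineK (total_slack_fin _ z01)).
by rewrite sumEFin -EFinM -EFinD => -[<-]; rewrite addrK.
Qed.

Definition drift_limit : R :=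
  (fine (mean_cost 1) - \sum_(i < r) fine (mean_slack 1 (head_limit (i := i))))%R.

Let entropy_fin n : entropy n \is a fin_num.
Proof.
rewrite ge0_fin_numE ?entropy_ge0//; apply: le_lt_trans (entropy_le n (zm01 0)) _.
by rewrite -(fineK (mean_green_dist_fin n (zm01' 0))) -EFinD ltry.
Qed.

(** The parameter [z < 1] is fixed before [n]: the constant of [entropy_le] depends on [z] and blows
    up as [z] tends to [1], but it disappears after division by [n]. *)
Let entropy_upper (e : R) : (0 < e)%R ->
  (* [B] will absorb that constant and the first [N] steps, during which the slack has no useful
     lower bound. *)
  exists B : R, \forall n \near \oo,
    (fine (entropy n) <= n%:R * (drift_limit + e) + B)%R.
Proof.
move=> e0; pose d := (e / (r%:R + 1))%R.
have r1 : (0 < r%:R + 1 :> R)%R by rewrite ltr_wpDl.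
have d0 : (0 < d)%R by rewrite divr_gt0.
pose E i := fine (mean_slack 1 (head_limit (i := i))).
(* The error [e] is cut into [r + 1] shares [d]: one per factor for the slack, and one for
   [- ln z]. *)
have EE i : (E i - d)%:E < mean_slack 1 (head_limit (i := i)).
  rewrite -(fineK (mean_slack_limit_fin i)) lte_fin -/(E i); lra.
have [k [kE kl]] : exists k, (forall i, (E i - d)%:E < mean_slack (zm k) (head_limit (i := i)))
    /\ (- ln (zm k) < d)%R.
  have lnz : (- ln (zm k))%R @[k --> \oo] --> (- ln (1 : R))%R.
    apply: cvgN; apply: (continuous_cvg _ (h := @ln R) _ zm_cvg).
    exact: continuous_ln.
  have near1 : \forall k \near \oo, forall i,
      (E i - d)%:E < mean_slack (zm k) (head_limit (i := i)).
    by apply: filter_forall => i; exact: slack_near.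
  have near2 : \forall k \near \oo, (- ln (zm k) < d)%R.
    by apply: (cvgr_lt _ lnz); rewrite ln1 oppr0.
  have [k] := filter_ex (filterI near1 near2).
  by move=> [? ?]; exists k.
set z := zm k in kE kl; have z01 := zm01' k; rewrite -/z in z01.
have [N _ NE] : \forall n \near \oo, forall i, (E i - d)%:E < mean_slack z (head_real (i := i) n).
  by apply: filter_forall => i; exact: slack_near_n.
set S := (\sum_(i < r) (E i - d))%R.
have sS n : (N <= n)%N -> (S <= fine (total_slack z n))%R.
  move=> Nn; rewrite -lee_fin fineK ?total_slack_fin// -sumEFin.
  by apply: lee_sum => i _; rewrite ltW//; exact: NE.
pose c := (- ln ((1 - z) * green_real z 1%g))%R.
exists (N%:R * S + c)%R; exists N => // n /= Nn.
have /(_ n) := entropy_le _ (zm01 k); rewrite -/z -/c => Hn.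
apply: (@le_trans _ _ (fine (mean_green_dist z n) + c)%R).
  by rewrite -lee_fin EFinD !fineK ?entropy_fin ?mean_green_dist_fin.
rewrite green_dist_real//.
have sum_ge : ((n%:R - N%:R) * S <= \sum_(k < n) fine (total_slack z k))%R.
  rewrite -(big_mkord xpredT (fun k => fine (total_slack z k))).
  rewrite (big_cat_nat _ Nn)//=; apply: (@le_trans _ _ (\sum_(N <= k < n) S)%R); last first.
    rewrite (@le_trans _ _ (\sum_(N <= k < n) fine (total_slack z k))%R)//.
      rewrite big_nat_cond [leRHS]big_nat_cond.
      by apply: ler_sum => j /andP[/andP[? _] _]; exact: sS.
    by rewrite lerDr sumr_ge0// => j _; rewrite fine_ge0// total_slack_ge0.
  by rewrite big_const_nat iter_addr_0 -natrB// mulr_natl.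
have KE : (fine (mean_cost z) = fine (mean_cost 1) - ln z)%R.
  by rewrite mean_costE// fineD// mean_cost_fin_num.
have SE : (S = \sum_(i < r) E i - r%:R * d)%R.
  by rewrite /S sumrB sumr_const card_ord mulr_natl.
have dE : (r%:R * d + d = e)%R by rewrite /d; field; rewrite gt_eqF.
have n0 : (0 <= n%:R :> R)%R by [].
have DE : drift_limit = (fine (mean_cost 1) - \sum_(i < r) E i)%R by [].
have nS := congr1 (fun x => n%:R * x)%R SE; have ne := congr1 (fun x => n%:R * x)%R dE.
have := ler_wpM2l n0 (ltW kl); rewrite DE KE; lra.
Qed.

(** Here [z = 1], where [entropy_ge] is available; an upper bound on the slack is needed, hence the
    dominated convergence behind [mean_slack_cvg]. *)
Let entropy_lower (e : R) : (0 < e)%R ->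
  exists B : R, \forall n \near \oo,
    (n%:R * (drift_limit - e) - B <= fine (entropy n))%R.
Proof.
move=> e0; pose E := (\sum_(i < r) fine (mean_slack 1 (head_limit (i := i))))%R.
have EE : E%:E = \sum_(i < r) mean_slack 1 (head_limit (i := i)).
  by rewrite -sumEFin; apply: eq_bigr => i _; rewrite fineK ?mean_slack_limit_fin.
have s_cvg : total_slack 1 n @[n --> \oo] --> E%:E.
  rewrite EE; apply: (@cvg_nnesum _ _ _ _ _ _ (fun i n => mean_slack 1 (head_real (i := i) n))).
    move=> i _; apply: nearW => n; apply: esum_ge0 => p _.
    by rewrite lee_fin slack_term_ge0// => g; exact: head_real_ge0.
  by move=> i _; exact: mean_slack_cvg.
have [N _ NE] : \forall n \near \oo, (fine (total_slack 1 n) <= E + e)%R.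
  have /fine_cvgP[_ s_cvg'] := s_cvg.
  by apply: (cvgr_le _ s_cvg'); lra.
(* Nonnegativity allows [n - N] to be replaced by [n] in front of [E + e] below. *)
have E0 : (0 <= E)%R.
  rewrite -lee_fin EE; apply: sume_ge0 => i _; apply: esum_ge0 => p _.
  by rewrite lee_fin slack_term_ge0// => g; exact: head_limit_ge0.
pose B1 := (\sum_(0 <= k < N) fine (total_slack 1 k))%R.
exists (B1 + ln (green_real 1 1%g))%R; exists N => // n /= Nn.
have Hn := entropy_ge n.
suff : (n%:R * (drift_limit - e) - B1 <= fine (mean_green_dist 1 n))%R.
  move=> le_n; have : (fine (mean_green_dist 1 n) <= fine (entropy n) + ln (green_real 1 1%g))%R.
    by rewrite -lee_fin EFinD !fineK ?entropy_fin ?mean_green_dist_fin.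
  lra.
rewrite green_dist_real//.
have sum_le : (\sum_(k < n) fine (total_slack 1 k) <= B1 + n%:R * (E + e))%R.
  rewrite -(big_mkord xpredT (fun k => fine (total_slack 1 k))).
  rewrite (big_cat_nat _ Nn)//= lerD2l.
  apply: (@le_trans _ _ (\sum_(N <= k < n) (E + e))%R).
    rewrite big_nat_cond [leRHS]big_nat_cond; apply: ler_sum => j /andP[/andP[? _] _].
    exact: NE.
  rewrite big_const_nat iter_addr_0 -[(_ *+ _)%R]mulr_natl ler_wpM2r//; first by lra.
  by rewrite ler_nat leq_subr.
rewrite /drift_limit -/E; lra.
Qed.

Lemma entropy_rate : (n%:R^-1)%:E * entropy n @[n --> \oo] --> drift_limit%:E.
Proof.
have -> : (fun n => (n%:R^-1)%:E * entropy n) =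
    (fun n => (n%:R^-1 * fine (entropy n))%:E).
  by apply/funext => n; rewrite EFinM fineK ?entropy_fin.
apply: cvg_EFin; first exact: nearW.
apply/cvgrPdist_le => e e0; have e20 : (0 < e / 2)%R by rewrite divr_gt0.
have [B1 near1] := entropy_upper e20; have [B2 near2] := entropy_lower e20.
near=> n.
have n0 : (0 < n%:R :> R)%R by rewrite ltr0n; near: n; exact: nbhs_infty_gt.
have nB1 : (B1 <= n%:R * (e / 2))%R.
  rewrite -ler_pdivrMr//; near: n; exact: nbhs_infty_ger.
have nB2 : (B2 <= n%:R * (e / 2))%R.
  rewrite -ler_pdivrMr//; near: n; exact: nbhs_infty_ger.
have up : (fine (entropy n) <= n%:R * (drift_limit + e / 2) + B1)%R by near: n.
have lo : (n%:R * (drift_limit - e / 2) - B2 <= fine (entropy n))%R by near: n.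
rewrite /= distrC ler_distl mulrC ler_pdivlMr// ler_pdivrMr//; apply/andP; split; lra.
Unshelve. all: by end_near. Qed.

(** * The limit in terms of the generating functions of the factors *)

Section Formula.
Variables (F : forall i, Gam i -> R) (Goo : 'I_r -> R).
Arguments F : clear implicits.
Hypothesis FE : forall i g, (F i g)%:E = hitting_fun (mu i) (xi_real i) g.
Hypothesis GooE : forall i, (Goo i)%:E = green_fun (mu i) (xi_real i) 1%g.

Let one_return_gt0 i : (0 < 1 - return_real i)%R.
Proof. by have := return_real_lt i; have := alpha_gt0 i; lra. Qed.

Let F_green i g : (F i g * Goo i = (1 - return_real i) * green_real 1 (fp_inj g))%R.
Proof.
apply: EFin_inj; rewrite green_factor EFinM FE GooE -green_funE//.
exact: ltW (xi_real_gt0 i).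
Qed.

Let green_inj_gt0 i (g : Gam i) : (0 < (1 - return_real i) * green_real 1 (fp_inj g))%R.
Proof. by rewrite mulr_gt0// green_real_gt0. Qed.

Let Goo_gt0 i : (0 < Goo i)%R.
Proof. by rewrite -lte_fin GooE -green_factor lte_fin. Qed.

Let F_gt0 i g : (0 < F i g)%R.
Proof. by have := green_inj_gt0 g; rewrite -F_green pmulr_lgt0. Qed.

Let F1 i : F i 1%g = 1%R.
Proof.
have Goo0 : Goo i != 0%R by rewrite gt_eqF.
apply: (mulIf Goo0); rewrite mul1r F_green.
by apply: EFin_inj; rewrite green_factor GooE.
Qed.

Let weight i : R := ((1 - xi_real i) * Goo i)%R.

Let weight_gt0 i : (0 < weight i)%R.
Proof. by rewrite mulr_gt0// subr_gt0 xi_real_lt1. Qed.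

Let head_limit_F i g : head_limit g = (weight i * F i g)%R.
Proof.
apply: EFin_inj; rewrite head_limitE -green_factor -F_green /weight -EFinM.
by congr (_%:E); ring.
Qed.

(** [F i] is proportional to the Green function on the factor, and the constant cancels in the
    ratio. *)
Let slack_F i (g h : Gam i) :
  slack 1 g h = (step_cost 1 g + ln (F i (g * h)%g / F i h))%R.
Proof.
have lnF k : ln (F i k) = (ln (1 - return_real i) + ln (green_real 1 (fp_inj k)) - ln (Goo i))%R.
  rewrite -lnM ?posrE ?green_real_gt0// -F_green lnM ?posrE//; ring.
by rewrite ln_div ?posrE// !lnF /slack; ring.
Qed.

(** [usum] is built on positive and negative parts; for summable families any other splitting into
    nonnegative parts gives the same value. *)
Let usum_sub (T : choiceType) (D : set T) (f g : T -> R) :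
  (forall x, 0 <= f x)%R -> (forall x, 0 <= g x)%R ->
  \esum_(x in D) (f x)%:E < +oo -> \esum_(x in D) (g x)%:E < +oo ->
  usum D (fun x => (f x - g x)%:E) =
  \esum_(x in D) (f x)%:E - \esum_(x in D) (g x)%:E.
Proof.
move=> f0 g0 ff gf.
have summ (h : T -> R) : (forall x, 0 <= h x)%R ->
    \esum_(x in D) (h x)%:E < +oo -> summable D (fun x => (h x)%:E).
  move=> h0; rewrite /summable; congr (_ < _); apply: eq_esum => x _.
  by rewrite gee0_abs ?lee_fin.
apply: (esumB (f := fun x => (f x)%:E) (g := fun x => (g x)%:E)).
- exact: summ.
- exact: summ.
- by move=> x _; rewrite lee_fin.
- by move=> x _; rewrite lee_fin.
Qed.

Let calF i g : \bar R := usum [set g' : Gam i | g' <> 1%g]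
  (fun g' => (F i g' * ln (F i (g * g')%g / F i g'))%:E).

Let head_slack i (g : Gam i) : \bar R :=
  \esum_(h in [set: Gam i]) (head_limit h * slack 1 g h)%:E.

Let hs_ge0 i (g h : Gam i) : (0 < mu i g)%R -> (0 <= head_limit h * slack 1 g h)%R.
Proof. by move=> g0; rewrite mulr_ge0 ?head_limit_ge0 ?slack_ge0. Qed.

Let mean_slack_sum i : mean_slack 1 (head_limit (i := i)) =
  \esum_(g in [set: Gam i]) ((alpha i * mu i g)%:E * head_slack g).
Proof.
rewrite /mean_slack -(esum_pairE (a := fun g h => (slack_term 1 (head_limit (i := i)) (g, h))%:E)).
  apply: eq_esum => g _; rewrite /slack_term /=.
  have [->|gN0] := eqVneq (mu i g) 0%R.
    by rewrite mulr0 mul0e esum1// => h _; rewrite !mul0r.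
  have g0 : (0 < mu i g)%R by rewrite lt_neqAle eq_sym gN0 mu0.
  rewrite -esumZl ?lee_fin//; last by move=> h _; rewrite lee_fin hs_ge0.
  by apply: eq_esum => h _; rewrite -EFinM; congr (_%:E); ring.
by move=> g h; rewrite lee_fin slack_term_ge0// => k; exact: head_limit_ge0.
Qed.

(** It occurs with the positive coefficient [alpha i * mu i g] in the finite sum [mean_slack]. *)
Let head_slack_fin i (g : Gam i) : (0 < mu i g)%R -> head_slack g \is a fin_num.
Proof.
move=> g0; have hs0 : 0 <= head_slack g.
  by apply: esum_ge0 => h _; rewrite lee_fin hs_ge0.
have : (alpha i * mu i g)%:E * head_slack g <= mean_slack 1 (head_limit (i := i)).
  rewrite mean_slack_sum.
  apply: (@le_esum_term _ _ _ (fun g => (alpha i * mu i g)%:E * head_slack g)) => //.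
  move=> k _; have [->|kN0] := eqVneq (mu i k) 0%R; first by rewrite mulr0 mul0e.
  rewrite mule_ge0 ?lee_fin//; apply: esum_ge0 => h _; rewrite lee_fin hs_ge0//.
  by rewrite lt_neqAle eq_sym kN0 mu0.
rewrite -(fineK (mean_slack_limit_fin i)); case: (head_slack g) hs0 => [x||]// _.
by rewrite gt0_muley ?lte_fin ?mulr_gt0.
Qed.

(** Since [F i 1 = 1], [ln (F i g)] is the term [h = 1] of the average of [ln (F i (g h) / F i h)]
    under [head_limit], and [calF] collects the other terms. As [head_limit] has mass [1], that
    average is the mean slack minus the constant [step_cost 1 g]. *)
Let inner_formula i (g : Gam i) : (0 < mu i g)%R ->
  (weight i * ln (F i g))%:E + (weight i)%:E * calF g =
  (fine (head_slack g) - step_cost 1 g)%:E.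
Proof.
move=> g0; pose D : set (Gam i) := [set g' | g' <> 1%g].
have C0 := step_cost_ge0 g h01'.
have w0 := ltW (weight_gt0 i).
pose A : \bar R := \esum_(h in D) (F i h * slack 1 g h)%:E.
pose B : \bar R := \esum_(h in D) (F i h * step_cost 1 g)%:E.
have A0 h : (0 <= F i h * slack 1 g h)%R by rewrite mulr_ge0 ?slack_ge0// ltW.
have B0 h : (0 <= F i h * step_cost 1 g)%R by rewrite mulr_ge0// ltW.
have pos_mul_fin (x : \bar R) : 0 <= x -> (weight i)%:E * x \is a fin_num ->
    x \is a fin_num.
  by case: x => [x||]// _; rewrite gt0_muley ?lte_fin.
have splitD (f : Gam i -> R) : (forall h, 0 <= f h)%R ->
    \esum_(h in [set: Gam i]) (f h)%:E = (f 1%g)%:E + \esum_(h in D) (f h)%:E.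
  move=> f0; rewrite (esumID [set 1%g]); last by move=> x _; rewrite lee_fin.
  rewrite !setTI esum_set1 ?lee_fin//.
have AE : head_slack g = (weight i * (step_cost 1 g + ln (F i g)))%:E + (weight i)%:E * A.
  rewrite /head_slack splitD; last by move=> h; exact: hs_ge0.
  rewrite head_limit_F F1 mulr1 slack_F mulg1 F1 divr1; congr (_ + _).
  rewrite -esumZl ?lee_fin//; last by move=> h _; rewrite lee_fin.
  by apply: eq_esum => h _; rewrite head_limit_F -EFinM mulrA.
(* The cost is spread over [h] with the weights [head_limit], to be subtracted term by term from the
   slack. *)
have BE : (step_cost 1 g)%:E = (weight i * step_cost 1 g)%:E + (weight i)%:E * B.
  rewrite -[LHS]mul1e -(esum_head_limit i) -esumZr ?lee_fin//; last first.
    by move=> h _; rewrite lee_fin head_limit_ge0.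
  under eq_esum do rewrite -EFinM.
  rewrite splitD; last by move=> h; rewrite mulr_ge0// head_limit_ge0.
  rewrite head_limit_F F1 mulr1; congr (_ + _).
  rewrite -esumZl ?lee_fin//; last by move=> h _; rewrite lee_fin.
  by apply: eq_esum => h _; rewrite head_limit_F -EFinM mulrA.
have Afin : A \is a fin_num.
  have Ag0 : 0 <= A by apply: esum_ge0 => h _; rewrite lee_fin.
  have := head_slack_fin g0; rewrite AE fin_numD => /andP[_].
  exact: pos_mul_fin.
have Bfin : B \is a fin_num.
  have Bg0 : 0 <= B by apply: esum_ge0 => h _; rewrite lee_fin.
  have : (step_cost 1 g)%:E \is a fin_num by [].
  by rewrite BE fin_numD => /andP[_]; exact: pos_mul_fin.
have -> : calF g = A - B.
  rewrite /calF -usum_sub//; last 2 first.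
  - by rewrite -ge0_fin_numE//; apply: esum_ge0 => h _; rewrite lee_fin.
  - by rewrite -ge0_fin_numE//; apply: esum_ge0 => h _; rewrite lee_fin.
  by congr usum; apply/funext => h; rewrite slack_F; congr (_%:E); ring.
rewrite AE; move: BE; rewrite -(fineK Afin) -(fineK Bfin) -!EFinM -!EFinD /= => -[BE].
by congr (_%:E); rewrite {2}BE; ring.
Qed.

Lemma drift_limit_formula :
  drift_limit%:E = - (\sum_(i < r) usum [set: Gam i] (fun g =>
    (alpha i * mu i g)%:E *
    ((weight i * ln (F i g))%:E + (weight i)%:E * calF g))).
Proof.
pose E i := mean_slack 1 (head_limit (i := i)).
have cfin i : factor_cost i \is a fin_num.
  rewrite ge0_fin_numE ?factor_cost_fin//.
  by apply: esum_ge0 => g _; rewrite lee_fin cost_term_ge0.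
have usumE i : usum [set: Gam i] (fun g => (alpha i * mu i g)%:E *
    ((weight i * ln (F i g))%:E + (weight i)%:E * calF g)) =
    (fine (E i) - fine (factor_cost i))%:E.
  pose s (g : Gam i) := (alpha i * mu i g * fine (head_slack g))%R.
  have s0 g : (0 <= s g)%R.
    rewrite /s; have [->|gN0] := eqVneq (mu i g) 0%R; first by rewrite mulr0 mul0r.
    rewrite mulr_ge0// fine_ge0//; apply: esum_ge0 => h _; rewrite lee_fin hs_ge0//.
    by rewrite lt_neqAle eq_sym gN0 mu0.
  have sE : \esum_(g in [set: Gam i]) (s g)%:E = E i.
    rewrite /E mean_slack_sum; apply: eq_esum => g _; rewrite /s EFinM.
    have [->|gN0] := eqVneq (mu i g) 0%R; first by rewrite mulr0 !mul0e.
    by rewrite fineK// head_slack_fin// lt_neqAle eq_sym gN0 mu0.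
  have -> : (fun g => (alpha i * mu i g)%:E *
      ((weight i * ln (F i g))%:E + (weight i)%:E * calF g)) =
      (fun g => (s g - alpha i * mu i g * step_cost 1 g)%:E).
    (* [inner_formula] assumes [mu i g > 0]; otherwise the zero factor kills the bracket, whatever
       extended value it has. *)
    apply/funext => g; rewrite /s; have [->|gN0] := eqVneq (mu i g) 0%R.
      by rewrite mulr0 mul0e !mul0r subrr.
    have g0 : (0 < mu i g)%R by rewrite lt_neqAle eq_sym gN0 mu0.
    by rewrite inner_formula// -EFinM; congr (_%:E); ring.
  rewrite usum_sub//.
  - by rewrite sE -/(factor_cost i) EFinB !fineK// mean_slack_limit_fin.
  - by move=> g; exact: cost_term_ge0.
  - rewrite sE -ge0_fin_numE ?mean_slack_limit_fin// -sE.
    by apply: esum_ge0 => g _; rewrite lee_fin.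
  - exact: factor_cost_fin.
rewrite (eq_bigr _ (fun i _ => usumE i)) sumEFin -EFinN; congr (_%:E).
rewrite /drift_limit sumrB opprB; congr (_ - _)%R.
apply: EFin_inj; rewrite fineK ?mean_cost_fin_num// -sumEFin.
by apply: eq_bigr => i _; rewrite fineK.
Qed.

End Formula.
End GreenReal.

(** * Identification of [xi_i] with its definition through return times *)

Section ReturnEvents.
Local Open Scope ereal_scope.
Variables (R : realType) (r : nat) (Gam : 'I_r -> groupType).
Variables (alpha : 'I_r -> R) (mu : forall i, Gam i -> R).
Arguments mu : clear implicits.
Hypotheses (mu_prob : forall i, prob_mass (mu i)) (mu1 : forall i, mu i 1%g = 0%R).
Hypotheses (alpha_gt0 : forall i, (0 < alpha i)%R) (alpha_sum : (\sum_i alpha i = 1)%R).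
Hypothesis Gam_countable : forall i, countable [set: Gam i].

Local Notation nu := (fp_measure alpha mu).
Let nu_prob : prob_mass nu := fp_measure_prob mu_prob mu1 alpha_gt0 alpha_sum.

Context {d : measure_display} {T : measurableType d}.
Variables (P : probability T R) (X : nat -> T -> free_product Gam).
Hypothesis X_walk : random_walk P nu 1%g X.
Variable i : 'I_r.

(* A path that leaves [1] through another factor re-enters the factor [i] only
   at [1], so avoiding [1] after such a first step is the same as avoiding the
   whole factor. *)
Let excursion_avoid (k : nat) (x : free_product Gam) : bool :=
  (k == 0)%N || ((x != 1%g) && ((k == 1)%N ==> ~~ in_factor i x)).

Let restricted_excursion n : restricted_law nu excursion_avoid n = excursion alpha mu i n.
Proof.
elim: n => [|n IH]; first by [].
apply/funext => x; rewrite excursionS /= IH /excursion_avoid /=.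
have [->|xN1] := eqVneq x 1%g; first by rewrite in_factor1.
case: n {IH} => [|n] /=; first by case: in_factor.
by case: ifPn => // xi; rewrite walk_step_excursion_in_factor.
Qed.

Lemma prob_excursion_return n :
  P (return_time X 1%g n `&` [set w | ~ factor_nontriv i (X 1%N w)]) =
  excursion_return alpha mu i n.
Proof.
case: n => [|n] /=.
  by rewrite -[RHS](measure0 P); congr (P _); rewrite -subset0 => w /= [[]].
have Gc := free_product_countable Gam_countable.
rewrite -restricted_excursion -(prob_restricted_step Gc X_walk nu_prob).
congr (P _); apply/seteqP; split => w /=.
  move=> [[_ wn wN] w1]; split => // -[//|k kn]; rewrite /excursion_avoid /=.
  have /eqP kN1 : X k.+1 w <> 1%g by exact: wN.
  rewrite kN1 /=; case: k kn kN1 => //= _ kN1; apply/negP => /in_factorP[g wg].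
  apply: w1; exists g => //= g1; move: kN1; rewrite wg g1.
  by rewrite fp_inj1 eqxx.
move=> [wA wn]; split.
  split => // -[//|k] kn; apply/eqP.
  by have /andP[] := wA k.+1 kn.
move=> [g /= gN1 wg]; case: n wA wn => [|n] wA wn.
  apply: gN1; apply: (@fp_inj_inj _ _ i); rewrite fp_inj1.
  by rewrite wg.
by have /andP[_ /negP] := wA 1%N isT; apply; rewrite -wg in_factor_inj.
Qed.

(** The coefficients of [Hbar] are the excursion return probabilities, and finiteness of
    [return_mass] makes the limit at [z = 1] a genuine sum. *)
Lemma xiE : return_mass alpha mu i < (1 - alpha i)%:E ->
  xi alpha P X i 1 = xi_real alpha mu i.
Proof.
move=> return_lt.
have sum_fin : \esum_(n in [set: nat]) ((1 ^+ n)%:E * excursion_return alpha mu i n)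
    = return_mass alpha mu i.
  by apply: eq_esum => n _; rewrite expr1n mul1e.
have ret0 n : 0 <= excursion_return alpha mu i n by exact: excursion_return_ge0.
have ret_lty : return_mass alpha mu i < +oo by rewrite (lt_trans return_lt) ?ltry.
rewrite /xi /xi_real mulr1; congr (_ / (1 - _))%R; apply: EFin_inj.
rewrite /Hbar (_ : (fun n => fine _) = fun n => fine (excursion_return alpha mu i n));
  last by apply/funext => n; rewrite prob_excursion_return.
rewrite gen_funE ?sum_fin//.
- by rewrite fineK// ge0_fin_numE//; apply: esum_ge0.
- move=> n; rewrite ge0_fin_numE//; apply: le_lt_trans ret_lty.
  by apply: (le_esum_term (D := setT) (t := n)).
Qed.

End ReturnEvents.

Theorem theorem5p1 (R : realType) (r : nat) (Gam : 'I_r -> groupType)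
  (mu : forall i : 'I_r, Gam i -> R) (alpha : 'I_r -> R)
  (d : measure_display) (Om : measurableType d) (P : probability Om R)
  (X : nat -> Om -> free_product Gam)
  (d' : 'I_r -> measure_display) (Om' : forall i : 'I_r, measurableType (d' i))
  (P' : forall i : 'I_r, probability (Om' i) R)
  (Y : forall i : 'I_r, nat -> Om' i -> Gam i)
  (hr : (2 <= r)%N)
  (hfg : forall i, finitely_generated (Gam i))
  (hmu : forall i, prob_mass (mu i))
  (hmu1 : forall i, mu i 1%g = 0)
  (hsupp : forall i, semigroup_generates [set g | mu i g != 0])
  (hexcl : ~ (r = 2%N /\ forall i, ([set: Gam i] #= `I_2)%card))
  (halpha : forall i, 0 < alpha i)
  (halpha1 : \sum_(i < r) alpha i = 1)
  (hX : random_walk P (fp_measure alpha mu) 1%g X)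
  (hY : forall i, random_walk (P' i) (mu i) 1%g (Y i))
  (hent : forall i, (shannon (mu i) < +oo)%E) :
  let xi1 (i : 'I_r) : R := xi alpha P X i 1 in
  let F (i : 'I_r) (g : Gam i) : R := first_passage (P' i) (Y i) g (xi1 i) in
  let Goo (i : 'I_r) : R := green (P' i) (Y i) 1%g (xi1 i) in
  let varrho (i : 'I_r) : R := 1 - (1 - xi1 i) * Goo i in
  let calF (i : 'I_r) (g : Gam i) : \bar R :=
    usum [set g' : Gam i | g' <> 1%g]
      (fun g' => (F i g' * ln (F i (g * g')%g / F i g'))%:E) in
  (fun n : nat => (n%:R^-1)%:E * mean_neg_log P X n)%E @ \oo -->
  (- (\sum_(i < r) usum [set: Gam i] (fun g =>
        (alpha i * mu i g)%:E *
        (((1 - varrho i) * ln (F i g))%:E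
         + ((1 - xi1 i) * Goo i)%:E * calF i g))))%E.
Proof.
move=> xi1 F Goo varrho calF.
have Gc i := finitely_generated_countable (hfg i).
have FGc := free_product_countable Gc.
have nu_prob := fp_measure_prob hmu hmu1 halpha halpha1.
have [green_fin return_lt] :=
  free_product_transient hmu hmu1 halpha halpha1 hsupp hr hexcl.
have r_gt0 : (0 < r)%N by exact: ltnW.
have xi1E i : xi1 i = xi_real alpha mu i.
  exact: (xiE hmu hmu1 halpha halpha1 Gc hX (return_lt i)).
have xi_ge0 i : 0 <= xi1 i.
  by rewrite xi1E ltW// (xi_real_gt0 hmu hmu1 halpha halpha1 return_lt).
have xi_le1 i : xi1 i <= 1.
  by rewrite xi1E ltW// (xi_real_lt1 hmu hmu1 halpha halpha1 return_lt).
have FE i g : (F i g)%:E = hitting_fun (mu i) (xi_real alpha mu i) g.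
  by rewrite -xi1E; apply: (first_passageE (Gc i) (hmu i) (hY i)); rewrite xi_ge0 xi_le1.
have GooE i : (Goo i)%:E = green_fun (mu i) (xi_real alpha mu i) 1%g.
  rewrite -xi1E; apply: (greenE (Gc i) (hmu i) (hY i)) => //.
  (* Convergence of the Green series at [xi_i] comes from the finite Green function of the free
     product. *)
  by rewrite xi1E -(green_factor hmu hmu1 halpha halpha1 hsupp r_gt0 green_fin return_lt) ltry.
have := entropy_rate hmu hmu1 halpha halpha1 hsupp r_gt0 green_fin return_lt hent.
rewrite (drift_limit_formula hmu hmu1 halpha halpha1 hsupp r_gt0 green_fin return_lt hent FE GooE).
have -> : (fun n => (n%:R^-1)%:E * mean_neg_log P X n)%E =
    (fun n => (n%:R^-1)%:E * entropy alpha mu n)%E.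
  by apply/funext => n; rewrite (mean_neg_logE FGc hX nu_prob).
(* The two coefficients in the statement, [1 - varrho i] and [(1 - xi1 i) * Goo i], are the same
   number, the [weight] of the formula. *)
rewrite (_ : (\sum_(i < r) _)%E = \sum_(i < r) usum [set: Gam i] (fun g =>
  (alpha i * mu i g)%:E * (((1 - varrho i) * ln (F i g))%:E
         + ((1 - xi1 i) * Goo i)%:E * calF i g))%E)//.
apply: eq_bigr => i _; congr usum; apply/funext => g.
by rewrite /varrho opprB addrCA subrr addr0 xi1E.
Qed.
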